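(* Let $\tau_A:A\to M$ be a Lie affgebroid modelled on the vector bundle $\tau_V:V\to M$. Denote by $\tau_{A^+}:A^+\to M$ (resp., $\tau_V^*:V^*\to M$) the dual vector bundle to $A$ (resp., to $V$) and by $\mu:A^+\to V^*$ the canonical projection. Then: (i) $\mu:A^+\to V^*$ is an AV-bundle which admits an aff-Poisson structure. (ii) If $h:V^*\to A^+$ is a Hamiltonian section (that is, $h\in\Gamma(\mu)$), then the Hamiltonian vector field of $h$ with respect to the aff-Poisson structure is a vector field on $V^*$ whose integral curves are just the solutions of the Hamilton equations for $h$.
   Context: Everything is smooth. A Lie algebroid $(E,[\cdot,\cdot],\rho)$ over $M$ is a vector bundle $\tau:E\to M$ with a Lie bracket on $\Gamma(E)$ and an anchor $\rho:E\to TM$ with $[X,fY]=f[X,Y]+\rho(X)(f)Y$; $d^E$ is its differential on $\Gamma(\wedge^kE^* )$. **Lie affgebroids.** Let $\tau_A:A\to M$ be an affine bundle modelled on the vector bundle $\tau_V:V\to M$. $A^+=\mathrm{Aff}(A,\mathbb R)\to M$ is the vector bundle whose fibre at $x$ is the space of affine functions on $A_x$; $1_A\in\Gamma(A^+)$ is the constant function $1$; $\tilde A=(A^+)^*$; $i_A:A\to\tilde A$, $i_A(a)(\varphi)=\varphi(a)$, and $i_V:V\to\tilde A$ (its linear part) are the canonical inclusions. A Lie affgebroid structure on $A$ is a Lie bracket $[\cdot,\cdot]_V$ on $\Gamma(V)$, an $\mathbb R$-linear action $D:\Gamma(A)\times\Gamma(V)\to\Gamma(V)$ and an affine map $\rho_A:A\to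 TM$ with $D_X[\bar Y,\bar Z]_V=[D_X\bar Y,\bar Z]_V+[\bar Y,D_X\bar Z]_V$, $D_{X+\bar Y}\bar Z=D_X\bar Z+[\bar Y,\bar Z]_V$, $D_X(f\bar Y)=fD_X\bar Y+\rho_A(X)(f)\bar Y$. It induces a Lie algebroid structure on $\tilde A$ for which $1_A$ is a 1-cocycle, with $[i_V\bar Y,i_V\bar Z]_{\tilde A}=i_V[\bar Y,\bar Z]_V$, $[i_AX,i_V\bar Y]_{\tilde A}=i_V(D_X\bar Y)$, $\rho_{\tilde A}\circ i_A=\rho_A$. **Local data.** $(x^i)$ are local coordinates on $M$ and $\{e_0,e_\alpha\}$ a local basis of $\Gamma(\tilde A)$ with $1_A(e_0)=1$, $1_A(e_\alpha)=0$; $[e_0,e_\alpha]_{\tilde A}=C_{0\alpha}^\gamma e_\gamma$, $[e_\alpha,e_\beta]_{\tilde A}=C_{\alpha\beta}^\gamma e_\gamma$, $\rho_{\tilde A}(e_0)=\rho_0^i\partial_{x^i}$, $\rho_{\tilde A}(e_\alpha)=\rho_\alpha^i\partial_{x^i}$; $(x^i,y_0,y_\alpha)$ and $(x^i,y_\alpha)$ are the induced coordinates on $A^+$ and $V^*$. The projection $\mu:A^+\to V^*$ sends an affine function to its linear part: $\mu(x^i,y_0,y_\alpha)=(x^i,y_\alpha)$. **Hamilton equations.** If a section $h$ of $\mu$ is locally $h(x^i,y_\alpha)=(x^i,-H(x^j,y_\beta),y_\alpha)$, the Hamilton equations for $h$ (a globally defined system on $V^*$) are $$\frac{dx^i}{dt}=\rho_0^i+\frac{\partial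 H}{\partial y_\alpha}\rho_\alpha^i,\qquad \frac{dy_\alpha}{dt}=-\rho_\alpha^i\frac{\partial H}{\partial x^i}+y_\gamma\Big(C_{0\alpha}^\gamma+C_{\beta\alpha}^\gamma\frac{\partial H}{\partial y_\beta}\Big).$$ **AV-bundles and aff-Poisson structures.** An AV-bundle is an affine bundle $\tau_Z:Z\to N$ of rank 1 modelled on the trivial vector bundle $N\times\mathbb R\to N$. Then $\Gamma(\tau_Z)$ is an affine space modelled on $C^\infty(N)$. For $\mu:A^+\to V^*$ the translation action of $\mathbb R$ is $a^++t=a^++t\,1_A(x)$, for $a^+\in A^+_x$ and $t\in\mathbb R$. An aff-Poisson structure on $\tau_Z:Z\to N$ is a bi-affine map $\{\cdot,\cdot\}:\Gamma(\tau_Z)\times\Gamma(\tau_Z)\to C^\infty(N)$ such that: (a) $\{h_1,h_2\}=-\{h_2,h_1\}$; (b) $\{h_1,\{h_2,h_3\}\}_V^2+\{h_2,\{h_3,h_1\}\}_V^2+\{h_3,\{h_1,h_2\}\}_V^2=0$, where $\{\cdot,\cdot\}_V^2$ is the affine-linear part of the bracket, $\{h,f\}_V^2=\{h,h'+f\}-\{h,h'\}$ for $f\in C^\infty(N)$; (c) for every $h\in\Gamma(\tau_Z)$ the map $\{h,\cdot\}:\Gamma(\tau_Z)\to C^\infty(N)$ is an affine derivation, so that its linear part $\{h,\cdot\}_V:C^\infty(N)\to C^\infty(N)$ is a derivation, i.e. a vector field on $N$. This vector field on $N$ is called the Hamiltonian vector field of $h$. In (ii), ''the aff-Poisson structure''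 is the one whose existence is asserted in (i), the same for all $h$. *)

(* Defs.v *)
From HB Require Import structures.
From mathcomp Require Import all_boot all_order all_algebra.
From mathcomp Require Import all_classical all_reals all_analysis.

Set Implicit Arguments.
Unset Strict Implicit.
Unset Printing Implicit Defensive.

Import Order.TTheory GRing.Theory Num.Theory.
Import numFieldNormedType.Exports.

Local Open Scope classical_set_scope.
Local Open Scope ring_scope.

Fixpoint iter_derive (R : realType) (V : normedModType R) (f : V -> R^o)
    (vs : seq V) : V -> R^o :=
  if vs is v :: vs' then (fun x => 'D_v (iter_derive f vs') x) else f.

(* C^oo on the open set O: all iterated directional derivatives exist and are
   continuous there. *)
Definition smooth_in (R : realType) (V : normedModType R) (O : set V)
    (f : V -> R^o) : Prop :=
  forall (vs : seq V) (x : V), O x ->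
    {for x, continuous (iter_derive f vs)} /\
    (forall v : V, derivable (iter_derive f vs) x v).

(* A manifold is presented as a set with an atlas, and carries the topology
   determined by the atlas. *)

Record chart (R : realType) (n : nat) (T : Type) := Chart {
  chart_dom : set T ;
  chart_map :> T -> 'rV[R]_n }.

Record charted (R : realType) (n : nat) := Charted {
  carrier :> Type ;
  atlas : set (chart R n carrier) }.

Section AtlasTopology.
Context {R : realType} {n : nat} (N : charted R n).

HB.instance Definition _ := gen_eqMixin (carrier N).
HB.instance Definition _ := gen_choiceMixin (carrier N).

Definition atlas_open (U : set N) : Prop :=
  forall c, atlas c -> exists2 O : set 'rV[R]_n, open O &
    U `&` chart_dom c = chart_dom c `&` c @^-1` O.

Lemma atlas_openT : atlas_open setT.
Proof.
by move=> c _; exists setT; [exact: openT|rewrite setTI preimage_setT setIT].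
Qed.

Lemma atlas_openI : setI_closed atlas_open.
Proof.
move=> U W opU opW c Ac.
have [P opP UP] := opU c Ac; have [Q opQ WQ] := opW c Ac.
exists (P `&` Q); first exact: openI.
by rewrite preimage_setI -(setIid (chart_dom c)) setIACA UP WQ setIACA setIid.
Qed.

Lemma atlas_open_bigU (I : Type) (f : I -> set N) :
  (forall i, atlas_open (f i)) -> atlas_open (\bigcup_i f i).
Proof.
move=> opf c Ac.
have /choice[Q HQ] : forall i, exists Q : set 'rV[R]_n,
    open Q /\ f i `&` chart_dom c = chart_dom c `&` c @^-1` Q.
  by move=> i; have [Q opQ fQ] := opf i c Ac; exists Q.
exists (\bigcup_i Q i); first by apply: bigcup_open => i _; have [] := HQ i.
rewrite preimage_bigcup setI_bigcupl setI_bigcupr.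
by apply: eq_bigcupr => i _; have [] := HQ i.
Qed.

HB.instance Definition _ := isOpenTopological.Build (carrier N)
  atlas_openT atlas_openI atlas_open_bigU.

End AtlasTopology.

Definition smooth_in_chart (R : realType) (n : nat) (T : Type)
    (c : chart R n T) (U : set T) (f : T -> R) : Prop :=
  exists2 g : 'rV[R]_n -> R^o, smooth_in (c @` (U `&` chart_dom c)) g &
    forall p, U p -> chart_dom c p -> f p = g (c p).

Definition smooth_transition (R : realType) (n : nat) (T : Type)
    (c c' : chart R n T) : Prop :=
  open (c @` (chart_dom c' `&` chart_dom c)) /\
  forall j, smooth_in_chart c (chart_dom c') (fun p => c' p ord0 j).

(* The local coordinate systems of N: charts of the maximal atlas. *)
Definition maximal_atlas (R : realType) (n : nat) (N : charted R n) :
    set (chart R n N) := fun c =>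
  (forall p q, chart_dom c p -> chart_dom c q -> c p = c q -> p = q) /\
  (forall c', atlas c' -> smooth_transition c c' /\ smooth_transition c' c).

Definition smooth_manifold (R : realType) (n : nat) (N : charted R n) : Prop :=
  [/\ forall p : N, exists2 c, atlas c & chart_dom c p,
      @atlas R n N `<=` @maximal_atlas R n N,
      hausdorff_space N
    & @second_countable N].

Definition smooth_on (R : realType) (n : nat) (N : charted R n) (U : set N)
    (f : N -> R) : Prop := forall c, atlas c -> smooth_in_chart c U f.

Definition smooth_fun (R : realType) (n : nat) (N : charted R n)
    (f : N -> R) : Prop := smooth_on setT f.

(* F is smooth on the open set U: it is continuous there and pulls local smooth
   functions back to smooth ones. *)
Definition smooth_map_on (R : realType) (n m : nat) (N : charted R n)
    (N' : charted R m) (U : set N) (F : N -> N') : Prop :=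
  (forall p, U p -> {for p, continuous F}) /\
  (forall (O : set N') (g : N' -> R), open O -> smooth_on O g ->
     smooth_on (U `&` F @^-1` O) (g \o F)).

Definition smooth_map (R : realType) (n m : nat) (N : charted R n)
    (N' : charted R m) (F : N -> N') : Prop := smooth_map_on setT F.

Definition real_line (R : realType) : charted R 1 :=
  {| carrier := R ;
     atlas := [set {| chart_dom := setT ; chart_map := fun t => const_mx t |}] |}.

Definition prod_chart (R : realType) (n m : nat) (S T : Type)
    (c : chart R n S) (d : chart R m T) : chart R (n + m) (S * T) :=
  {| chart_dom := chart_dom c `*` chart_dom d ;
     chart_map := fun p => row_mx (c p.1) (d p.2) |}.

Definition prod_charted (R : realType) (n m : nat) (N : charted R n)
    (N' : charted R m) : charted R (n + m) :=
  {| carrier := N * N' ;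
     atlas := [set prod_chart c d | c in @atlas R n N & d in @atlas R m N'] |}.

(* A tangent vector at x is a derivation at x of the algebra of smooth
   functions; its values on non-smooth functions are irrelevant. *)
Definition tangent_vector (R : realType) (n : nat) (N : charted R n) (x : N)
    (v : (N -> R) -> R) : Prop :=
  (forall (k : R) f g, smooth_fun f -> smooth_fun g ->
     v (fun p => k * f p + g p) = k * v f + v g) /\
  (forall f g, smooth_fun f -> smooth_fun g ->
     v (fun p => f p * g p) = v f * g x + f x * v g).

Definition vector_field (R : realType) (n : nat) (N : charted R n)
    (X : (N -> R) -> (N -> R)) : Prop :=
  (forall f, smooth_fun f -> smooth_fun (X f)) /\
  (forall x, tangent_vector x (X^~ x)).

Definition smooth_curve (R : realType) (n : nat) (N : charted R n) (J : set R)
    (c : R -> N) : Prop := @smooth_map_on R 1 n (real_line R) N J c.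

Definition integral_curve (R : realType) (n : nat) (N : charted R n)
    (X : (N -> R) -> (N -> R)) (J : set R) (c : R -> N) : Prop :=
  forall t, J t -> forall f, smooth_fun f ->
    is_derive (t : R^o) 1 (f \o c : R^o -> R^o) (X f (c t)).

Definition linear_form (R : realType) (L : lmodType R) : {pred L -> R^o} :=
  fun f => `[< linear f >].

Lemma linear_form_submod (R : realType) (L : lmodType R) :
  GRing.submod_closed (@linear_form R L).
Proof.
split; first by apply/asboolP => k u v; rewrite /= scaler0 addr0.
move=> a f g /asboolP lf /asboolP lg; apply/asboolP => k u v.
rewrite /= !fctE lf lg !scalerDr !scalerA (mulrC a k).
by rewrite -!addrA; congr (_ + _); rewrite addrCA.
Qed.

HB.instance Definition _ (R : realType) (L : lmodType R) :=
  GRing.isSubmodClosed.Build R (L -> R^o) (@linear_form R L)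
    (@linear_form_submod R L).

Record dual (R : realType) (L : lmodType R) := Dual {
  dual_fun :> L -> R^o ;
  dual_funP : dual_fun \in @linear_form R L }.

HB.instance Definition _ (R : realType) (L : lmodType R) :=
  [isSub for @dual_fun R L].
HB.instance Definition _ (R : realType) (L : lmodType R) :=
  [Choice of @dual R L by <:].
HB.instance Definition _ (R : realType) (L : lmodType R) :=
  [SubChoice_isSubLmodule of @dual R L by <:].

Record affine_space (R : realType) (L : lmodType R) := AffineSpace {
  apoint :> Type ;
  ashift : apoint -> L -> apoint ;
  ainhab : inhabited apoint ;
  ashift0 : forall a, ashift a 0 = a ;
  ashiftD : forall a u v, ashift a (u + v) = ashift (ashift a u) v ;
  ashift_uniq : forall a b, exists! v, b = ashift a v }.

Notation "a +> v" := (ashift a v) (at level 50, left associativity).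

Definition affine_form (R : realType) (L : lmodType R) (S : affine_space L) :
    {pred S -> R^o} :=
  fun f => `[< exists l : dual L, forall a v, f (a +> v) = f a + l v >].

Lemma affine_form_submod (R : realType) (L : lmodType R) (S : affine_space L) :
  GRing.submod_closed (@affine_form R L S).
Proof.
split; first by apply/asboolP; exists 0 => a v; rewrite /= addr0.
move=> k f g /asboolP[l lf] /asboolP[m mg]; apply/asboolP.
exists (k *: l + m) => a v; rewrite /= !fctE lf mg !scalerDr.
by rewrite addrACA.
Qed.

HB.instance Definition _ (R : realType) (L : lmodType R) (S : affine_space L) :=
  GRing.isSubmodClosed.Build R (S -> R^o) (@affine_form R L S)
    (@affine_form_submod R L S).

Record affine_fun (R : realType) (L : lmodType R) (S : affine_space L) :=
  AffineFun {
    affine_funval :> S -> R^o ;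
    affine_funP : affine_funval \in @affine_form R L S }.

HB.instance Definition _ (R : realType) (L : lmodType R) (S : affine_space L) :=
  [isSub for @affine_funval R L S].
HB.instance Definition _ (R : realType) (L : lmodType R) (S : affine_space L) :=
  [Choice of @affine_fun R L S by <:].
HB.instance Definition _ (R : realType) (L : lmodType R) (S : affine_space L) :=
  [SubChoice_isSubLmodule of @affine_fun R L S by <:].

Definition linear_part (R : realType) (L : lmodType R) (S : affine_space L)
    (phi : affine_fun S) : dual L :=
  sval (cid (asboolW (affine_funP phi))).

Lemma linear_partE (R : realType) (L : lmodType R) (S : affine_space L)
    (phi : affine_fun S) (a : S) (v : L) :
  phi (a +> v) = phi a + linear_part phi v.
Proof. exact: (svalP (cid (asboolW (affine_funP phi)))). Qed.

Lemma affine_one_subproof (R : realType) (L : lmodType R)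
    (S : affine_space L) : (fun=> 1) \in @affine_form R L S.
Proof. by apply/asboolP; exists 0 => a v; rewrite /= addr0. Qed.

Definition affine_one (R : realType) (L : lmodType R) (S : affine_space L) :
  affine_fun S := AffineFun (affine_one_subproof S).

(* incl_point is i_A and incl_vector is i_V, with values in the dual of the
   space of affine functions. *)
Lemma incl_point_subproof (R : realType) (L : lmodType R)
    (S : affine_space L) (a : S) :
  (fun phi : affine_fun S => phi a) \in @linear_form R (affine_fun S).
Proof. by apply/asboolP => k phi psi. Qed.

Definition incl_point (R : realType) (L : lmodType R) (S : affine_space L)
  (a : S) : dual (affine_fun S) := Dual (incl_point_subproof a).

Lemma incl_vector_subproof (R : realType) (L : lmodType R)
    (S : affine_space L) (v : L) :
  (fun phi : affine_fun S => linear_part phi v)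
    \in @linear_form R (affine_fun S).
Proof.
apply/asboolP => k phi psi; have [a] := ainhab S.
have lin (f : affine_fun S) : linear_part f v = f (a +> v) - f a.
  by rewrite linear_partE addrC addKr.
by rewrite !lin /= scalerBr opprD addrACA.
Qed.

Definition incl_vector (R : realType) (L : lmodType R) (S : affine_space L)
  (v : L) : dual (affine_fun S) := Dual (incl_vector_subproof S v).

(* A bundle of rank r over M is a family of vector spaces together with a
   family of local frames that are smooth with respect to one another. A local
   section is a total function, whose values outside its domain are
   irrelevant. *)

Definition is_basis (R : realType) (L : lmodType R) (r : nat)
    (e : 'I_r -> L) : Prop :=
  forall v, exists! k : 'rV[R]_r, v = \sum_(i < r) k ord0 i *: e i.

Record vbundle (R : realType) (n : nat) (M : charted R n) (r : nat) := VBundle {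
  vfibre :> M -> lmodType R ;
  vframes : set (set M * ('I_r -> forall x, vfibre x)) }.

Definition sec (R : realType) (n : nat) (M : charted R n) (r : nat)
  (E : vbundle M r) : Type := forall x, E x.

Definition smooth_sec_on (R : realType) (n : nat) (M : charted R n) (r : nat)
    (E : vbundle M r) (U : set M) (s : sec E) : Prop :=
  forall F, @vframes R n M r E F ->
    exists2 k : 'I_r -> M -> R, (forall i, smooth_on (U `&` F.1) (k i)) &
      forall x, U x -> F.1 x -> s x = \sum_(i < r) k i x *: F.2 i x.

Definition smooth_sec (R : realType) (n : nat) (M : charted R n) (r : nat)
    (E : vbundle M r) (s : sec E) : Prop := smooth_sec_on setT s.

Definition local_frame (R : realType) (n : nat) (M : charted R n) (r : nat)
    (E : vbundle M r) (U : set M) (e : 'I_r -> sec E) : Prop :=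
  [/\ open U, forall x, U x -> is_basis (fun i => e i x)
    & forall i, smooth_sec_on U (e i)].

Definition vector_bundle (R : realType) (n : nat) (M : charted R n) (r : nat)
    (E : vbundle M r) : Prop :=
  (forall x, exists2 F, @vframes R n M r E F & F.1 x) /\
  (forall F, @vframes R n M r E F -> local_frame F.1 F.2).

(* The chart of the total space given by a chart x of M and a local frame e
   sends \sum_i y_i e_i(p) to (x(p), y). *)
Definition total_space (R : realType) (n : nat) (M : charted R n) (r : nat)
    (E : vbundle M r) : charted R (n + r) :=
  {| carrier := {x : M & E x} ;
     atlas := [set c | exists2 d, @atlas R n M d &
       exists2 F, @vframes R n M r E F &
         chart_dom c = [set z | chart_dom d (projT1 z) /\ F.1 (projT1 z)] /\
         forall z, chart_dom c z ->
           lsubmx (c z) = d (projT1 z) /\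
           projT2 z =
             \sum_(i < r) rsubmx (c z) ord0 i *: F.2 i (projT1 z)] |}.

Definition dual_bundle (R : realType) (n : nat) (M : charted R n) (r : nat)
    (E : vbundle M r) : vbundle M r :=
  {| vfibre := fun x => dual (E x) : lmodType R ;
     vframes := [set F : set M * ('I_r -> forall x, dual (E x)) |
       exists2 G, @vframes R n M r E G &
       F.1 = G.1 /\
       forall x, F.1 x -> forall i j : 'I_r, F.2 i x (G.2 j x) = (i == j)%:R] |}.

Definition fibre_coord (R : realType) (n : nat) (M : charted R n) (r : nat)
    (E : vbundle M r) (s : sec (dual_bundle E)) (z : total_space E) : R :=
  s (projT1 z) (projT2 z).

Record abundle (R : realType) (n : nat) (M : charted R n) (r : nat)
    (V : vbundle M r) := ABundle {
  afibre :> forall x, affine_space (V x) ;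
  aorigins : set (set M * (forall x, afibre x)) }.

Definition asec (R : realType) (n : nat) (M : charted R n) (r : nat)
  (V : vbundle M r) (A : abundle V) : Type := forall x, A x.

Definition smooth_asec_on (R : realType) (n : nat) (M : charted R n) (r : nat)
    (V : vbundle M r) (A : abundle V) (U : set M) (X : asec A) : Prop :=
  forall o, @aorigins R n M r V A o ->
    exists2 Y : sec V, smooth_sec_on (U `&` o.1) Y &
      forall x, U x -> o.1 x -> X x = o.2 x +> Y x.

Definition smooth_asec (R : realType) (n : nat) (M : charted R n) (r : nat)
    (V : vbundle M r) (A : abundle V) (X : asec A) : Prop :=
  smooth_asec_on setT X.

Definition affine_bundle (R : realType) (n : nat) (M : charted R n) (r : nat)
    (V : vbundle M r) (A : abundle V) : Prop :=
  (forall x, exists2 o, @aorigins R n M r V A o & o.1 x) /\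
  (forall o, @aorigins R n M r V A o -> open o.1 /\ smooth_asec_on o.1 o.2).

(* A^+: a local origin o of A and a local frame e of V give the frame made of
   the constant 1 and of the affine functions that vanish at o and whose linear
   parts are dual to e. *)
Definition aff_dual (R : realType) (n : nat) (M : charted R n) (r : nat)
    (V : vbundle M r) (A : abundle V) : vbundle M r.+1 :=
  {| vfibre := fun x => affine_fun (A x) : lmodType R ;
     vframes := [set F : set M * ('I_r.+1 -> forall x, affine_fun (A x)) |
       exists2 o, @aorigins R n M r V A o &
       exists2 G, @vframes R n M r V G &
       F.1 = o.1 `&` G.1 /\
       forall x, F.1 x ->
         F.2 ord0 x = affine_one (A x) /\
         forall i : 'I_r, F.2 (lift ord0 i) x (o.2 x) = 0 /\
           forall j : 'I_r, F.2 (lift ord0 i) x (o.2 x +> G.2 j x) = (i == j)%:R] |}.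

Definition bidual (R : realType) (n : nat) (M : charted R n) (r : nat)
    (V : vbundle M r) (A : abundle V) : vbundle M r.+1 :=
  dual_bundle (aff_dual A).

Definition mu (R : realType) (n : nat) (M : charted R n) (r : nat)
    (V : vbundle M r) (A : abundle V) (z : total_space (aff_dual A)) :
    total_space (dual_bundle V) :=
  existT (fun x => dual_bundle V x) (projT1 z) (linear_part (projT2 z)).

Definition mu_shift (R : realType) (n : nat) (M : charted R n) (r : nat)
    (V : vbundle M r) (A : abundle V) (z : total_space (aff_dual A)) (t : R) :
    total_space (aff_dual A) :=
  existT (fun x => aff_dual A x) (projT1 z)
    (projT2 z + t *: affine_one (A (projT1 z))).

Definition lie_bracket (R : realType) (n : nat) (M : charted R n) (r : nat)
    (E : vbundle M r) (br : sec E -> sec E -> sec E) : Prop :=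
  [/\ forall s t, smooth_sec s -> smooth_sec t -> smooth_sec (br s t),
      forall (k : R) s t u, smooth_sec s -> smooth_sec t -> smooth_sec u ->
        forall x, br (fun p => k *: s p + t p) u x = k *: br s u x + br t u x,
      forall s t, smooth_sec s -> smooth_sec t ->
        forall x, br s t x = - br t s x
    & forall s t u, smooth_sec s -> smooth_sec t -> smooth_sec u ->
        forall x, br s (br t u) x + br t (br u s) x + br u (br s t) x = 0].

Record affgebroid (R : realType) (n : nat) (M : charted R n) (r : nat)
    (V : vbundle M r) (A : abundle V) := Affgebroid {
  la_br : sec V -> sec V -> sec V ;
  la_D : asec A -> sec V -> sec V ;
  la_anchor : forall x, A x -> (M -> R) -> R }.

Definition affine_anchor (R : realType) (n : nat) (M : charted R n) (r : nat)
    (V : vbundle M r) (A : abundle V)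
    (rho : forall x, A x -> (M -> R) -> R) : Prop :=
  [/\ forall x (a : A x), tangent_vector x (rho x a),
      forall x f, smooth_fun f -> (rho x)^~ f \in @affine_form R (V x) (A x)
    & forall X f, @smooth_asec R n M r V A X -> smooth_fun f ->
        smooth_fun (fun x => rho x (X x) f)].

Definition lie_affgebroid (R : realType) (n : nat) (M : charted R n) (r : nat)
    (V : vbundle M r) (A : abundle V) (L : affgebroid A) : Prop :=
  let br := la_br L in let D := la_D L in
  [/\ lie_bracket br /\ affine_anchor (la_anchor L),
      forall X Y, smooth_asec X -> smooth_sec Y -> smooth_sec (D X Y),
      forall (k : R) X Y Z, smooth_asec X -> smooth_sec Y -> smooth_sec Z ->
        forall x, D X (fun p => k *: Y p + Z p) x = k *: D X Y x + D X Z x,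
      forall X Y Z, smooth_asec X -> smooth_sec Y -> smooth_sec Z ->
        (forall x, D X (br Y Z) x = br (D X Y) Z x + br Y (D X Z) x) /\
        (forall x, D (fun p => X p +> Y p) Z x = D X Z x + br Y Z x)
    & forall X f Y, smooth_asec X -> smooth_fun f -> smooth_sec Y ->
        forall x, D X (fun p => f p *: Y p) x =
          f x *: D X Y x + la_anchor L (X x) f *: Y x].

(* The anchor and the bracket of the Lie algebroid structure induced on the
   bidual, on the elements i_A(a), i_V(v) and on the pairs of sections
   (i_A X, i_V Y), (i_V Y, i_V Z). Up to local extension, these are all the
   values that enter the structure functions of a frame {e_0, e_alpha} with
   1_A(e_0) = 1 and 1_A(e_alpha) = 0. *)
Inductive bidual_anchor (R : realType) (n : nat) (M : charted R n) (r : nat)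
    (V : vbundle M r) (A : abundle V) (L : affgebroid A) (x : M) :
    bidual A x -> ((M -> R) -> R) -> Prop :=
| bidual_anchor_point (a : A x) :
    bidual_anchor L (incl_point a) (la_anchor L a)
| bidual_anchor_vector (a : A x) (v : V x) :
    bidual_anchor L (incl_vector (A x) v)
      (fun f => la_anchor L (a +> v) f - la_anchor L a f).

Inductive bidual_bracket (R : realType) (n : nat) (M : charted R n) (r : nat)
    (V : vbundle M r) (A : abundle V) (L : affgebroid A) :
    sec (bidual A) -> sec (bidual A) -> sec (bidual A) -> Prop :=
| bidual_bracket_point (X : asec A) (Y : sec V) :
    smooth_asec X -> smooth_sec Y ->
    bidual_bracket L (fun x => incl_point (X x))
      (fun x => incl_vector (A x) (Y x))
      (fun x => incl_vector (A x) (la_D L X Y x))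
| bidual_bracket_vector (Y Z : sec V) :
    smooth_sec Y -> smooth_sec Z ->
    bidual_bracket L (fun x => incl_vector (A x) (Y x))
      (fun x => incl_vector (A x) (Z x))
      (fun x => incl_vector (A x) (la_br L Y Z x)).

(* Index 0 of 'I_r.+1 stands for e_0, and lift ord0 alpha for e_alpha;
   ld_C a beta gamma is the coefficient of e_gamma in [e_a, e_beta]. *)
Record local_data (R : realType) (n : nat) (M : charted R n) (r : nat)
    (V : vbundle M r) (A : abundle V) := LocalData {
  ld_x : chart R n M ;
  ld_e : 'I_r.+1 -> sec (bidual A) ;
  ld_y : total_space (dual_bundle V) -> 'rV[R]_r ;
  ld_rho : 'I_r.+1 -> 'I_n -> M -> R ;
  ld_C : 'I_r.+1 -> 'I_r -> 'I_r -> M -> R }.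

Definition is_local_data (R : realType) (n : nat) (M : charted R n) (r : nat)
    (V : vbundle M r) (A : abundle V) (L : affgebroid A)
    (d : local_data A) : Prop :=
  let x := ld_x d in let e := ld_e d in let U := chart_dom x in
  [/\ [/\ @maximal_atlas R n M x, local_frame U e,
          forall p, U p -> e ord0 p (affine_one (A p)) = 1
        & forall p, U p -> forall i, e (lift ord0 i) p (affine_one (A p)) = 0],
      (forall z : total_space (aff_dual A), U (projT1 z) ->
         forall i, ld_y d (mu z) ord0 i = fibre_coord (e (lift ord0 i)) z),
      (forall p, U p -> forall a v, bidual_anchor L (e a p) v ->
         forall (f : M -> R) (g : 'rV[R]_n -> R^o), smooth_fun f ->
           (forall q, U q -> f q = g (x q)) ->
           v f = \sum_(i < n) ld_rho d a i p * 'D_(delta_mx 0 i) g (x p))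
    & (forall p, U p -> forall a b s t w, bidual_bracket L s t w ->
         (\forall q \near p, s q = e a q) ->
         (\forall q \near p, t q = e (lift ord0 b) q) ->
         w p = \sum_(c < r) ld_C d a b c p *: e (lift ord0 c) p)].

(* h(x, y) = (x, - H(x, y), y) *)
Definition local_hamiltonian (R : realType) (n : nat) (M : charted R n)
    (r : nat) (V : vbundle M r) (A : abundle V) (d : local_data A)
    (h : total_space (dual_bundle V) -> total_space (aff_dual A))
    (H : 'rV[R]_n -> 'rV[R]_r -> R^o) : Prop :=
  forall w : total_space (dual_bundle V), chart_dom (ld_x d) (projT1 w) ->
    fibre_coord (ld_e d ord0) (h w) = - H (ld_x d (projT1 w)) (ld_y d w).

Definition hamilton_equations (R : realType) (n : nat) (M : charted R n)
    (r : nat) (V : vbundle M r) (A : abundle V) (d : local_data A)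
    (H : 'rV[R]_n -> 'rV[R]_r -> R^o) (c : R -> total_space (dual_bundle V))
    (t : R) : Prop :=
  let p := projT1 (c t) in
  let x := ld_x d p in let y := ld_y d (c t) in
  let rho := fun a i => ld_rho d a i p in
  let C := fun a b g => ld_C d a b g p in
  let Hx := fun i : 'I_n => 'D_(delta_mx 0 i) (H^~ y) x in
  let Hy := fun b : 'I_r => 'D_(delta_mx 0 b) (H x) y in
  (forall i : 'I_n,
     is_derive (t : R^o) 1
       (fun s : R^o => ld_x d (projT1 (c s)) ord0 i : R^o)
       (rho ord0 i + \sum_(b < r) Hy b * rho (lift ord0 b) i)) /\
  (forall a : 'I_r,
     is_derive (t : R^o) 1 (fun s : R^o => ld_y d (c s) ord0 a : R^o)
       (- (\sum_(i < n) rho (lift ord0 a) i * Hx i) +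
        \sum_(g < r) y ord0 g *
          (C ord0 a g + \sum_(b < r) C (lift ord0 b) a g * Hy b))).

Definition hamilton_solution (R : realType) (n : nat) (M : charted R n)
    (r : nat) (V : vbundle M r) (A : abundle V) (L : affgebroid A)
    (h : total_space (dual_bundle V) -> total_space (aff_dual A)) (J : set R)
    (c : R -> total_space (dual_bundle V)) : Prop :=
  forall t, J t -> forall (d : local_data A) H, is_local_data L d ->
    local_hamiltonian d h H -> chart_dom (ld_x d) (projT1 (c t)) ->
    hamilton_equations d H c t.

Section AVBundle.
Context {R : realType} {m n : nat} {Z : charted R m} {N : charted R n}.
Variables (tau : Z -> N) (shift : Z -> R -> Z).

(* Phi is a local trivialization U x R -> tau^-1(U), with inverse (tau, theta),
   affine with linear part the identity on fibres. *)
Definition av_trivialization (U : set N) (Phi : prod_charted N (real_line R) -> Z)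
    (theta : Z -> R) : Prop :=
  [/\ smooth_map_on (U `*` setT : set (prod_charted N (real_line R))) Phi,
      smooth_on (tau @^-1` U) theta,
      forall q t, U q -> tau (Phi (q, t)) = q /\ theta (Phi (q, t)) = t,
      forall z, U (tau z) -> Phi (tau z, theta z) = z
    & forall q s t, U q -> Phi (q, s + t) = shift (Phi (q, s)) t].

Definition av_bundle : Prop :=
  [/\ [/\ smooth_manifold Z, smooth_manifold N, smooth_map tau
        & forall q, exists z, tau z = q],
      forall z, shift z 0 = z,
      forall z s t, shift z (s + t) = shift (shift z s) t,
      (forall z t, tau (shift z t) = tau z) /\
      (forall z z', tau z = tau z' -> exists! t, z' = shift z t)
    & forall q, exists U Phi theta,
        [/\ open U, U q & av_trivialization U Phi theta]].

Definition av_section (h : N -> Z) : Prop :=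
  smooth_map h /\ forall q, tau (h q) = q.

Definition sec_shift (h : N -> Z) (f : N -> R) : N -> Z :=
  fun q => shift (h q) (f q).

Definition affine_on_sections (Phi : (N -> Z) -> (N -> R)) : Prop :=
  exists2 l : (N -> R) -> (N -> R),
    (forall (k : R) f g, smooth_fun f -> smooth_fun g ->
       forall q, l (fun p => k * f p + g p) q = k * l f q + l g q) &
    (forall h f, av_section h -> smooth_fun f ->
       forall q, Phi (sec_shift h f) q = Phi h q + l f q).

(* {h, f}_V^2 = {h, h' + f} - {h, h'} does not depend on h' when {h, .} is
   affine; the choice h' = h is made. *)
Definition affine_linear_part (B : (N -> Z) -> (N -> Z) -> (N -> R))
    (h : N -> Z) (f : N -> R) : N -> R :=
  fun q => B h (sec_shift h f) q - B h h q.

Definition aff_poisson (B : (N -> Z) -> (N -> Z) -> (N -> R)) : Prop :=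
  let B2 := affine_linear_part B in
  [/\ forall h1 h2, av_section h1 -> av_section h2 -> smooth_fun (B h1 h2),
      forall h, av_section h ->
        affine_on_sections (B h) /\ affine_on_sections (B^~ h),
      forall h1 h2, av_section h1 -> av_section h2 ->
        forall q, B h1 h2 q = - B h2 h1 q,
      forall h1 h2 h3, av_section h1 -> av_section h2 -> av_section h3 ->
        forall q, B2 h1 (B h2 h3) q + B2 h2 (B h3 h1) q + B2 h3 (B h1 h2) q = 0
    & forall h, av_section h -> vector_field (B2 h)].

Definition hamiltonian_vector_field (B : (N -> Z) -> (N -> Z) -> (N -> R))
    (h : N -> Z) : (N -> R) -> (N -> R) := affine_linear_part B h.

End AVBundle.

(* Main.v *)
(* A global section X of A, glued from local ones, identifies A^+ with V^* x R and
   hence the sections h of mu with functions H on V^*. The Lie algebroid V induces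
   a linear Poisson bracket on V^*, and (rho_A o X, D_X) induces a vector field X'
   on V^* which is a derivation of this bracket. Then
     {h1, h2} = X'(H1 - H2) - {H1, H2}
   is an aff-Poisson structure: in the Jacobi identity the terms X'X'(Hi - Hj)
   telescope, and the others cancel because X' is a derivation. The Hamiltonian
   vector field of h is X' + {H, .}; it does not depend on X, and when X extends
   e_0 its components in the coordinates (x, y) are the right-hand sides of the
   Hamilton equations. Identities between vector fields on V^* need only be checked
   on the functions f o pi and on the fibrewise linear functions l_Y, because
   coordinates are of this form and, by Hadamard's lemma, a derivation is
   determined by its values on coordinates. *)

From Stdlib Require Eqdep_dec.
Require Import Defs.
From mathcomp Require Import all_boot all_order all_algebra.
From mathcomp Require Import all_classical all_reals all_analysis.
From mathcomp Require Import ring lra.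

Set Implicit Arguments.
Unset Strict Implicit.
Unset Printing Implicit Defensive.

Import Order.TTheory GRing.Theory Num.Theory.
Import numFieldNormedType.Exports.

Local Open Scope classical_set_scope.
Local Open Scope ring_scope.

(** * Calculus on row vectors *)

(** Tangent vectors act on global functions, and brackets on global sections. Whatever is local is
    therefore first made global with bump functions, whose existence rests on the Hausdorff axiom;
    second countability reduces the local sections blended into X to countably many. The vector
    fields on V^* are not glued. At each covector, values prescribed on the functions f o pi and l_Y
    come from a unique tangent vector as soon as they obey the Leibniz rule, and the resulting
    family is smooth as soon as the values are. One choice per point gives X'; the Poisson bracket
    is built in the same way, in one slot and then in the other. Second-order terms need no
    coordinates: the failure of X' to preserve the bracket, and the Jacobiator, are derivations in
    each argument, so that they vanish if they vanish on generators. The definition of smoothness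
    provides directional derivatives only. Differentiability, on which the chain rule rests, is
    derived from the continuity of the partial derivatives. *)

Section Calculus.
Context {R : realType}.

Lemma is_derive_line (V : normedModType R) (f : V -> R^o) (a v : V) (s : R) :
  derivable f (a + s *: v) v ->
  is_derive (s : R^o) 1 (fun t : R^o => f (a + t *: v)) ('D_v f (a + s *: v)).
Proof.
have E : (fun h : R => h^-1 *: (((fun t : R^o => f (a + t *: v)) \o shift (s : R^o))
    (h *: 1) - f (a + s *: v))) =
  (fun h : R => h^-1 *: ((f \o shift (a + s *: v)) (h *: v) - f (a + s *: v))).
  by apply/funext => h /=; rewrite [h *: 1]mulr1 scalerDl addrCA.
by move=> df; apply: DeriveDef; rewrite /derivable /derive E.
Qed.

(** Directional derivatives are all that [smooth_in] provides, so [phi] is only assumed derivable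
    along [v]. Restricted to the line h |-> h v + x it is differentiable, and differentials
    compose. *)
Lemma derive_comp (V W : normedModType R) (phi : V -> W) (g : W -> R^o) x v :
  derivable phi x v -> differentiable g (phi x) ->
  is_derive x v (g \o phi) ('D_('D_v phi x) g (phi x)).
Proof.
move=> dphi dg.
pose psi (h : R^o) := phi (h *: v + x).
have psi0 : psi 0 = phi x by rewrite /psi scale0r add0r.
have dpsi : differentiable psi (0 : R^o).
  by apply/derivable1_diffP; move/derivable1P : dphi.
have dg0 : differentiable g (psi 0) by rewrite psi0.
have dgpsi : differentiable (g \o psi) (0 : R^o) by exact: differentiable_comp.
have Dline (W' : normedModType R) (f : V -> W') :
    'D_v f x = 'D_1 (fun h : R^o => f (h *: v + x)) (0 : R^o).
  rewrite /derive (_ : (fun h => _) = (fun h : R => h^-1 *: (((fun h : R^o => f (h *: v + x))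
    \o shift (0 : R^o)) (h *: 1) - f (0 *: v + x))))//.
  by apply/funext => h /=; rewrite [h *: 1]mulr1 addr0 scale0r add0r.
apply: DeriveDef.
  by apply/derivable1P; apply/derivable1_diffP.
rewrite (Dline _ (g \o phi)) (deriveE _ dgpsi) diff_comp//= (Dline _ phi).
by rewrite (deriveE _ dpsi) -psi0 (deriveE _ dg0).
Qed.

Lemma derive1_scale (g : R^o -> R^o) (x v : R) :
  differentiable g (x : R^o) -> 'D_v g x = v * 'D_1 g x.
Proof.
move=> dg; rewrite !deriveE//.
by rewrite -[in LHS](mulr1 v) -[v * 1]/(v *: (1 : R^o)) linearZ.
Qed.

(** The derivative peeled off here is the innermost one, whereas [iter_derive] exposes the outermost
    one. Inductions on [k] can then apply their hypothesis to the first derivatives of a sum, a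
    product or an inverse. *)
Fixpoint Ck (V : normedModType R) (k : nat) (O : set V) (f : V -> R^o) : Prop :=
  (forall x, O x -> {for x, continuous f}) /\
  if k is k'.+1 then
    forall v, (forall x, O x -> derivable f x v) /\ Ck k' O (fun x => 'D_v f x)
  else True.

Section Ck_theory.
Context {V : normedModType R}.
Implicit Types (O : set V) (f g : V -> R^o).

Lemma Ck_cont k O f x : Ck k O f -> O x -> {for x, continuous f}.
Proof. by case: k => [|k] [+ _]; exact. Qed.

Lemma Ck_derivable k O f x v : Ck k.+1 O f -> O x -> derivable f x v.
Proof. by move=> [_ /(_ v)[+ _]]; exact. Qed.

Lemma Ck_derive k O f v : Ck k.+1 O f -> Ck k O (fun x => 'D_v f x).
Proof. by move=> [_ /(_ v)[]]. Qed.

Lemma CkW k O f : Ck k.+1 O f -> Ck k O f.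
Proof.
elim: k f => [|k IH] f [cf df]; split=> // v; have [dvf Ck1] := df v.
by split=> //; exact: IH.
Qed.

Lemma smooth_inP O f : smooth_in O f <-> forall k, Ck k O f.
Proof.
(* The last direction of the list is the one along which [f] is differentiated first. *)
have E vs v x : iter_derive f (rcons vs v) x = iter_derive (fun x => 'D_v f x) vs x.
  elim: vs x => //= w vs IH x; rewrite (_ : iter_derive f _ = iter_derive (fun x => 'D_v f x) vs) //.
  exact/funext.
split=> [sf k|].
  elim: k f E sf => [|k IH] f E sf; first by split=> // x Ox; have [] := sf [::] x Ox.
  split=> [x Ox|v]; first by have [] := sf [::] x Ox.
  split=> [x Ox|]; first by have [_] := sf [::] x Ox; exact.
  apply: IH => [vs w x|vs x Ox].
    elim: vs x => //= u vs IH x; rewrite (_ : iter_derive (fun x0 => 'D_v f x0) (rcons vs w) =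
       iter_derive (fun x => 'D_w (fun x => 'D_v f x) x) vs) //.
    exact/funext.
  rewrite (_ : iter_derive _ vs = iter_derive f (rcons vs v)).
    exact: sf.
  by apply/funext => y; rewrite E.
move=> Cf vs x Ox.
elim/last_ind: vs f Cf E => [|vs v IH] f Cf E.
  by split; [exact: (Ck_cont (Cf 0))|move=> v; exact: (Ck_derivable (Cf 1) Ox)].
rewrite (_ : iter_derive f _ = iter_derive (fun x => 'D_v f x) vs); last exact/funext.
apply: IH => [k|ws w y]; first exact: Ck_derive (Cf k.+1).
elim: ws y => //= u ws IH y; rewrite (_ : iter_derive (fun x0 => 'D_v f x0) (rcons ws w) =
       iter_derive (fun x => 'D_w (fun x => 'D_v f x) x) ws) //.
exact/funext.
Qed.

Lemma open_near_eq O f g x : open O -> O x -> (forall y, O y -> f y = g y) ->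
  \near x, f x = g x.
Proof. by move=> oO Ox fg; near=> y; apply: fg; near: y; exact: open_nbhs_nbhs. Unshelve. all: by end_near. Qed.

Lemma near_eq_cont f g x : (\near x, f x = g x) -> {for x, continuous f} ->
  {for x, continuous g}.
Proof.
move=> fg cf; have fgx := nbhs_singleton fg; rewrite /prop_for /continuous_at -fgx.
by apply: cvg_trans cf; apply: near_eq_cvg; apply: filterS fg => y ->.
Qed.

Lemma Ck_eq k O f g : open O -> (forall x, O x -> f x = g x) ->
  Ck k O f -> Ck k O g.
Proof.
move=> oO; elim: k f g => [|k IH] f g fg [cf df].
  by split=> // x Ox; exact: near_eq_cont (open_near_eq oO Ox fg) (cf x Ox).
split=> [x Ox|v]; first exact: near_eq_cont (open_near_eq oO Ox fg) (cf x Ox).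
have [dvf Cf] := df v; split=> [x Ox|].
  exact: near_eq_derivable (open_near_eq oO Ox fg) (dvf x Ox).
by apply: IH Cf => x Ox; apply: near_eq_derive; exact: open_near_eq fg.
Qed.

Lemma Ck_sub k O P f : P `<=` O -> Ck k O f -> Ck k P f.
Proof.
move=> PO; elim: k f => [|k IH] f [cf df]; split=> //; first by move=> x /PO; exact: cf.
  by move=> x /PO; exact: cf.
by move=> v; have [dvf Cf] := df v; split; [move=> x /PO; exact: dvf|exact: IH].
Qed.

Lemma Ck_cst k O (c : R) : Ck k O (fun=> c).
Proof.
elim: k c => [|k IH] c; (split=> [x _|//]; first exact: cst_continuous) => v.
split=> [x _|]; first exact: derivable_cst.
have -> : 'D_v (fun=> c) = (fun=> 0 : R^o) :> (V -> R^o).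
  by apply/funext => x; rewrite derive_cst.
exact: IH.
Qed.

Lemma Ck_add k O f g : open O -> Ck k O f -> Ck k O g ->
  Ck k O (fun x => f x + g x).
Proof.
move=> oO; elim: k f g => [|k IH] f g Cf Cg; split=> //.
- by move=> x Ox; apply: continuousD; [exact: Ck_cont Cf Ox|exact: Ck_cont Cg Ox].
- by move=> x Ox; apply: continuousD; [exact: Ck_cont Cf Ox|exact: Ck_cont Cg Ox].
move=> v; split=> [x Ox|].
  by apply: derivableD; [exact: Ck_derivable Cf Ox|exact: Ck_derivable Cg Ox].
apply: (@Ck_eq _ _ (fun x => 'D_v f x + 'D_v g x)) => // [x Ox|].
  by rewrite -deriveD//; [exact: Ck_derivable Cf Ox|exact: Ck_derivable Cg Ox].
by apply: IH; exact: Ck_derive.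
Qed.

Lemma Ck_mul k O f g : open O -> Ck k O f -> Ck k O g ->
  Ck k O (fun x => f x * g x).
Proof.
move=> oO; elim: k f g => [|k IH] f g Cf Cg; split=> //.
- by move=> x Ox; apply: continuousM; [exact: Ck_cont Cf Ox|exact: Ck_cont Cg Ox].
- by move=> x Ox; apply: continuousM; [exact: Ck_cont Cf Ox|exact: Ck_cont Cg Ox].
move=> v; split=> [x Ox|].
  by apply: derivableM; [exact: Ck_derivable Cf Ox|exact: Ck_derivable Cg Ox].
apply: (@Ck_eq _ _ (fun x => f x * 'D_v g x + g x * 'D_v f x)) => // [x Ox|].
  by rewrite -[LHS](@deriveM _ _ f g)//; [exact: Ck_derivable Cf Ox|exact: Ck_derivable Cg Ox].
by apply: Ck_add => //; apply: IH; try exact: Ck_derive; exact: CkW.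
Qed.

Lemma Ck_sum k O (I : finType) (F : I -> V -> R^o) : open O ->
  (forall i, Ck k O (F i)) -> Ck k O (fun x => \sum_i F i x).
Proof.
move=> oO CF.
rewrite (_ : (fun x => _) = \big[(fun f g x => f x + g x)/(fun=> 0)]_i F i).
  by elim/big_ind : _ => // [|f g Cf Cg]; [exact: Ck_cst|exact: Ck_add].
by apply/funext => x; elim/big_rec2 : _ => // i y f _ ->.
Qed.

Lemma Ck_inv k O f : open O -> Ck k O f -> (forall x, O x -> f x != 0) ->
  Ck k O (fun x => (f x)^-1).
Proof.
move=> oO; elim: k f => [|k IH] f Cf f0; split=> //.
- by move=> x Ox; apply: continuousV; [exact: f0|exact: Ck_cont Cf Ox].
- by move=> x Ox; apply: continuousV; [exact: f0|exact: Ck_cont Cf Ox].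
move=> v; split=> [x Ox|].
  by apply: derivableV; [exact: f0|exact: Ck_derivable Cf Ox].
apply: (@Ck_eq _ _ (fun x => (-1) * (((f x)^-1 * (f x)^-1) * 'D_v f x))) => // [x Ox|].
  rewrite [RHS](@deriveV _ _ f)//; [|exact: f0|exact: Ck_derivable Cf Ox].
  by rewrite mulN1r /GRing.scale/= -mulNr expr2 invfM.
apply: Ck_mul => //; first exact: Ck_cst.
by apply: Ck_mul; [done| |exact: Ck_derive]; apply: Ck_mul => //; apply: IH => //; exact: CkW.
Qed.

(** A whole sequence, each term being the derivative of the preceding one, lets the induction pass
    from [G j] to [G j.+1]. It is meant for the family [flat_exp]. *)
Lemma Ck_comp1 (G : nat -> R^o -> R^o) k j O f : open O ->
  (forall i x, is_derive (x : R^o) 1 (G i) (G i.+1 x)) -> Ck k O f ->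
  Ck k O (G j \o f).
Proof.
move=> oO dG; elim: k j f => [|k IH] j f Cf.
  split=> // x Ox; apply: continuous_comp; first exact: Ck_cont Cf Ox.
  by apply: differentiable_continuous; apply/derivable1_diffP; have [] := dG j (f x).
have diffG y : differentiable (G j) (y : R^o).
  by apply/derivable1_diffP; have [] := dG j y.
split=> [x Ox|v].
  by apply: continuous_comp; [exact: Ck_cont Cf Ox|exact: differentiable_continuous].
have H x : O x -> is_derive x v (G j \o f) ('D_('D_v f x) (G j) (f x)).
  by move=> Ox; apply: derive_comp => //; exact: Ck_derivable Cf Ox.
split=> [x /H[]//|].
apply: (@Ck_eq _ _ (fun x => 'D_v f x * (G j.+1 \o f) x)) => // [x Ox|].
  have [_ ->] := H x Ox; rewrite derive1_scale//.
  by have [_ ->] := dG j (f x).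
by apply: Ck_mul => //; [exact: Ck_derive|apply: IH; exact: CkW].
Qed.

End Ck_theory.

End Calculus.

(** * Mean value estimates and differentiability of C^1 functions *)

Section RowVectorCalculus.
Context {R : realType}.

(** Mean value theorem along the segment, which is parametrized by t in [0, 1] so that [h] may have
    any sign. *)
Lemma segment_bound (V : normedModType R) (f : V -> R^o) (a e : V) (h C : R) :
  (forall t : R, 0 <= t <= 1 -> derivable f (a + (t * h) *: e) e /\
     `|'D_e f (a + (t * h) *: e)| <= C) ->
  `|f (a + h *: e) - f a| <= C * `|h|.
Proof.
move=> H.
pose G := fun t : R => f (a + (t * h) *: e) : R.
have dG (t : R) : 0 <= t <= 1 -> is_derive t 1 G ('D_e f (a + (t * h) *: e) * h).
  move=> /H[df _].
  have d1 : is_derive (t * h) 1 (fun s : R^o => f (a + s *: e) : R^o)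
      ('D_e f (a + (t * h) *: e)) by exact: is_derive_line.
  have d2 : is_derive t 1 (fun s : R => s * h) h.
    have d3 : is_derive (t : R^o) 1 (fun s : R^o => s : R^o) 1 by exact: is_derive_id.
    by apply: is_derive_eq; rewrite scaler0 add0r /GRing.scale/= mulr1.
  exact: (@is_derive1_comp R (fun s => f (a + s *: e)) (fun s => s * h)).
have [||c c01] := @MVT_segment R G (fun t => 'D_e f (a + (t * h) *: e) * h) 0 1 ler01.
- by move=> t; rewrite in_itv/= => /andP[t0 t1]; apply: dG; rewrite !ltW.
- apply: derivable_within_continuous => t; rewrite in_itv/= => t01.
  by have [] := dG t t01.
rewrite /G mul1r mul0r scale0r addr0 subr0 mulr1 => ->.
rewrite normrM; apply: ler_wpM2r => //; by have [] := H c; rewrite in_itv/= in c01.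
Qed.

(** The path from [x] to [y] changes one coordinate at a time. It stays in the ball because balls of
    row vectors are boxes. *)
Lemma rV_lipschitz n (f : 'rV[R]_n -> R^o) (x0 : 'rV[R]_n) (d C : R) :
  (forall z, ball x0 d z -> forall i, derivable f z (delta_mx 0 i) /\
     `|'D_(delta_mx 0 i) f z| <= C) ->
  forall x y, ball x0 d x -> ball x0 d y ->
  `|f y - f x| <= C * \sum_i `|y 0 i - x 0 i|.
Proof.
move=> H x y Bx By.
pose p k : 'rV[R]_n := \row_i (if (i < k)%N then y 0 i else x 0 i).
have p0 : p 0%N = x by apply/rowP => i; rewrite mxE.
have pn : p n = y by apply/rowP => i; rewrite mxE ltn_ord.
have pS (k : 'I_n) : p k.+1 = p k + (y 0 k - x 0 k) *: delta_mx 0 k.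
  apply/rowP => i; rewrite !mxE/= ltnS leq_eqVlt.
  case: (eqVneq i k) => [->|ik]; first by rewrite ltnn eqxx/= mulr1 addrC subrK.
  have -> : (i == k :> nat) = false by apply/negbTE.
  by rewrite mulr0 addr0.
rewrite -pn -p0 -(@telescope_sumr _ 0 n (fun k => f (p k))) ?leq0n//.
rewrite big_mkord pn p0 (le_trans (ler_norm_sum _ _ _))// mulr_sumr ler_sum// => k _.
rewrite pS; apply: segment_bound => t /andP[t0 t1]; apply: H.
have [d0 Bx'] := Bx; have [_ By'] := By; split=> // a i.
rewrite ord1 !mxE/=.
have bx := Bx' 0 i; have by_ := By' 0 i.
case: (eqVneq i k) => [eik|ik]; last by rewrite mulr0 addr0; case: ifP.
rewrite eik in bx by_ *; rewrite ltnn mulr1.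
move: bx by_; rewrite /ball/= => bx by_.
rewrite (_ : _ - _ = (1 - t) * (x0 0 k - x 0 k) + t * (x0 0 k - y 0 k)); last first.
  by rewrite !mulrBr !mulrBl !mul1r; lra.
have := ler_normD ((1 - t) * (x0 0 k - x 0 k)) (t * (x0 0 k - y 0 k)).
rewrite !normrM (ger0_norm t0) ger0_norm ?subr_ge0// => /le_lt_trans; apply.
set A := `|_|; set B := `|_|; have mx : Num.max A B < d by rewrite gt_max bx by_.
apply: le_lt_trans mx; rewrite (_ : Num.max A B = (1 - t) * Num.max A B + t * Num.max A B); last by lra.
by rewrite lerD// ler_wpM2l ?subr_ge0// le_max lexx ?orbT.
Qed.

Lemma rV_coord_norm n (x : 'rV[R]_n) i : `|x 0 i| <= `|x|.
Proof.
rewrite [leRHS]/Num.Def.normr/= mx_normrE.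
by apply: le_trans; last exact: (@le_bigmax _ _ _ _ _ (0, i)).
Qed.

Lemma rV_norm_sum n (x : 'rV[R]_n) : \sum_i `|x 0 i| <= n%:R * `|x|.
Proof.
apply: (@le_trans _ _ (\sum_(i < n) `|x|)); first by apply: ler_sum => i _; exact: rV_coord_norm.
by rewrite sumr_const card_ord mulr_natl.
Qed.

Lemma near_forall_ord (V : normedModType R) n (x0 : V) (P : 'I_n -> V -> Prop) :
  (forall i, \forall x \near x0, P i x) -> \forall x \near x0, forall i, P i x.
Proof. exact: filter_forall. Qed.

Lemma norm_bound_continuous (V : normedModType R) (f : V -> R^o) (x0 : V) (d C : R) :
  0 < d -> (forall x, ball x0 d x -> `|f x - f x0| <= C * `|x - x0|) ->
  {for x0, continuous f}.
Proof.
move=> d0 H; apply/cvgrPdist_le => e e0; near=> x.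
have K0 : 0 < `|C| + 1 by rewrite ltr_wpDl.
rewrite distrC (le_trans (H x _))//; first by near: x; exact: nbhsx_ballx.
rewrite (le_trans (y := (`|C| + 1) * `|x - x0|))//.
  by rewrite ler_wpM2r// (le_trans (ler_norm C))// lerDl.
rewrite mulrC -ler_pdivlMr// distrC.
by near: x; apply: cvgr_dist_le => //; rewrite divr_gt0.
Unshelve. all: by end_near. Qed.

Lemma rV_dist_sum n (x y : 'rV[R]_n) : \sum_i `|x 0 i - y 0 i| <= n%:R * `|x - y|.
Proof.
apply: le_trans (rV_norm_sum (x - y)); apply: ler_sum => i _.
by rewrite !mxE.
Qed.

Lemma derive_coord n (i : 'I_n) (v x : 'rV[R]_n) :
  'D_v (fun x : 'rV[R]_n => x 0 i : R^o) x = v 0 i.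
Proof.
rewrite deriveE; last exact: differentiable_coord.
have @f : {linear 'rV[R]_n -> R^o}.
  by exists (fun N : 'rV[R]_n => N 0 i); do 2![eexists]; do ?[constructor];
     rewrite ?mxE// => ? *; rewrite ?mxE//; move=> ?; rewrite !mxE.
rewrite (_ : (fun _ => _) = f) // diff_lin//; exact: coord_continuous.
Qed.

Lemma Ck_coord n k O (i : 'I_n) : Ck k O (fun x : 'rV[R]_n => x 0 i : R^o).
Proof.
case: k => [|k]; first by split=> // x _; exact: coord_continuous.
split=> [x _|v]; first exact: coord_continuous.
split=> [x _|]; first exact/diff_derivable/differentiable_coord.
have -> : 'D_v (fun x : 'rV[R]_n => x 0 i : R^o) = (fun=> v 0 i : R^o).
  by apply/funext => x; exact: derive_coord.
exact: Ck_cst.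
Qed.

(** Let [L] be the linear form made of the partial derivatives of [f] at [x0]. Those of f - L are
    small near [x0], hence f - L has a small Lipschitz constant there, which is the required
    estimate. *)
Lemma C1_differentiable n (O : set 'rV[R]_n) (f : 'rV[R]_n -> R^o) x0 :
  open O -> Ck 1 O f -> O x0 -> differentiable f x0.
Proof.
move=> oO Cf Ox0.
pose c i := 'D_(delta_mx 0 i) f x0 : R.
have [L [cL dL]] : exists L : {linear 'rV[R]_n -> R^o}, continuous (L : _ -> R^o) /\
    forall i x, 'D_(delta_mx 0 i) (L : _ -> R^o) x = c i.
  have @L : {linear 'rV[R]_n -> R^o}.
    exists (fun x : 'rV[R]_n => \sum_i c i * x 0 i : R^o); do 2![eexists]; do ?[constructor].
    - by rewrite big1// => i _; rewrite mxE mulr0.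
    - by move=> x y; rewrite -big_split/=; apply: eq_bigr => i _; rewrite mxE mulrDr.
    - by move=> a x; rewrite /GRing.scale/= mulr_sumr; apply: eq_bigr => i _; rewrite mxE mulrCA.
  have CL k P : open P -> Ck k P (L : _ -> R^o).
    move=> oP; rewrite (_ : (L : _ -> _) = (fun x => \sum_i (c i) * x 0 i))//.
    by apply: Ck_sum => // i; apply: Ck_mul => //; [exact: Ck_cst|exact: Ck_coord].
  have cL : continuous (L : _ -> R^o) by move=> x; exact: (Ck_cont (CL 0 setT openT)).
  exists L; split=> // i x; rewrite deriveE; last exact: linear_differentiable.
  rewrite diff_lin// [L _]/= /GRing.Linear.sort/= (bigD1 i)//= big1 ?addr0 ?mxE ?eqxx ?mulr1// => j ji.
  by rewrite mxE (negbTE ji) andbF mulr0.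
have H : f \o shift x0 = cst (f x0) + (L : _ -> R^o) +o_ (0 : 'rV[R]_n) id.
  apply/eqaddoP => e e0.
  (* The factor absorbs the comparison of the sum of the absolute values of the [n] coordinates with
     the norm. *)
  pose e' := e / n.+1%:R.
  have e'0 : 0 < e' by rewrite divr_gt0.
  have : \forall x \near x0, O x /\ forall i, `|c i - 'D_(delta_mx 0 i) f x| <= e'.
    apply: filterI; first exact: open_nbhs_nbhs.
    apply: (@near_forall_ord 'rV[R]_n n x0 (fun i x => `|c i - 'D_(delta_mx 0 i) f x| <= e')) => i.
    have := Ck_cont (Ck_derive (delta_mx 0 i) Cf) Ox0.
    by move=> /cvgrPdist_le/(_ _ e'0).
  move=> /nbhs_ballP[d/= d0 Bd].
  have : \forall h \near (0 : 'rV[R]_n), ball x0 d (h + x0).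
    have : nbhs (0 : 'rV[R]_n) (ball (0 : 'rV[R]_n) d) by exact: nbhsx_ballx.
    apply: filterS => h; rewrite mx_norm_ball /ball_/= sub0r normrN => hd.
    by rewrite opprD addrCA subrr addr0 normrN.
  apply: filterS => h Bh.
  have Hl := @rV_lipschitz n (fun x => f x - L x) x0 d e' _ x0 (h + x0) (ballxx _ d0) Bh.
  change (`|f (h + x0) - (f x0 + L h)| <= e * `|h|); move: Hl; rewrite linearD => Hl.
  rewrite (_ : f (h + x0) - _ = f (h + x0) - (L h + L x0) - (f x0 - L x0)); last first.
    have E4 (p q r s : R) : p - (q + r) = p - (r + s) - (q - s) by ring.
    exact: E4.
  apply: le_trans (Hl _) _ => [z Bz i|].
    have [Oz cz] := Bd z Bz.
    have dfz : derivable f z (delta_mx 0 i) by exact: Ck_derivable Cf Oz.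
    have dLz : derivable (L : _ -> R^o) z (delta_mx 0 i).
      exact/diff_derivable/linear_differentiable.
    split; first exact: derivableB.
    by rewrite deriveB// dL distrC.
  rewrite (_ : \sum_i _ = \sum_i `|h 0 i|); last first.
    by apply: eq_bigr => i _; rewrite mxE addrK.
  rewrite (le_trans (y := e' * (n%:R * `|h|)))//.
    by rewrite ler_wpM2l ?(ltW e'0)// rV_norm_sum.
  by rewrite mulrA ler_wpM2r// /e' mulrAC ler_pdivrMr// ler_wpM2l ?(ltW e0)// ler_nat.
have dE : 'd f x0 = L :> (_ -> _) by exact: diff_unique.
apply/diff_locallyP; rewrite dE; split=> //.
Qed.

Lemma derive_rV n (f : 'rV[R]_n -> R^o) (x v : 'rV[R]_n) : differentiable f x ->
  'D_v f x = \sum_i v 0 i * 'D_(delta_mx 0 i) f x.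
Proof.
move=> df; rewrite deriveE// [in LHS](row_sum_delta v) linear_sum.
by apply: eq_bigr => i _; rewrite linearZ deriveE.
Qed.

Lemma Ck_comp (V : normedModType R) n k (O : set V) (O' : set 'rV[R]_n)
    (g : 'rV[R]_n -> R^o) (phi : V -> 'rV[R]_n) :
  open O -> open O' -> (forall x, O x -> O' (phi x)) ->
  Ck k O' g -> (forall j, Ck k O (fun x => phi x 0 j : R^o)) -> Ck k O (g \o phi).
Proof.
move=> oO oO' OO'; elim: k g => [|k IH] g Cg Cphi.
  split=> // x Ox; apply: continuous_comp; last exact: Ck_cont Cg (OO' _ Ox).
  apply/cvgrPdist_le => e e0; near=> y.
  rewrite [leLHS]/Num.Def.normr/= mx_normrE (bigmax_le _ (ltW e0))//= => i _.
  rewrite !mxE/= ord1; move: i.2; near: y; apply: filter_forall => j.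
  by have /cvgrPdist_le/(_ _ e0) := Ck_cont (Cphi j) Ox.
have Cphi' j := CkW (Cphi j).
have Cg1 : Ck 1 O' g by elim: (k) Cg => // l IHl /CkW.
split=> [x Ox|v].
  exact: (Ck_cont (IH g (CkW Cg) Cphi') Ox).
have dphi x : O x -> derivable phi x v.
  move=> Ox; apply/derivable_mxP => i j; rewrite ord1.
  exact: Ck_derivable (Cphi j) Ox.
have H x : O x -> is_derive x v (g \o phi) ('D_('D_v phi x) g (phi x)).
  move=> Ox; apply: derive_comp; first exact: dphi.
  by apply: C1_differentiable Cg1 _ => //; exact: OO'.
split=> [x /H[]//|].
apply: (@Ck_eq _ _ _ _ (fun x => \sum_j 'D_v (fun y => phi y 0 j : R^o) x *
  ('D_(delta_mx 0 j) g \o phi) x)) => // [x Ox|].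
  have [_ ->] := H x Ox; rewrite derive_rV; last first.
    by apply: C1_differentiable Cg1 _ => //; exact: OO'.
  by apply: eq_bigr => j _; rewrite derive_mx ?mxE//; exact: dphi.
apply: Ck_sum => // j; apply: Ck_mul => //; first exact: Ck_derive.
by apply: IH => //; exact: Ck_derive.
Unshelve. all: by end_near. Qed.

End RowVectorCalculus.

(** * Bump functions on row vectors *)

Section BumpFunction.
Context {R : realType}.

(* x |-> p(1/x) exp(-1/x), extended by 0 to x <= 0: a family of functions that
   is stable under derivation. *)
Definition flat_exp (p : {poly R}) (x : R^o) : R^o :=
  if 0 < x then p.[x^-1] * expR (- x^-1) else 0.

(** For positive [m], raise t / m <= exp (t / m) to the power [m]. *)
Lemma pow_le_expR (m : nat) (t : R) : 0 <= t -> t ^+ m <= m%:R ^+ m * expR t.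
Proof.
case: m => [|m] t0; first by rewrite !expr0 mul1r -expR0 ler_expR.
have H : t / m.+1%:R <= expR (t / m.+1%:R).
  by rewrite (le_trans _ (expR_ge1Dx _))// lerDr.
have -> : expR t = expR (t / m.+1%:R) ^+ m.+1.
  by rewrite -expRM_natl mulrC divfK// pnatr_eq0.
rewrite -exprMn ler_pXn2r ?nnegrE ?mulr_ge0 ?expR_ge0//.
by rewrite mulrC -ler_pdivrMr// ltr0n.
Qed.

(** With t = 1 / h, the polynomial is at most A t^s while exp t dominates t^(s+2); the two spare
    powers of t are the factor h^2. Quadratic decay is what makes the difference quotients at 0 tend
    to 0. *)
Lemma flat_exp_bound (p : {poly R}) :
  exists2 C, 0 <= C & forall h, 0 < h <= 1 -> `|flat_exp p h| <= C * h ^+ 2.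
Proof.
pose A := \sum_(i < size p) `|p`_i|; pose s := size p.
have A0 : 0 <= A by rewrite sumr_ge0.
have [K [K0 HK]] : exists K : R, 0 <= K /\ forall t, 0 <= t -> t ^+ s.+2 <= K * expR t.
  by exists ((s.+2)%:R ^+ s.+2); split; [exact: exprn_ge0|exact: pow_le_expR].
exists (A * K); first exact: mulr_ge0.
move=> h /andP[h0 h1]; rewrite /flat_exp h0.
have [t [t1 ->]] : exists t : R, 1 <= t /\ h = t^-1.
  by exists h^-1; rewrite invrK invf_ge1.
have t0 : 0 < t by rewrite (lt_le_trans ltr01).
rewrite invrK normrM (ger0_norm (expR_ge0 _)) expRN.
have B1 : `|p.[t]| <= A * t ^+ s.
  rewrite horner_coef (le_trans (ler_norm_sum _ _ _))// mulr_suml ler_sum// => i _.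
  rewrite normrM ler_wpM2l// normrX (ger0_norm (ltW t0)).
  by rewrite ler_weXn2l// ltnW// .
rewrite ler_pdivrMr ?expR_gt0// (le_trans B1)// -!mulrA ler_wpM2l//.
rewrite (_ : t ^+ s = t^-1 * (t^-1 * t ^+ s.+2)); last first.
  by rewrite !exprS !mulKf ?gt_eqF.
rewrite (_ : K * _ = t^-1 * (t^-1 * (K * expR t))); last by ring.
by do 2 rewrite ler_wpM2l ?invr_ge0 ?(ltW t0)//; exact: HK (ltW t0).
Qed.

(** For positive x, the derivative of p(1/x) exp(-1/x) is x^-2 (p - p')(1/x) exp(-1/x), again of the
    same form. At 0 the difference quotient is O(h) by [flat_exp_bound]. *)
Lemma is_derive_flat_exp (p : {poly R}) (x : R) :
  is_derive (x : R^o) 1 (flat_exp p) (flat_exp ('X^2 * (p - p^`())) x).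
Proof.
have [x0|x0|->] := ltgtP x 0.
- rewrite {2}/flat_exp ltNge (ltW x0)/=.
  apply: (@near_eq_is_derive _ R^o R^o (fun=> 0)).
  near=> y; rewrite /flat_exp ltNge (_ : y <= 0)//.
  by apply: ltW; near: y; exact: lt_nbhsl.
- rewrite {2}/flat_exp x0.
  have x_neq0 : x != 0 by rewrite gt_eqF.
  have dV : is_derive x 1 (fun y : R => y^-1) (- x ^- 2).
    have did : is_derive (x : R^o) 1 (fun y : R^o => y : R^o) 1 by exact: is_derive_id.
    have := @is_deriveV R (fun y => y) x 1 1 x_neq0 did.
    by rewrite /GRing.scale/= mulr1.
  have dE : is_derive x 1 (fun y : R => expR (- y^-1)) (expR (- x^-1) * x ^- 2).
    apply: (@is_derive1_comp R expR (fun y => - y^-1)).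
    by rewrite -[x ^- 2]opprK; exact: is_deriveN.
  have dp : is_derive x 1 (fun y : R => p.[y^-1]) (p^`().[x^-1] * - x ^- 2).
    exact: (@is_derive1_comp R (horner p) (fun y => y^-1)).
  apply: (@near_eq_is_derive _ R^o R^o (fun y => p.[y^-1] * expR (- y^-1))).
    near=> y; rewrite /flat_exp (_ : 0 < y)//; near: y; exact: lt_nbhsr.
  have -> : ('X^2 * (p - p^`())).[x^-1] * expR (- x^-1) =
     p.[x^-1] *: (expR (- x^-1) * x ^- 2) + expR (- x^-1) *: (p^`().[x^-1] * - x ^- 2).
    rewrite /GRing.scale/= hornerM hornerXn hornerD hornerN exprVn; ring.
  exact: (@is_deriveM R R^o).
- rewrite [X in is_derive _ _ _ X]/flat_exp ltxx.
  have [C C0 HC] := flat_exp_bound p.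
  have H : h^-1 *: ((flat_exp p \o shift (0 : R^o)) (h *: (1 : R^o)) - flat_exp p 0)
      @[h --> (0 : R^o)^'] --> (0 : R^o).
    apply/cvgrPdist_le => e e0; near=> h.
    rewrite /= /shift/= addr0 [h *: 1]mulr1 {2}/flat_exp ltxx subr0 sub0r normrN.
    have [h0|h0] := ltP 0 h; last first.
      by rewrite /flat_exp ltNge h0/= scaler0 normr0 ltW.
    rewrite normrM (ger0_norm (_ : 0 <= h^-1)) ?invr_ge0 ?(ltW h0)//.
    rewrite mulrC ler_pdivrMr// (le_trans (HC h _))//.
      by rewrite h0/= -(ger0_norm (ltW h0)); near: h; apply: dnbhs0_le.
    rewrite expr2 mulrA ler_wpM2r ?(ltW h0)//.
    rewrite (le_trans (y := (C + 1) * h))//; first by rewrite ler_wpM2r ?(ltW h0)// lerDl.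
    rewrite mulrC -ler_pdivlMr ?ltr_wpDl// -(ger0_norm (ltW h0)).
    by near: h; apply: dnbhs0_le; rewrite divr_gt0// ltr_wpDl.
  apply: DeriveDef; first by apply/cvg_ex; exists 0.
  exact: cvg_lim H.
Unshelve. all: by end_near. Qed.

Lemma flat_exp1_gt0 (x : R) : 0 < x -> 0 < flat_exp 1 x.
Proof. by move=> x0; rewrite /flat_exp x0 hornerC mul1r expR_gt0. Qed.

Lemma flat_exp1_ge0 (x : R) : 0 <= flat_exp 1 x.
Proof. by rewrite /flat_exp; case: ifP => // _; rewrite hornerC mul1r expR_ge0. Qed.

Lemma flat_exp1_le0 (x : R) : x <= 0 -> flat_exp 1 x = 0.
Proof. by move=> x0; rewrite /flat_exp ltNge x0. Qed.

Lemma Ck_flat_exp (V : normedModType R) k (O : set V) (f : V -> R^o) :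
  open O -> Ck k O f -> Ck k O (fun x => flat_exp 1 (f x)).
Proof.
move=> oO Cf; pose T p : {poly R} := 'X^2 * (p - p^`()).
apply: (@Ck_comp1 _ _ (fun j => flat_exp (iter j T 1)) k 0 O f) => // i x.
exact: is_derive_flat_exp.
Qed.

(** Writing psi for [flat_exp 1], the quotient psi(u) / (psi(u) + psi(1 - u)) is 1 for u >= 1 and 0
    for u <= 0. The argument [u] decreases with [q], the squared Euclidean distance, which is smooth
    whereas the norm of row vectors is not. *)
Lemma bump_rV n (a : 'rV[R]_n) (e : R) : 0 < e -> exists chi : 'rV[R]_n -> R^o,
  [/\ forall k, Ck k setT chi, exists2 d, 0 < d & forall x, ball a d x -> chi x = 1
    & forall x, chi x != 0 -> `|a - x| <= e].
Proof.
move=> e0; pose q (x : 'rV[R]_n) : R^o := \sum_i (x 0 i - a 0 i) * (x 0 i - a 0 i).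
pose d := e / 2; have d0 : 0 < d by rewrite divr_gt0.
have d20 : 0 < d ^+ 2 by rewrite exprn_gt0.
pose u (x : 'rV[R]_n) : R^o := 2 - (d ^+ 2)^-1 * q x.
pose den x : R^o := flat_exp 1 (u x) + flat_exp 1 (1 - u x).
have Cu k : Ck k setT u.
  apply: Ck_add; [exact: openT|exact: Ck_cst|].
  rewrite (_ : (fun x => _) = (fun x => - (d ^+ 2)^-1 * q x)); last first.
    by apply/funext => x; rewrite mulNr.
  apply: Ck_mul; [exact: openT|exact: Ck_cst|].
  apply: Ck_sum => [|i]; first exact: openT.
  by apply: Ck_mul; try exact: openT; apply: Ck_add; try exact: openT; try exact: Ck_coord; exact: Ck_cst.
have q0 x : 0 <= q x by apply: sumr_ge0 => i _; rewrite -expr2 sqr_ge0.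
have den0 x : den x != 0.
  rewrite gt_eqF// /den.
  have [u0|u0] := ltP 0 (u x); first by rewrite ltr_pwDl ?flat_exp1_gt0// flat_exp1_ge0.
  by rewrite ltr_wpDl ?flat_exp1_ge0// flat_exp1_gt0// subr_gt0 (le_lt_trans u0).
exists (fun x => flat_exp 1 (u x) * (den x)^-1); split.
- move=> k; apply: Ck_mul; first exact: openT.
    by apply: Ck_flat_exp => //; exact: openT.
  apply: Ck_inv => //; first exact: openT.
  apply: Ck_add; try exact: openT.
    by apply: Ck_flat_exp => //; exact: openT.
  apply: Ck_flat_exp; first exact: openT.
  apply: Ck_add; [exact: openT|exact: Ck_cst|].
  rewrite (_ : (fun x => - u x) = (fun x => (-1) * u x)); last by apply/funext => x; rewrite mulN1r.
  by apply: Ck_mul => //; [exact: openT|exact: Ck_cst].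
(* On this box, q <= n (d / (n + 1))^2 <= d^2, that is u >= 1. *)
- exists (d / n.+1%:R) => [|x ax]; first by rewrite divr_gt0.
  have u1 : 1 <= u x.
    rewrite /u lerBrDr addrC -lerBrDr (_ : 2 - 1 = 1 :> R); last by lra.
    rewrite mulrC ler_pdivrMr// mul1r.
    apply: (@le_trans _ _ (\sum_(i < n) (d / n.+1%:R) ^+ 2)).
      apply: ler_sum => i _; rewrite -expr2 -real_normK ?num_real//.
      have [_ /(_ 0 i)] := ax; rewrite /ball/= distrC => /ltW axi.
      by rewrite ler_pXn2r ?nnegrE ?(ltW (divr_gt0 _ _))// divr_ge0// ltW.
    rewrite sumr_const card_ord expr_div_n -[leLHS]mulr_natr -mulrA ler_piMr ?(ltW d20)//.
    rewrite mulrC ler_pdivrMr ?exprn_gt0// mul1r -natrX ler_nat.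
    by rewrite (leq_trans (leqnSn n))// -{1}[n.+1]expn1 leq_pexp2l.
  rewrite /den (flat_exp1_le0 (x := 1 - u x)) ?subr_le0// addr0 divff// gt_eqF// flat_exp1_gt0//.
  by rewrite (lt_le_trans ltr01).
- move=> x; apply: contra_neqT; rewrite -ltNge => ax.
  have u0 : u x <= 0.
    rewrite /u subr_le0 mulrC ler_pdivlMr//.
    have [i] : exists i, `|(a - x) 0 i| = `|a - x|.
      have ax0 : mx_norm (a - x) != 0.
        by rewrite gt_eqF// (lt_trans e0).
      have [[j i]/= E] := mx_norm_neq0 ax0; exists i.
      by rewrite [RHS]/Num.Def.normr/= E (ord1 j).
    rewrite !mxE => aE.
    apply: (@le_trans _ _ (e ^+ 2)).
      rewrite (_ : 2 * d ^+ 2 = e ^+ 2 / 2); last by rewrite /d; field.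
      by rewrite ler_pdivrMr// ler_peMr ?sqr_ge0// ler1n.
    rewrite /q (bigD1 i)//= -expr2 -[(x _ _ - _) ^+ 2]real_normK ?num_real// distrC aE.
    rewrite (le_trans (y := `|a - x| ^+ 2))//.
      by rewrite ler_pXn2r ?nnegrE ?(ltW e0)// ltW.
    by rewrite lerDl sumr_ge0// => j _; rewrite -expr2 sqr_ge0.
  by rewrite flat_exp1_le0// mul0r.
Qed.

End BumpFunction.

(** * Hadamard's lemma *)

Section Hadamard.
Context {R : realType}.
Local Notation mu := (@lebesgue_measure R).
Local Notation I01 := (`[0, 1]%classic : set R).

Lemma is_derive_cvg (V : normedModType R) (f : V -> R^o) (x v : V) (l : R) :
  h^-1 *: (f (x + h *: v) - f x) @[h --> (0 : R)^'] --> (l : R^o) -> is_derive x v f l.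
Proof.
have E : (fun h : R => h^-1 *: ((f \o shift x) (h *: v) - f x)) =
   (fun h => h^-1 *: (f (x + h *: v) - f x)).
  by apply/funext => h; rewrite /= [h *: v + x]addrC.
move=> H; apply: DeriveDef; first by rewrite /derivable E; apply/cvg_ex; exists l.
by rewrite /derive E; apply: (@cvg_lim R^o).
Qed.

Lemma continuous_integrable01 (f : R -> R) :
  (forall t, 0 <= t <= 1 -> {for t, continuous f}) ->
  mu.-integrable I01 (EFin \o f).
Proof.
move=> cf; apply: continuous_compact_integrable; first exact: segment_compact.
apply: continuous_in_subspaceT => t; rewrite inE/= in_itv/=; exact: cf.
Qed.

Lemma Rintegral01_bound (f : R -> R) C :
  (forall t, 0 <= t <= 1 -> {for t, continuous f}) ->
  (forall t, 0 <= t <= 1 -> `|f t| <= C) -> `|\int[mu]_(t in I01) f t| <= C.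
Proof.
move=> cf fC.
have C0 : 0 <= C by rewrite (le_trans (normr_ge0 _) (fC 0 _))// lexx ler01.
rewrite (le_trans (le_normr_Rintegral _ _))//; first exact: continuous_integrable01.
have -> : C = \int[mu]_(t in I01) C.
  by rewrite Rintegral_cst//= lebesgue_measure_itv/= lte_fin ltr01 oppr0 adde0 mulr1.
apply: le_Rintegral => //.
- apply: continuous_integrable01 => t t01.
  by apply: continuous_comp; [exact: cf|exact: norm_continuous].
- by apply: continuous_integrable01 => t t01; exact: cst_continuous.
Qed.

Lemma Rintegral01_sum n (f : 'I_n -> R -> R) :
  (forall i t, 0 <= t <= 1 -> {for t, continuous (f i)}) ->
  \int[mu]_(t in I01) (\sum_i f i t) = \sum_i \int[mu]_(t in I01) f i t.
Proof.
move=> cf.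
elim: (index_enum _) => [|i s IH].
  rewrite big_nil (_ : (fun t => _) = fun=> 0); last by apply/funext => t; rewrite big_nil.
  by rewrite Rintegral_cst ?mul0r.
rewrite big_cons -IH (_ : (fun t => _) = fun t => f i t + \sum_(j <- s) f j t); last first.
  by apply/funext => t; rewrite big_cons.
rewrite RintegralD//; first by apply: continuous_integrable01 => t; exact: cf.
apply: continuous_integrable01 => t t01.
elim: s {IH} => [|j s IH].
  rewrite (_ : (fun t => _) = fun=> 0); last by apply/funext => u; rewrite big_nil.
  exact: cst_continuous.
rewrite (_ : (fun t => _) = fun t => f j t + \sum_(j <- s) f j t); last first.
  by apply/funext => u; rewrite big_cons.
by apply: continuousD => //; exact: cf.
Qed.

Variable n : nat.
Implicit Types (F : 'rV[R]_n -> R^o) (a x v : 'rV[R]_n).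

Definition radial a x (t : R) : 'rV[R]_n := a + t *: (x - a).

Lemma radial_ball a x (e t : R) : 0 <= t <= 1 -> ball a e x -> ball a e (radial a x t).
Proof.
move=> /andP[t0 t1]; rewrite mx_norm_ball /ball_/= /radial => ax.
rewrite opprD addrA subrr sub0r normrN normrZ (ger0_norm t0) distrC (le_lt_trans _ ax)//.
by rewrite ler_piMl.
Qed.

(** Differentiating along [v] replaces [F] by its derivative and [m] by [m.+1]. The weight thus
    makes the family stable under derivation; Hadamard's lemma itself has weight 1. *)
Definition radial_mean a (m : nat) F x : R^o :=
  \int[mu]_(t in I01) (t ^+ m * F (radial a x t)).

Section Ball.
Variables (a : 'rV[R]_n) (e : R).
Hypothesis e0 : 0 < e.
Let P := ball a (e / 2).

Lemma half_ball : P `<=` ball a e.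
Proof. by apply: le_ball; rewrite ler_pdivrMr// ler_peMr ?ler1n// ltW. Qed.

Lemma continuous_radial m F x t : Ck 0 (ball a e) F -> ball a e x -> 0 <= t <= 1 ->
  {for t, continuous (fun t : R => t ^+ m * F (radial a x t) : R)}.
Proof.
move=> CF ax t01; apply: continuousM; first exact: exprn_continuous.
apply: continuous_comp; last by apply: (Ck_cont CF); exact: radial_ball.
apply: continuousD; first exact: cst_continuous.
exact: scalel_continuous.
Qed.

(** The reason for halving the radius: the closed half ball is compact and still contained in the
    domain. *)
Lemma bounded_on_half F : Ck 0 (ball a e) F -> exists2 C, 0 <= C &
  forall y, P y -> `|F y| <= C.
Proof.
move=> CF.
pose K := closed_ball a (e / 2).
have e20 : 0 < e / 2 by rewrite divr_gt0.
have Ke : K `<=` ball a e.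
  apply: (@closed_ball_subset R 'rV[R]_n); first by rewrite divr_gt0.
  by rewrite ltr_pdivrMr// ltr_pMr// ltr1n.
have cK : compact K.
  apply: bounded_closed_compact; last exact: closed_ball_closed.
  exists (`|a| + e / 2); split=> [|M aM y]; first exact: num_real.
  rewrite /K closed_ballE// /closed_ball_/= => ay.
  rewrite (le_trans _ (ltW aM))// -(subrK a y) addrC (le_trans (ler_normD _ _))//.
  by rewrite lerD2l distrC.
have [||c _ cM] := @compact_EVT_max 'rV[R]_n R (fun y => `|F y|) K _ cK.
- by exists a; exact: closed_ballxx.
- apply: continuous_in_subspaceT => y /set_mem Ky.
  by apply: continuous_comp; [apply: (Ck_cont CF); exact: Ke|exact: norm_continuous].
exists `|F c| => // y Py; apply: cM; apply/mem_set; exact: subset_closed_ball.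
Qed.

Lemma radial_mean_bounded m F : Ck 0 (ball a e) F ->
  exists2 C, 0 <= C & forall y, P y -> `|radial_mean a m F y| <= C.
Proof.
move=> CF; have [C C0 FC] := bounded_on_half CF.
exists C => // y Py; apply: Rintegral01_bound => t t01.
  by apply: continuous_radial => //; exact: half_ball.
have /andP[t0 t1] := t01.
rewrite normrM (le_trans (y := 1 * C))//; last by rewrite mul1r.
rewrite ler_pM//; last by apply: FC; exact: radial_ball.
by rewrite normrX (ger0_norm t0) exprn_ile1.
Qed.

(** Differentiation under the integral sign along s |-> x + s v. The bound of the derivative of [F]
    on the half ball serves as a constant dominating function. *)
Lemma is_derive_radial_mean m F x v : Ck 1 (ball a e) F -> P x ->
  is_derive x v (radial_mean a m F) (radial_mean a m.+1 (fun y => 'D_v F y) x).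
Proof.
move=> CF Px.
pose f (s t : R) : R := t ^+ m * F (radial a (x + s *: v) t).
have : \forall s \near (0 : R), P (x + s *: v).
  have c0 : {for (0 : R), continuous (fun s : R => x + s *: v)}.
    apply: continuousD; first exact: cst_continuous.
    exact: scalel_continuous.
  apply: c0; rewrite scale0r addr0; apply: open_nbhs_nbhs; split=> //.
  exact: (@ball_open R 'rV[R]_n).
move=> /nbhs_ballP[d/= d0 Bd].
have Ps (s : R) : `]-d, d[%classic s -> P (x + s *: v).
  by rewrite /= in_itv/= => sd; apply: Bd; rewrite /ball/= sub0r normrN ltr_norml.
have dF (s t : R) : `]-d, d[%classic s -> 0 <= t <= 1 ->
    is_derive s 1 (fun s => f s t) (t ^+ m.+1 * 'D_v F (radial a (x + s *: v) t)).
  move=> Is t01.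
  have E s' : radial a (x + s' *: v) t = radial a x t + s' *: (t *: v).
    by rewrite /radial addrAC scalerDr scalerA mulrC -scalerA addrA.
  have By : ball a e (radial a (x + s *: v) t).
    by apply: radial_ball => //; apply: half_ball; exact: Ps.
  have oB : open (ball a e) by exact: (@ball_open R 'rV[R]_n).
  have dfF := C1_differentiable oB CF By.
  have dl : is_derive (s : R^o) 1 (fun s' : R^o => F (radial a x t + s' *: (t *: v)))
      ('D_(t *: v) F (radial a x t + s *: (t *: v))).
    by apply: is_derive_line; rewrite -E; exact: diff_derivable.
  rewrite exprSr -mulrA (_ : t * _ = 'D_(t *: v) F (radial a (x + s *: v) t)); last first.
    by rewrite !deriveE// linearZ.
  rewrite E /f (_ : (fun s => _) = (fun s => t ^+ m *: (F (radial a x t + s *: (t *: v))) )); last first.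
    by apply/funext => s'; rewrite E.
  exact: is_deriveZ.
have CF0 := CkW CF.
have [C C0 HC] := bounded_on_half (Ck_derive v CF).
have part s t : `]-d, d[%classic s -> I01 t ->
   partial1of2 f s t = t ^+ m.+1 * 'D_v F (radial a (x + s *: v) t).
  move=> Is; rewrite /= in_itv/= => t01.
  by rewrite /partial1of2 derive1E; have [_ ->] := dF s t Is t01.
have d00 : `]-d, d[%classic (0 : R) by rewrite /= in_itv/= d0 ltrNl oppr0 d0.
have H : h^-1 *: (radial_mean a m F (x + h *: v) - radial_mean a m F x) @[h --> (0 : R)^'] -->
    radial_mean a m.+1 (fun y => 'D_v F y) x.
  rewrite (_ : radial_mean a m.+1 _ x = \int[mu]_(t in I01) partial1of2 f 0 t); last first.
    apply: eq_Rintegral => t /set_mem It; rewrite part// scale0r addr0//.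
  rewrite (_ : (fun h => _) = fun h => h^-1 *: ((fun s => \int[mu]_(t in I01) f s t) (h + 0) -
      (fun s => \int[mu]_(t in I01) f s t) 0)); last first.
    by apply/funext => h; rewrite addr0 /radial_mean /f scale0r addr0.
  apply: (@cvg_differentiation_under_integral R _ _ mu f I01 (measurable_itv _) 0 (-d) d d00
    _ _ (fun=> C)) => //.
  - move=> s Is; apply: continuous_integrable01 => t t01.
    by apply: continuous_radial => //; apply: half_ball; exact: Ps.
  - by move=> s t Is; rewrite /= in_itv/= => t01; have [] := dF s t Is t01.
  - by apply: continuous_integrable01 => t _; exact: cst_continuous.
  - move=> s t Is It; rewrite part//; move: It; rewrite /= in_itv/= => t01.
    have /andP[t0 t1] := t01.
    have t_ge0 : 0 <= t ^+ m.+1 by exact: exprn_ge0.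
    rewrite normrM (ger0_norm t_ge0) (le_trans (y := 1 * C))//; last by rewrite mul1r.
    rewrite ler_pM//; first exact: exprn_ile1.
    apply: HC; rewrite /P; apply: radial_ball => //; exact: Ps.
exact: is_derive_cvg.
Qed.

(** Continuity comes from [rV_lipschitz]: the partial derivatives are again radial means, hence
    bounded. Higher orders follow from the stability of the family. *)
Lemma Ck_radial_mean m k F : (forall j, Ck j (ball a e) F) -> Ck k P (radial_mean a m F).
Proof.
elim: k m F => [|k IH] m F CF; last first.
  have := IH m F CF.
  move=> H; split; first by move=> x; exact: (Ck_cont H).
  move=> v; split=> [x Px|]; first by have [] := is_derive_radial_mean m v (CF 1) Px.
  apply: (@Ck_eq _ _ _ _ (radial_mean a m.+1 (fun y => 'D_v F y))).
  - exact: (@ball_open R 'rV[R]_n).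
  - by move=> x Px; have [_ ->] := is_derive_radial_mean m v (CF 1) Px.
  - by apply: IH => j; exact: Ck_derive (CF j.+1).
split=> // x Px.
have HB i : exists C, 0 <= C /\ forall y, P y ->
    `|radial_mean a m.+1 (fun z => 'D_(delta_mx 0 i) F z) y| <= C.
  have [C C0 HC] := radial_mean_bounded m.+1 (Ck_derive (delta_mx 0 i) (CF 1)).
  by exists C.
have [C HC] := choice HB.
pose D := \sum_i C i.
have D0 : 0 <= D by apply: sumr_ge0 => i _; have [] := HC i.
have := open_nbhs_nbhs (conj (@ball_open R 'rV[R]_n a (e / 2)) Px).
move=> /nbhs_ballP[d/= d0 Bd].
apply: (@norm_bound_continuous _ 'rV[R]_n _ x d (D * n%:R) d0) => y xy.
rewrite (le_trans (y := D * \sum_i `|y 0 i - x 0 i|))//.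
  apply: (@rV_lipschitz _ _ _ a (e / 2) D) => //; last exact: Bd.
  move=> z Pz i; have [? ->] := is_derive_radial_mean m (delta_mx 0 i) (CF 1) Pz.
  split=> //; have [_ HCi] := HC i; apply: (le_trans (HCi _ Pz)).
  by rewrite /D (bigD1 i)//= lerDl sumr_ge0// => j _; have [] := HC j.
by rewrite -mulrA ler_wpM2l// rV_dist_sum.
Qed.

End Ball.

(** F x - F a is the integral over [0, 1] of the derivative of t |-> F (a + t (x - a)). The chain
    rule splits the integrand into the terms (x_i - a_i) D_i F, and [g i] is the mean of D_i F. *)
Lemma hadamard F a e : 0 < e -> (forall k, Ck k (ball a e) F) ->
  exists g : 'I_n -> 'rV[R]_n -> R^o,
  [/\ forall i k, Ck k (ball a (e / 2)) (g i),
      forall i, g i a = 'D_(delta_mx 0 i) F a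
    & forall x, ball a (e / 2) x -> F x = F a + \sum_i (x 0 i - a 0 i) * g i x].
Proof.
move=> e0 CF; pose DF i := (fun y => 'D_(delta_mx 0 i) F y) : 'rV[R]_n -> R^o.
have CDF i j : Ck j (ball a e) (DF i) by exact: Ck_derive (CF j.+1).
exists (fun i => radial_mean a 0 (DF i)); split.
- by move=> i k; apply: Ck_radial_mean.
- move=> i; rewrite /radial_mean (_ : (fun t => _) = fun=> DF i a); last first.
    by apply/funext => t; rewrite expr0 mul1r /radial subrr scaler0 addr0.
  by rewrite Rintegral_cst//= lebesgue_measure_itv/= lte_fin ltr01 oppr0 adde0 mulr1.
move=> x /(half_ball e0) ax.
have oB : open (ball a e) by exact: (@ball_open R 'rV[R]_n).
pose f (t : R) : R := \sum_i (x 0 i - a 0 i) * (t ^+ 0 * DF i (radial a x t)).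
pose G (t : R) : R := F (radial a x t).
have dG (t : R) : 0 <= t <= 1 -> is_derive t 1 G (f t).
  move=> t01; have By := radial_ball t01 ax.
  have dF := C1_differentiable oB (CF 1) By.
  rewrite /f (_ : \sum_i _ = 'D_(x - a) F (radial a x t)).
    by apply: is_derive_line; exact: diff_derivable.
  by rewrite derive_rV//; apply: eq_bigr => i _; rewrite expr0 mul1r !mxE.
have cf i t : 0 <= t <= 1 ->
    {for t, continuous (fun t : R => (x 0 i - a 0 i) * (t ^+ 0 * DF i (radial a x t)) : R)}.
  move=> t01; apply: continuousM; first exact: cst_continuous.
  exact: (@continuous_radial a e 0 (DF i)).
have cf' t : 0 <= t <= 1 -> {for t, continuous f}.
  move=> t01; rewrite /f; elim: (index_enum _) => [|j s IH].
    rewrite (_ : (fun t => _) = fun=> 0); last by apply/funext => u; rewrite big_nil.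
    exact: cst_continuous.
  rewrite (_ : (fun t => _) = fun t => (x 0 j - a 0 j) * (t ^+ 0 * DF j (radial a x t)) +
      \sum_(i <- s) (x 0 i - a 0 i) * (t ^+ 0 * DF i (radial a x t))); last first.
    by apply/funext => u; rewrite big_cons.
  by apply: continuousD => //; exact: cf.
have cG t : 0 <= t <= 1 -> {for t, continuous G}.
  by move=> t01; apply: differentiable_continuous; apply/derivable1_diffP; have [] := dG t t01.
have FTC : (\int[mu]_(t in `[0%R, 1%R]) (f t)%:E = (G 1)%:E - (G 0)%:E)%E.
  apply: continuous_FTC2 => //.
  - by apply: continuous_in_subspaceT => t; rewrite inE/= in_itv/=; exact: cf'.
  - split.
    + by move=> t; rewrite in_itv/= => /andP[t0 t1]; have [] := dG t; rewrite ?ltW.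
    + by apply: cvg_at_right_filter; apply: cG; rewrite lexx ler01.
    + by apply: cvg_at_left_filter; apply: cG; rewrite lexx ler01.
  - by move=> t; rewrite in_itv/= => /andP[t0 t1]; rewrite derive1E; have [|_ ->] := dG t; rewrite ?ltW.
have G0 : G 0 = F a by rewrite /G /radial scale0r addr0.
have G1 : G 1 = F x by rewrite /G /radial scale1r addrC subrK.
have -> : \sum_i (x 0 i - a 0 i) * radial_mean a 0 (DF i) x = \int[mu]_(t in I01) f t.
  rewrite Rintegral01_sum//; apply: eq_bigr => i _.
  rewrite RintegralZl//; apply: continuous_integrable01 => t t01.
  exact: (@continuous_radial a e 0 (DF i)).
by rewrite /Rintegral FTC /= G0 G1 [RHS]addrC subrK.
Qed.

End Hadamard.

(** * Manifolds and tangent vectors *)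

Section SmoothIn.
Context {R : realType} {V : normedModType R}.
Implicit Types (O : set V) (f g : V -> R^o).

Lemma smooth_in_eq O f g : open O -> (forall x, O x -> f x = g x) ->
  smooth_in O f -> smooth_in O g.
Proof.
by move=> oO fg /smooth_inP Cf; apply/smooth_inP => k; apply: Ck_eq (Cf k).
Qed.

Lemma smooth_in_sub O P f : P `<=` O -> smooth_in O f -> smooth_in P f.
Proof. by move=> PO sf vs x /PO; exact: sf. Qed.

Lemma smooth_in_cst O (a : R) : smooth_in O (fun=> a).
Proof. by apply/smooth_inP => k; exact: Ck_cst. Qed.

Lemma smooth_in_add O f g : open O -> smooth_in O f -> smooth_in O g ->
  smooth_in O (fun x => f x + g x).
Proof.
by move=> oO /smooth_inP Cf /smooth_inP Cg; apply/smooth_inP => k; exact: Ck_add.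
Qed.

Lemma smooth_in_mul O f g : open O -> smooth_in O f -> smooth_in O g ->
  smooth_in O (fun x => f x * g x).
Proof.
by move=> oO /smooth_inP Cf /smooth_inP Cg; apply/smooth_inP => k; exact: Ck_mul.
Qed.

Lemma smooth_in_inv O f : open O -> smooth_in O f -> (forall x, O x -> f x != 0) ->
  smooth_in O (fun x => (f x)^-1).
Proof.
by move=> oO /smooth_inP Cf f0; apply/smooth_inP => k; exact: Ck_inv.
Qed.

Lemma smooth_in_cont O f x : smooth_in O f -> O x -> {for x, continuous f}.
Proof. by move=> /smooth_inP/(_ 0%N) Cf; exact: (Ck_cont Cf). Qed.

Lemma smooth_in_derive O f v : smooth_in O f -> smooth_in O (fun x => 'D_v f x).
Proof. by move=> /smooth_inP Cf; apply/smooth_inP => k; exact: Ck_derive (Cf k.+1). Qed.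

Lemma smooth_in_comp n O (O' : set 'rV[R]_n) (g : 'rV[R]_n -> R^o) (phi : V -> 'rV[R]_n) :
  open O -> open O' -> (forall x, O x -> O' (phi x)) ->
  smooth_in O' g -> (forall j, smooth_in O (fun x => phi x 0 j : R^o)) ->
  smooth_in O (g \o phi).
Proof.
move=> oO oO' OO' /smooth_inP Cg Cphi; apply/smooth_inP => k.
apply: (Ck_comp oO oO' OO' (Cg k)) => j.
by have /smooth_inP := Cphi j.
Qed.

End SmoothIn.

Section SmoothInRowVector.
Context {R : realType} {n : nat}.
Implicit Types (O : set 'rV[R]_n) (f : 'rV[R]_n -> R^o).

Lemma smooth_in_coord O (i : 'I_n) : smooth_in O (fun x : 'rV[R]_n => x 0 i : R^o).
Proof. by apply/smooth_inP => k; exact: Ck_coord. Qed.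

Lemma smooth_in_differentiable O f x : open O -> smooth_in O f -> O x ->
  differentiable f x.
Proof. by move=> oO /smooth_inP Cf; exact: C1_differentiable (Cf 1%N). Qed.

Lemma row_continuous (T : topologicalType) (u : T -> 'rV[R]_n) (p : T) :
  (forall j, {for p, continuous (fun q => u q 0 j : R)}) -> {for p, continuous u}.
Proof.
move=> cu; apply/cvgrPdist_le => e e0; near=> y.
rewrite [leLHS]/Num.Def.normr/= mx_normrE (bigmax_le _ (ltW e0))//= => i _.
rewrite !mxE/= ord1; move: i.2; near: y; apply: filter_forall => j.
by have /cvgrPdist_le/(_ _ e0) := cu j.
Unshelve. all: by end_near. Qed.

End SmoothInRowVector.

Lemma open_local (T : topologicalType) (U : set T) : (forall x, U x ->
  exists W : set T, [/\ open W, W x & W `<=` U]) -> open U.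
Proof.
move=> H; rewrite openE => x /H[W [oW Wx WU]].
by apply: (filterS WU); exact: open_nbhs_nbhs.
Qed.

Lemma open_preimage_within (T U : topologicalType) (W : set T) (f : T -> U) (O : set U) :
  open W -> open O -> (forall x, W x -> {for x, continuous f}) ->
  open (W `&` f @^-1` O).
Proof.
move=> oW oO cf; rewrite openE => x [Wx Ofx].
apply: filterI; first exact: open_nbhs_nbhs.
by apply: (cf x Wx); exact: open_nbhs_nbhs.
Qed.

Lemma open_forall_ord (T : topologicalType) m (W : 'I_m -> set T) :
  (forall j, open (W j)) -> open [set q | forall j, W j q].
Proof.
move=> oW; rewrite openE => q Wq; apply: filter_forall => j.
by apply: open_nbhs_nbhs; split; [exact: oW|exact: Wq].
Qed.

Lemma near_eq_continuous (T U : topologicalType) (f g : T -> U) (p : T) (W : set T) :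
  open W -> W p -> (forall q, W q -> f q = g q) ->
  {for p, continuous f} -> {for p, continuous g}.
Proof.
move=> oW Wp fg cf; rewrite /prop_for /continuous_at -fg//.
apply: cvg_trans cf; apply: near_eq_cvg; have : nbhs p W by exact: open_nbhs_nbhs.
by apply: filterS => q; exact: fg.
Qed.

(** The part of [smooth_manifold] on which local arguments rely. For total spaces it is available
    before the topological axioms, whose proofs use it. *)
Definition smooth_atlas (R : realType) (n : nat) (N : charted R n) : Prop :=
  (forall p : N, exists2 c, atlas c & chart_dom c p) /\
  @atlas R n N `<=` @maximal_atlas R n N.

Lemma manifold_atlas (R : realType) (n : nat) (N : charted R n) :
  smooth_manifold N -> smooth_atlas N.
Proof. by case. Qed.

(** A canonical choice, f o c^-1 extended by 0, for the function that [smooth_in_chart] only asserts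
    to exist. *)
Definition chart_rep (R : realType) (n : nat) (T : Type) (c : chart R n T)
    (f : T -> R) (y : 'rV[R]_n) : R^o :=
  if pselect (exists p, chart_dom c p /\ c p = y) is left H then f (sval (cid H)) else 0.

Lemma openP (R : realType) (n : nat) (N : charted R n) (U : set N) :
  open U <-> atlas_open U.
Proof. by []. Qed.

(** * Charts of the maximal atlas and smoothness at a point *)

Section Charts.
Context {R : realType} {n : nat} {N : charted R n}.
Hypothesis hN : smooth_atlas N.
Implicit Types (c : chart R n N) (f g : N -> R) (p q : N) (U W : set N).

Lemma chart_repE c f p : maximal_atlas c -> chart_dom c p ->
  chart_rep c f (c p) = f p.
Proof.
move=> [injc _] dp; rewrite /chart_rep; case: pselect => [H|[]]; last by exists p.
by case: cid => q /= [dq cq]; rewrite (injc q p).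
Qed.

Lemma transition_map c c' : smooth_transition c c' -> exists T : 'rV[R]_n -> 'rV[R]_n,
  (forall j, smooth_in (c @` (chart_dom c' `&` chart_dom c)) (fun y => T y 0 j : R^o)) /\
  forall p, chart_dom c p -> chart_dom c' p -> c' p = T (c p).
Proof.
move=> [_ H].
have /choice[g Hg] : forall j, exists g : 'rV[R]_n -> R^o,
    smooth_in (c @` (chart_dom c' `&` chart_dom c)) g /\
    forall p, chart_dom c' p -> chart_dom c p -> c' p 0 j = g (c p).
  by move=> j; have [g] := H j; exists g.
exists (fun y => \row_j g j y); split=> [j|p dp d'p].
  rewrite (_ : (fun y => _) = g j); first by have [] := Hg j.
  by apply/funext => y; rewrite mxE.
by apply/rowP => j; rewrite mxE; have [_ ->] := Hg j.
Qed.

Lemma chart_inj c p q : maximal_atlas c -> chart_dom c p -> chart_dom c q -> c p = c q -> p = q.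
Proof. by move=> [injc _]; exact: injc. Qed.

(** Open sets are tested in the charts of the atlas, and [c] is only a chart of the maximal one.
    Each test goes through the transition map, which is continuous on an open set. *)
Lemma chart_open_preimage c O : maximal_atlas c -> open O -> open (chart_dom c `&` c @^-1` O).
Proof.
move=> mc oO; apply/openP => c' ac'; have mc' := hN.2 _ ac'.
have [_ tr] := mc.2 _ ac'; have [T [sT ET]] := transition_map tr.
exists (c' @` (chart_dom c `&` chart_dom c') `&` T @^-1` O).
  apply: open_preimage_within => //; first by have [] := tr.
  by move=> y Wy; apply: row_continuous => j; exact: smooth_in_cont (sT j) Wy.
apply/seteqP; split=> p /=.
  move=> [[dp Op] d'p]; split=> //; split; first by exists p.
  by rewrite -ET.
move=> [d'p [[q [dq d'q] /(chart_inj mc' d'q d'p) qp] Op]].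
by subst q; split=> //; split=> //; rewrite ET.
Qed.

Lemma chart_dom_open c : maximal_atlas c -> open (chart_dom c).
Proof.
by move=> mc; have := chart_open_preimage mc openT; rewrite preimage_setT setIT.
Qed.

Lemma chart_image_open c U : maximal_atlas c -> open U -> open (c @` (U `&` chart_dom c)).
Proof.
move=> mc oU; apply: open_local => y [p [Up dp] <-].
have [c' ac' d'p] := hN.1 p; have mc' := hN.2 _ ac'.
have [tr _] := mc.2 _ ac'; have [T [sT ET]] := transition_map tr.
have [Q oQ UQ] := (openP U).1 oU _ ac'.
have UP q : chart_dom c' q -> Q (c' q) -> U q.
  by move=> dq Qq; have : (chart_dom c' `&` c' @^-1` Q) q by []; rewrite -UQ => -[].
have Qp : Q (c' p) by have : (U `&` chart_dom c') p by []; rewrite UQ => -[].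
exists (c @` (chart_dom c' `&` chart_dom c) `&` T @^-1` Q); split.
- apply: open_preimage_within => //; first by have [] := tr.
  by move=> z Wz; apply: row_continuous => j; exact: smooth_in_cont (sT j) Wz.
- by split; [exists p|rewrite /= -ET].
- move=> z [[q [d'q dq] <-]] /=; rewrite -ET// => Qq; exists q => //; split=> //.
  exact: UP.
Qed.

Lemma chart_imageW_open c W : maximal_atlas c -> open W -> W `<=` chart_dom c -> open (c @` W).
Proof. by move=> mc oW /setIidl<-; exact: chart_image_open. Qed.

Lemma chart_continuous c p : maximal_atlas c -> chart_dom c p -> {for p, continuous c}.
Proof.
move=> mc dp A /= /nbhs_ballP[e/= e0 Be].
have : nbhs p (chart_dom c `&` c @^-1` (ball (c p) e)).
  apply: open_nbhs_nbhs; split; last by split=> //; exact: ballxx.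
  by apply: chart_open_preimage => //; exact: (@ball_open R 'rV[R]_n).
by apply: filterS => q [_]; exact: Be.
Qed.

Lemma chart_rep_change c c' f W : maximal_atlas c -> maximal_atlas c' ->
  smooth_transition c' c -> open W -> W `<=` chart_dom c -> W `<=` chart_dom c' ->
  smooth_in (c @` W) (chart_rep c f) -> smooth_in (c' @` W) (chart_rep c' f).
Proof.
move=> mc mc' tr oW Wc Wc' sf.
have [T [sT ET]] := transition_map tr.
apply: (@smooth_in_eq _ _ _ (chart_rep c f \o T)).
- exact: chart_imageW_open.
- move=> y [p Wp <-] /=; rewrite -ET; [|exact: Wc'|exact: Wc].
  by rewrite !chart_repE//; [exact: Wc'|exact: Wc].
apply: (@smooth_in_comp _ _ _ _ (c @` W)) => //.
- exact: chart_imageW_open.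
- exact: chart_imageW_open.
- by move=> y [p Wp <-]; exists p => //; apply: ET; [exact: Wc'|exact: Wc].
- move=> j; apply: smooth_in_sub (sT j) => y [p Wp <-]; exists p => //; split.
    exact: Wc.
  exact: Wc'.
Qed.

(** Every chart of the maximal atlas at [p] is allowed, which is the convenient form for use;
    [smooth_atP] shows that a single chart is enough. *)
Variant smooth_at f p : Prop := SmoothAt of forall c, maximal_atlas c -> chart_dom c p ->
  exists W, [/\ open W, W p, W `<=` chart_dom c & smooth_in (c @` W) (chart_rep c f)].

Lemma smooth_at_dom f p c : smooth_at f p -> maximal_atlas c -> chart_dom c p ->
  exists W, [/\ open W, W p, W `<=` chart_dom c & smooth_in (c @` W) (chart_rep c f)].
Proof. by case; exact. Qed.

Lemma smooth_atP c f p W : maximal_atlas c -> chart_dom c p -> open W -> W p ->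
  smooth_in_chart c W f -> smooth_at f p.
Proof.
move=> mc dp oW Wp [g sg Eg]; split=> c' mc' d'p.
(* Charts of the maximal atlas are only assumed compatible with those of the atlas, so the change
   from [c] to [c'] goes through a chart [c0] of the atlas. *)
have [c0 ac0 d0p] := hN.1 p; have mc0 := hN.2 _ ac0.
pose W' := W `&` chart_dom c `&` (chart_dom c' `&` chart_dom c0).
have oW' : open W' by apply: openI; apply: openI => //; exact: chart_dom_open.
have W'c : W' `<=` chart_dom c by move=> q [[]].
have W'c' : W' `<=` chart_dom c' by move=> q [_ []].
have W'c0 : W' `<=` chart_dom c0 by move=> q [_ []].
exists W'; split=> //.
have sc : smooth_in (c @` W') (chart_rep c f).
  apply: (@smooth_in_eq _ _ _ g); first exact: chart_imageW_open.
    by move=> y [q [[Wq dq] _] <-]; rewrite chart_repE// Eg.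
  by apply: smooth_in_sub sg => y [q [Wdq _] <-]; exists q.
apply: (chart_rep_change mc0 mc' _ oW') => //; first by have [] := mc'.2 _ ac0.
by apply: (chart_rep_change mc mc0 _ oW') => //; have [] := mc.2 _ ac0.
Qed.

Lemma smooth_at_in c f p : smooth_at f p -> maximal_atlas c -> chart_dom c p ->
  smooth_in [set c p] (chart_rep c f).
Proof.
move=> sf mc dp; have [W [oW Wp Wc sW]] := smooth_at_dom sf mc dp.
by apply: smooth_in_sub sW => y ->; exists p.
Qed.

Lemma smooth_on_at U f : open U -> smooth_on U f <-> (forall p, U p -> smooth_at f p).
Proof.
move=> oU; split=> [sf p Up|sf c ac].
  have [c ac dp] := hN.1 p; have mc := hN.2 _ ac.
  exact: smooth_atP (sf c ac).
have mc := hN.2 _ ac; exists (chart_rep c f).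
  move=> vs y [p [Up dp] <-].
  exact: (smooth_at_in (sf p Up) mc dp).
by move=> p Up dp; rewrite chart_repE.
Qed.

Lemma smooth_funP f : smooth_fun f <-> forall p, smooth_at f p.
Proof.
split=> [/(smooth_on_at f openT)sf p|sf]; first exact: sf.
by apply/smooth_on_at => [|p _]; [exact: openT|exact: sf].
Qed.

Lemma smooth_at_maximal U f c : open U -> maximal_atlas c ->
  (forall p, U p -> smooth_at f p) -> smooth_in_chart c U f.
Proof.
move=> oU mc sf; exists (chart_rep c f); last by move=> p Up dp; rewrite chart_repE.
by move=> vs y [p [Up dp] <-]; exact: (smooth_at_in (sf p Up) mc dp).
Qed.

Lemma smooth_at_open f p : smooth_at f p -> exists W, [/\ open W, W p &
  forall q, W q -> smooth_at f q].
Proof.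
move=> sf; have [c ac dp] := hN.1 p; have mc := hN.2 _ ac.
have [W [oW Wp Wc sW]] := smooth_at_dom sf mc dp; exists W; split=> // q Wq.
apply: (smooth_atP mc (Wc _ Wq) oW Wq); exists (chart_rep c f); last by move=> z _ dz; rewrite chart_repE.
by rewrite (setIidl Wc).
Qed.

Lemma smooth_at_eq f g p W : open W -> W p -> (forall q, W q -> f q = g q) ->
  smooth_at f p -> smooth_at g p.
Proof.
move=> oW Wp fg sf; have [c ac dp] := hN.1 p; have mc := hN.2 _ ac.
have [W' [oW' W'p W'c sW']] := smooth_at_dom sf mc dp.
have oWW : open (W `&` W') by exact: openI.
apply: (smooth_atP mc dp oWW) => //; exists (chart_rep c f).
  by apply: smooth_in_sub sW' => y [q [[_ Wq] dq] <-]; exists q.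
by move=> q [Wq _] dq; rewrite chart_repE ?fg.
Qed.

Lemma smooth_at_cst (a : R) p : smooth_at (fun=> a) p.
Proof.
have [c ac dp] := hN.1 p; have mc := hN.2 _ ac.
by apply: (smooth_atP mc dp openT) => //; exists (fun=> a); first exact: smooth_in_cst.
Qed.

Lemma smooth_at_cont f p : smooth_at f p -> {for p, continuous f}.
Proof.
move=> sf; have [c ac dp] := hN.1 p; have mc := hN.2 _ ac.
have [W [oW Wp Wc sW]] := smooth_at_dom sf mc dp.
apply: (@near_eq_continuous _ _ (chart_rep c f \o c) f p W) => // [q Wq /=|].
  by rewrite chart_repE//; exact: Wc.
apply: continuous_comp; first exact: chart_continuous.
by apply: smooth_in_cont sW _; exists p.
Qed.

(** Sums, products and inverses of smooth functions are instances, with their arguments packed into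
    the row vector [u]. *)
Lemma smooth_at_comp m (u : N -> 'rV[R]_m) (O : set 'rV[R]_m) (G : 'rV[R]_m -> R^o) p :
  (forall j, smooth_at (fun q => u q 0 j) p) -> open O -> O (u p) -> smooth_in O G ->
  smooth_at (G \o u) p.
Proof.
move=> su oO Oup sG; have [c ac dp] := hN.1 p; have mc := hN.2 _ ac.
have /choice[W HW] : forall j, exists W, [/\ open W, W p, W `<=` chart_dom c &
    smooth_in (c @` W) (chart_rep c (fun q => u q 0 j))] by move=> j; have [suj] := su j; exact: suj.
pose W0 := chart_dom c `&` \bigcap_(j in [set: 'I_m]) W j.
have oW0 : open W0.
  apply: openI; first exact: chart_dom_open.
  rewrite (_ : \bigcap_(j in _) W j = [set q | forall j, W j q]); last first.
    by apply/seteqP; split=> q Hq j => [|_]; exact: Hq.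
  by apply: open_forall_ord => j; have [] := HW j.
have W0p : W0 p by split=> // j _; have [] := HW j.
have W0c : W0 `<=` chart_dom c by move=> q [].
have su0 j : smooth_in (c @` W0) (chart_rep c (fun q => u q 0 j)).
  by have [_ _ _] := HW j; apply: smooth_in_sub => y [q [_ Wq] <-]; exists q => //; exact: Wq.
pose v (y : 'rV[R]_n) : 'rV[R]_m := \row_j chart_rep c (fun q => u q 0 j) y.
have vE q : chart_dom c q -> v (c q) = u q.
  by move=> dq; apply/rowP => j; rewrite mxE chart_repE.
have sv j : smooth_in (c @` W0) (fun y => v y 0 j : R^o).
  rewrite (_ : (fun y => _) = chart_rep c (fun q => u q 0 j))//.
  by apply/funext => y; rewrite mxE.
pose Y := c @` W0 `&` v @^-1` O.
have oY : open Y.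
  apply: open_preimage_within => //; first exact: chart_imageW_open.
  by move=> y Wy; apply: row_continuous => j; exact: smooth_in_cont (sv j) Wy.
have oW1 : open (W0 `&` (chart_dom c `&` c @^-1` Y)).
  by apply: openI => //; exact: chart_open_preimage.
apply: (smooth_atP mc dp oW1).
  by split=> //; split=> //; split; [exists p|rewrite /= vE].
exists (G \o v); last by move=> q _ dq; rewrite /= vE.
apply: (@smooth_in_sub _ _ Y); first by move=> y [q [[_ [_ Yq]] _] <-].
apply: (@smooth_in_comp _ _ _ _ O) => //; first by move=> y [].
by move=> j; apply: smooth_in_sub (sv j) => y [].
Qed.

Lemma smooth_at_add f g p : smooth_at f p -> smooth_at g p ->
  smooth_at (fun q => f q + g q) p.
Proof.
move=> sf sg; pose u q : 'rV[R]_2 := \row_j (if j == 0 then f q else g q).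
rewrite (_ : (fun q => _) = (fun x : 'rV[R]_2 => x 0 0 + x 0 1 : R^o) \o u); last first.
  by apply/funext => q; rewrite /= !mxE.
apply: (@smooth_at_comp _ _ setT) => //; [|exact: openT|].
  move=> j; rewrite (_ : (fun q => _) = if j == 0 then f else g); first by case: ifP.
  by apply/funext => q; rewrite mxE; case: ifP.
by apply: smooth_in_add; try exact: openT; exact: smooth_in_coord.
Qed.

Lemma smooth_at_mul f g p : smooth_at f p -> smooth_at g p ->
  smooth_at (fun q => f q * g q) p.
Proof.
move=> sf sg; pose u q : 'rV[R]_2 := \row_j (if j == 0 then f q else g q).
rewrite (_ : (fun q => _) = (fun x : 'rV[R]_2 => x 0 0 * x 0 1 : R^o) \o u); last first.
  by apply/funext => q; rewrite /= !mxE.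
apply: (@smooth_at_comp _ _ setT) => //; [|exact: openT|].
  move=> j; rewrite (_ : (fun q => _) = if j == 0 then f else g); first by case: ifP.
  by apply/funext => q; rewrite mxE; case: ifP.
by apply: smooth_in_mul; try exact: openT; exact: smooth_in_coord.
Qed.

Lemma smooth_at_opp f p : smooth_at f p -> smooth_at (fun q => - f q) p.
Proof.
move=> sf; rewrite (_ : (fun q => _) = (fun q => (-1) * f q)); last first.
  by apply/funext => q; rewrite mulN1r.
by apply: smooth_at_mul => //; exact: smooth_at_cst.
Qed.

Lemma smooth_at_sum (I : finType) (F : I -> N -> R) p :
  (forall i, smooth_at (F i) p) -> smooth_at (fun q => \sum_i F i q) p.
Proof.
move=> CF; rewrite (_ : (fun q => _) = \big[(fun f g q => f q + g q)/(fun=> 0)]_i F i).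
  by elim/big_ind : _ => // [|f g]; [exact: smooth_at_cst|exact: smooth_at_add].
by apply/funext => q; elim/big_rec2 : _ => // i y f _ ->.
Qed.

Lemma smooth_at_prod (I : finType) (F : I -> N -> R) p :
  (forall i, smooth_at (F i) p) -> smooth_at (fun q => \prod_i F i q) p.
Proof.
move=> CF; rewrite (_ : (fun q => _) = \big[(fun f g q => f q * g q)/(fun=> 1)]_i F i).
  by elim/big_ind : _ => // [|f g]; [exact: smooth_at_cst|exact: smooth_at_mul].
by apply/funext => q; elim/big_rec2 : _ => // i y f _ ->.
Qed.

Lemma smooth_at_inv f p : smooth_at f p -> f p != 0 -> smooth_at (fun q => (f q)^-1) p.
Proof.
move=> sf f0; pose O := [set x : 'rV[R]_1 | x 0 0 != 0].
have oO : open O.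
  have := @open_preimage_within 'rV[R]_1 R setT (fun x => x 0 0) [set t | t != 0] openT.
  rewrite setTI; apply; first exact: open_neq.
  by move=> x _; exact: coord_continuous.
rewrite (_ : (fun q => _) = (fun x : 'rV[R]_1 => (x 0 0)^-1 : R^o) \o (fun q => const_mx (f q))); last first.
  by apply/funext => q; rewrite /= mxE.
apply: (@smooth_at_comp _ _ O) => //; first by move=> j; rewrite (_ : (fun q => _) = f)//; apply/funext => q; rewrite mxE.
  by rewrite /O/= mxE.
by apply: smooth_in_inv => //; exact: smooth_in_coord.
Qed.

Lemma smooth_at_chart c p j : maximal_atlas c -> chart_dom c p -> smooth_at (fun q => c q 0 j) p.
Proof.
move=> mc dp; apply: (smooth_atP mc dp openT) => //.
by exists (fun x => x 0 j); first exact: smooth_in_coord.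
Qed.

Lemma smooth_at_rep c f p : maximal_atlas c -> chart_dom c p -> smooth_at f p ->
  exists O (g : 'rV[R]_n -> R^o), [/\ open O, O (c p), smooth_in O g &
    forall q, chart_dom c q -> f q = g (c q)].
Proof.
move=> mc dp sf; have [W [oW Wp Wc sW]] := smooth_at_dom sf mc dp.
exists (c @` W), (chart_rep c f); split; [exact: chart_imageW_open|by exists p|exact: sW|].
by move=> q dq; rewrite chart_repE.
Qed.

End Charts.

(** * Cut-off functions and tangent vectors as derivations *)

Section Tangent.
Context {R : realType} {n : nat} {N : charted R n}.
Hypothesis hN : smooth_manifold N.
Let hA := manifold_atlas hN.
Implicit Types (c : chart R n N) (f g : N -> R) (p q : N) (U W : set N).

(** The function vanishes on an open set that contains the complement of [U]. This makes chi * f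
    smooth outside of [U], whatever the values of [f] there. *)
Definition bump_in p U (chi : N -> R) : Prop :=
  [/\ smooth_fun chi,
      exists W, [/\ open W, W p & forall q, W q -> chi q = 1]
    & exists W, [/\ open W, forall q, W q -> chi q = 0 & forall q, ~ U q -> W q]].

(** The Hausdorff axiom enters here. The closed ball in the chart is compact, so its preimage [K] is
    compact, hence closed in the manifold, and extension by 0 is smooth off [K]. *)
Lemma manifold_bump p U : open U -> U p -> exists chi, bump_in p U chi.
Proof.
move=> oU Up; have [c ac dp] := hA.1 p; have mc := hA.2 _ ac.
have oY : open (c @` (U `&` chart_dom c)) by exact: chart_image_open.
have Yp : (c @` (U `&` chart_dom c)) (c p) by exists p.
have /nbhs_closedballP[e' Be'] : nbhs (c p) (c @` (U `&` chart_dom c)).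
  exact: open_nbhs_nbhs.
have [e [e0 Be]] : exists e : R, 0 < e /\ @closed_ball R 'rV[R]_n (c p) e `<=` c @` (U `&` chart_dom c).
  by exists e'%:num.
pose B := @closed_ball R 'rV[R]_n (c p) e.
have [chi0 [Cchi [d d0 chi1] chi0E]] := bump_rV (c p) e0.
have schi0 : smooth_in setT chi0 by apply/smooth_inP.
pose inv y : N := if pselect (exists q, (U q /\ chart_dom c q) /\ c q = y) is left H
  then sval (cid H) else p.
have invE q : U q -> chart_dom c q -> inv (c q) = q.
  move=> Uq dq; rewrite /inv; case: pselect => [H|[]]; last by exists q.
  by case: cid => q' /= [[_ dq']]; exact: chart_inj.
pose K := inv @` B.
have cK : compact K.
  apply: continuous_compact; last first.
    apply: bounded_closed_compact; last exact: closed_ball_closed.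
    exists (`|c p| + e); split=> [|M aM y]; first exact: num_real.
    rewrite /B closed_ballE// /closed_ball_/= => ay.
    rewrite (le_trans _ (ltW aM))// -(subrK (c p) y) addrC (le_trans (ler_normD _ _))//.
    by rewrite lerD2l distrC.
  apply: continuous_in_subspaceT => y /set_mem /Be [q0 [Uq0 dq0] <-] A.
  rewrite invE// nbhsE => -[A' [oA' A'q] A'A].
  have oI : open (c @` ((A' `&` U) `&` chart_dom c)).
    by apply: chart_image_open => //; exact: openI.
  have : nbhs (c q0) (c @` ((A' `&` U) `&` chart_dom c)).
    by apply: open_nbhs_nbhs; split=> //; exists q0.
  by apply: filterS => z [q [[A'q' Uq] dq] <-] /=; rewrite invE//; exact: A'A.
have clK : closed K by apply: compact_closed => //; have [] := hN.
have KU : K `<=` U by move=> q [y /Be[q0 [Uq0 dq0] <-] <-]; rewrite invE.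
pose chi q : R := if pselect (chart_dom c q) is left _ then chi0 (c q) else 0.
have chiE q : chart_dom c q -> chi q = chi0 (c q) by rewrite /chi; case: pselect.
have chiK q : (~` K) q -> chi q = 0.
  rewrite /chi; case: pselect => // dq nKq; apply: contrapT => /eqP c0; apply: nKq.
  have Bq : B (c q) by rewrite /B closed_ballE//; exact: chi0E.
  have [q' [Uq' dq'] qq'] := Be _ Bq.
  exists (c q) => //; rewrite -qq' invE//; exact: (chart_inj mc).
have onK : open (~` K) by exact: closed_openC.
exists chi; split.
- apply/(smooth_funP hA) => q; have [dq|dq] := pselect (chart_dom c q).
    apply: (smooth_atP hA mc dq (chart_dom_open hA mc) dq).
    exists chi0; first exact: smooth_in_sub schi0.
    by move=> z _ dz; rewrite chiE.
  have nKq : (~` K) q by move=> [y /Be[q0 [Uq0 dq0] <-]]; rewrite invE// => qq0; apply: dq; rewrite -qq0.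
  apply: (@smooth_at_eq _ _ _ hA (fun=> 0) _ _ _ onK nKq) => [z nKz|].
    by rewrite chiK.
  exact: smooth_at_cst.
- exists (chart_dom c `&` c @^-1` ball (c p) d); split.
  + by apply: chart_open_preimage => //; exact: (@ball_open R 'rV[R]_n).
  + by split=> //; exact: ballxx.
  + by move=> q [dq Bq]; rewrite chiE//; exact: chi1.
- by exists (~` K); split=> // q nUq /KU.
Qed.

Lemma smooth_cutoff p U chi f : open U -> bump_in p U chi ->
  (forall q, U q -> smooth_at f q) -> smooth_fun (fun q => chi q * f q).
Proof.
move=> oU [/(smooth_funP hA) schi _ [W [oW chi0 nUW]]] sf; apply/(smooth_funP hA) => q.
have [Uq|/nUW Wq] := pselect (U q); first by apply: (smooth_at_mul hA) => //; exact: sf.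
apply: (@smooth_at_eq _ _ _ hA (fun=> 0) _ _ _ oW Wq) => [z Wz|].
  by rewrite chi0 ?mul0r.
exact: smooth_at_cst.
Qed.

Lemma smooth_fun_cst (a : R) : smooth_fun (fun=> a : R) (N := N).
Proof. by apply/(smooth_funP hA) => p; exact: smooth_at_cst. Qed.

Lemma smooth_fun_add f g : smooth_fun f -> smooth_fun g -> smooth_fun (fun q => f q + g q).
Proof.
move=> /(smooth_funP hA) sf /(smooth_funP hA) sg; apply/(smooth_funP hA) => p.
by apply: (smooth_at_add hA).
Qed.

Lemma smooth_fun_mul f g : smooth_fun f -> smooth_fun g -> smooth_fun (fun q => f q * g q).
Proof.
move=> /(smooth_funP hA) sf /(smooth_funP hA) sg; apply/(smooth_funP hA) => p.
by apply: (smooth_at_mul hA).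
Qed.

Lemma smooth_fun_opp f : smooth_fun f -> smooth_fun (fun q => - f q).
Proof.
move=> /(smooth_funP hA) sf; apply/(smooth_funP hA) => p.
by apply: (smooth_at_opp hA).
Qed.

Lemma smooth_fun_sub f g : smooth_fun f -> smooth_fun g -> smooth_fun (fun q => f q - g q).
Proof. by move=> sf sg; apply: smooth_fun_add => //; exact: smooth_fun_opp. Qed.

Lemma smooth_fun_sum (I : finType) (F : I -> N -> R) :
  (forall i, smooth_fun (F i)) -> smooth_fun (fun q => \sum_i F i q).
Proof.
move=> sF; apply/(smooth_funP hA) => p; apply: (smooth_at_sum hA) => i.
by have /(smooth_funP hA) := sF i.
Qed.

Section At.
Variables (p : N) (v : (N -> R) -> R).
Hypothesis tv : tangent_vector p v.

Lemma tangentD f g : smooth_fun f -> smooth_fun g ->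
  v (fun q => f q + g q) = v f + v g.
Proof.
move=> sf sg; have := tv.1 1 f g sf sg; rewrite mul1r => <-; congr v.
by apply/funext => q; rewrite mul1r.
Qed.

Lemma tangentM f g : smooth_fun f -> smooth_fun g ->
  v (fun q => f q * g q) = v f * g p + f p * v g.
Proof. exact: tv.2. Qed.

Lemma tangent_cst (a : R) : v (fun=> a) = 0.
Proof.
have s1 := smooth_fun_cst 1; have sa := smooth_fun_cst a.
have v1 : v (fun=> 1) = 0.
  have /eqP : v (fun=> 1) = v (fun=> 1) * 1 + 1 * v (fun=> 1).
    by rewrite -(tangentM s1 s1); congr v; apply/funext => q; rewrite mulr1.
  by rewrite mulr1 mul1r -subr_eq0 opprD addrA subrr sub0r oppr_eq0 => /eqP.
have := tv.1 a _ _ s1 s1.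
rewrite v1 mulr0 addr0 => H; apply/(addIr (v (fun=> 1))); rewrite -tangentD//.
rewrite v1 addr0 -H; congr v; apply/funext => q; by rewrite mulr1.
Qed.

Lemma tangentZ (a : R) f : smooth_fun f -> v (fun q => a * f q) = a * v f.
Proof. by move=> sf; rewrite tangentM ?tangent_cst ?mul0r ?add0r//; exact: smooth_fun_cst. Qed.

Lemma tangentN f : smooth_fun f -> v (fun q => - f q) = - v f.
Proof.
move=> sf; rewrite -mulN1r -tangentZ//; congr v.
by apply/funext => q; rewrite mulN1r.
Qed.

Lemma tangentB f g : smooth_fun f -> smooth_fun g ->
  v (fun q => f q - g q) = v f - v g.
Proof. by move=> sf sg; rewrite -tangentN// tangentD//; exact: smooth_fun_opp. Qed.

Lemma tangent_sum (I : finType) (F : I -> N -> R) : (forall i, smooth_fun (F i)) ->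
  v (fun q => \sum_i F i q) = \sum_i v (F i).
Proof.
move=> sF; elim: (index_enum I) => [|i s IH].
  rewrite big_nil -[RHS](tangent_cst 0); congr v.
  by apply/funext => q; rewrite big_nil.
rewrite big_cons -IH -tangentD//; first by congr v; apply/funext => q; rewrite big_cons.
elim: s {IH} => [|j s IH].
  rewrite (_ : (fun q => _) = fun=> 0); first exact: smooth_fun_cst.
  by apply/funext => q; rewrite big_nil.
rewrite (_ : (fun q => _) = fun q => F j q + \sum_(i <- s) F i q).
  exact: smooth_fun_add.
by apply/funext => q; rewrite big_cons.
Qed.

(** With [chi] a bump in [U], f - g = (1 - chi) (f - g) is a product of two functions that vanish at
    [p], and the Leibniz rule kills it. *)
Lemma tangent_local f g U : open U -> U p -> smooth_fun f -> smooth_fun g ->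
  (forall q, U q -> f q = g q) -> v f = v g.
Proof.
move=> oU Up sf sg fg; have [chi bchi] := manifold_bump oU Up.
have [schi [W [_ Wp W1]] [W0 [_ chi0 nUW]]] := bchi.
apply/eqP; rewrite -subr_eq0 -tangentB//; apply/eqP.
have sh : smooth_fun (fun q => f q - g q) by exact: smooth_fun_sub.
have s1 : smooth_fun (fun q => 1 - chi q).
  by apply: smooth_fun_sub => //; exact: smooth_fun_cst.
have := tangentM s1 sh.
rewrite W1// subrr mul0r addr0 fg// subrr mulr0 => <-; congr v.
apply/funext => q; have [Uq|/nUW Wq] := pselect (U q).
  by rewrite fg// subrr mulr0.
by rewrite chi0// subr0 mul1r.
Qed.

(* Hadamard's lemma makes a derivation depend on first derivatives only. *)
Lemma tangent_comp m (u : N -> 'rV[R]_m) (O : set 'rV[R]_m) (G : 'rV[R]_m -> R^o) f U :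
  (forall j, smooth_fun (fun q => u q 0 j)) -> open O -> O (u p) -> smooth_in O G ->
  open U -> U p -> smooth_fun f -> (forall q, U q -> f q = G (u q)) ->
  v f = \sum_j 'D_(delta_mx 0 j) G (u p) * v (fun q => u q 0 j).
Proof.
move=> su oO Oup sG oU Up sf fE.
have /nbhs_ballP[e/= e0 Be] : nbhs (u p) O by exact: open_nbhs_nbhs.
have CG k : Ck k (ball (u p) e) G.
  by apply: (Ck_sub Be); move: k; apply/smooth_inP.
have [g [Cg g_a GE]] := hadamard e0 CG.
have oB : open (ball (u p) (e / 2)) by exact: (@ball_open R 'rV[R]_m).
have cu q : {for q, continuous u}.
  apply: row_continuous => j; apply: (smooth_at_cont hA).
  by have /(smooth_funP hA) := su j.
pose W := U `&` u @^-1` (ball (u p) (e / 2)).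
have oW : open W by apply: open_preimage_within.
have e20 : 0 < e / 2 by rewrite divr_gt0.
have Wp : W p by split=> //; exact: ballxx.
have [chi bchi] := manifold_bump oW Wp.
have [schi [W1 [oW1 W1p chi1]] _] := bchi.
have sgu j : smooth_fun (fun q => chi q * (g j \o u) q).
  apply: (smooth_cutoff oW bchi) => q [_ Bq].
  apply: (@smooth_at_comp _ _ _ hA _ u (ball (u p) (e / 2))) => //.
    by move=> i; have /(smooth_funP hA) := su i.
  by apply/smooth_inP => k; exact: Cg.
have sdu j : smooth_fun (fun q => u q 0 j - u p 0 j).
  by apply: smooth_fun_sub => //; exact: smooth_fun_cst.
(* Hadamard's expansion of [G], cut off by [chi] so that all its factors are global smooth
   functions, on which [v] may act. *)
pose f' q := G (u p) + \sum_j (u q 0 j - u p 0 j) * (chi q * (g j \o u) q).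
have ss : smooth_fun (fun q => \sum_j (u q 0 j - u p 0 j) * (chi q * (g j \o u) q)).
  by apply: smooth_fun_sum => j; exact: smooth_fun_mul.
have sf' : smooth_fun f' by apply: smooth_fun_add => //; exact: smooth_fun_cst.
rewrite (@tangent_local f f' (W `&` W1)) //; [|exact: openI|]; last first.
  move=> q [[Uq Bq] W1q]; rewrite fE// GE//; congr (_ + _); apply: eq_bigr => j _.
  by rewrite chi1// mul1r.
rewrite /f' tangentD//; last exact: smooth_fun_cst.
rewrite tangent_cst add0r tangent_sum; last by move=> j; exact: smooth_fun_mul.
apply: eq_bigr => j _; rewrite tangentM// subrr mul0r addr0 chi1// mul1r /= g_a mulrC.
rewrite tangentB//; last exact: smooth_fun_cst.
by rewrite tangent_cst subr0.
Qed.

End At.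
End Tangent.

Section SmoothMap.
Context {R : realType} {n m : nat} {N : charted R n} {N' : charted R m}.
Hypotheses (hN : smooth_atlas N) (hN' : smooth_atlas N').

(** A local smooth function on the target is a smooth function of the coordinates [c'], so only the
    coordinates of [F] matter. Continuity follows because charts are open maps. *)
Lemma smooth_map_coord (U : set N) (F : N -> N') : open U ->
  (forall p, U p -> exists c' W, [/\ maximal_atlas c', open W, W p,
     forall q, W q -> chart_dom c' (F q) &
     forall j, smooth_at (fun q => c' (F q) 0 j) p]) ->
  smooth_map_on U F.
Proof.
move=> oU H.
have cF p : U p -> {for p, continuous F}.
  move=> Up; have [c' [W [mc' oW Wp WF sF]]] := H p Up.
  move=> A; rewrite nbhsE => -[A' [oA' A'F] A'A].
  have oI := chart_image_open hN' mc' oA'.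
  have cc : {for p, continuous (fun q => c' (F q))}.
    by apply: row_continuous => j; exact: smooth_at_cont (sF j).
  have : nbhs p (W `&` (fun q => c' (F q)) @^-1` (c' @` (A' `&` chart_dom c'))).
    apply: filterI; first exact: open_nbhs_nbhs.
    by apply: cc; apply: open_nbhs_nbhs; split=> //; exists (F p) => //; split=> //; exact: WF.
  apply: filterS => q [Wq [z [A'z dz] /(chart_inj mc' dz (WF _ Wq)) zE]].
  by apply: A'A; rewrite -zE.
split=> // O g oO /(smooth_on_at hN' g oO) sg.
apply/(smooth_on_at hN); first exact: open_preimage_within.
move=> p [Up Op]; have [c' [W [mc' oW Wp WF sF]]] := H p Up.
have [Q [G [oQ QF sG GE]]] := smooth_at_rep hN' mc' (WF _ Wp) (sg _ Op).
apply: (@smooth_at_eq _ _ _ hN (G \o (fun q => c' (F q))) _ _ W) => //.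
  by move=> q Wq /=; rewrite GE//; exact: WF.
exact: (@smooth_at_comp _ _ _ hN _ _ Q).
Qed.

Lemma smooth_map_at (F : N -> N') g p : smooth_map F -> smooth_at g (F p) ->
  smooth_at (g \o F) p.
Proof.
move=> [cF sF] sg; have [W [oW WF sgW]] := smooth_at_open hN' sg.
have /(smooth_on_at hN') sg' : forall q, W q -> smooth_at g q by [].
have := sF W g oW (sg' oW); move/smooth_on_at; apply=> //.
by apply: open_preimage_within => //; exact: openT.
Qed.

Lemma smooth_map_fun (F : N -> N') g : smooth_map F -> smooth_fun g -> smooth_fun (g \o F).
Proof.
by move=> sF /(smooth_funP hN') sg; apply/(smooth_funP hN) => p; exact: smooth_map_at.
Qed.

End SmoothMap.

(** * Vector bundles and affine bundles *)

Section Basis.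
Context {R : realType} {L : lmodType R} {r : nat}.
Implicit Types (e : 'I_r -> L) (f : 'I_r -> dual L) (u v : L).

Definition bcoord e v : 'rV[R]_r :=
  if pselect (exists k : 'rV[R]_r, v = \sum_i k 0 i *: e i) is left H then sval (cid H) else 0.

Lemma bcoordE e v : is_basis e -> v = \sum_i bcoord e v 0 i *: e i.
Proof.
move=> /(_ v)[k [vE _]]; rewrite /bcoord; case: pselect => [H|[]]; last by exists k.
exact: (svalP (cid H)).
Qed.

Lemma basis_inj e (k k' : 'rV[R]_r) : is_basis e ->
  \sum_i k 0 i *: e i = \sum_i k' 0 i *: e i -> k = k'.
Proof.
move=> /(_ (\sum_i k 0 i *: e i))[k0 [_ uk]] E.
by rewrite -(uk k)// -(uk k').
Qed.

Lemma bcoord_uniq e v (k : 'rV[R]_r) : is_basis e -> v = \sum_i k 0 i *: e i -> bcoord e v = k.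
Proof. by move=> be vE; apply: (basis_inj be); rewrite -vE -bcoordE. Qed.

Lemma bcoordD e u v i : is_basis e -> bcoord e (u + v) 0 i = bcoord e u 0 i + bcoord e v 0 i.
Proof.
move=> be; rewrite (@bcoord_uniq _ _ (bcoord e u + bcoord e v))// ?mxE//.
rewrite {1}(bcoordE u be) {1}(bcoordE v be) -big_split; apply: eq_bigr => j _ /=.
by rewrite mxE scalerDl.
Qed.

Lemma bcoordZ e (a : R) u i : is_basis e -> bcoord e (a *: u) 0 i = a * bcoord e u 0 i.
Proof.
move=> be; rewrite (@bcoord_uniq _ _ (a *: bcoord e u))// ?mxE//.
rewrite {1}(bcoordE u be) scaler_sumr; apply: eq_bigr => j _ /=.
by rewrite mxE scalerA.
Qed.

Lemma bcoord_basis e i j : is_basis e -> bcoord e (e i) 0 j = (i == j)%:R.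
Proof.
move=> be; rewrite (@bcoord_uniq _ _ (delta_mx 0 i))// ?mxE//= 1?eq_sym//.
rewrite (bigD1 i)//= big1 ?addr0 ?mxE ?eqxx ?scale1r// => k ki.
by rewrite mxE (negbTE ki) scale0r.
Qed.

End Basis.

Section DualBasis.
Context {R : realType} {L : lmodType R}.
Implicit Types (u v : L).

Lemma dual_linear (phi : dual L) (a : R) u v : phi (a *: u + v) = a * phi u + phi v.
Proof. by have /asboolP := dual_funP phi; exact. Qed.

Lemma dual0 (phi : dual L) : phi 0 = 0.
Proof.
have := dual_linear phi (-1) 0 0; rewrite scaler0 addr0 mulN1r addNr. exact.
Qed.

Lemma dualD (phi : dual L) u v : phi (u + v) = phi u + phi v.
Proof. by have := dual_linear phi 1 u v; rewrite scale1r mul1r. Qed.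

Lemma dualZ (phi : dual L) (a : R) u : phi (a *: u) = a * phi u.
Proof. by have := dual_linear phi a u 0; rewrite !addr0 dual0 addr0. Qed.

Lemma dualN (phi : dual L) u : phi (- u) = - phi u.
Proof. by rewrite -scaleN1r dualZ mulN1r. Qed.

Lemma dual_sum (phi : dual L) (I : finType) (u : I -> L) : phi (\sum_i u i) = \sum_i phi (u i).
Proof.
by elim/big_rec2 : _ => [|i x y _ <-]; [exact: dual0|exact: dualD].
Qed.

Lemma dual_eq (phi psi : dual L) : (forall u, phi u = psi u) -> phi = psi.
Proof. by move=> E; apply: val_inj; apply/funext. Qed.

Lemma sum_dualE (I : finType) (F : I -> dual L) u : (\sum_i F i) u = \sum_i F i u.
Proof. by elim/big_rec2 : _ => // i x y _ <-. Qed.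

Lemma dual_fun_linear (phi : L -> R^o) : (forall (a : R) u v, phi (a *: u + v) = a * phi u + phi v) ->
  exists psi : dual L, forall u, psi u = phi u.
Proof.
move=> H; have P : phi \in @linear_form R L by apply/asboolP => a u v; exact: H.
by exists (Dual P).
Qed.

Context {r : nat}.
Implicit Types (e : 'I_r -> L) (f : 'I_r -> dual L).

Lemma dual_basis_exists e : is_basis e -> exists f, forall i j, f i (e j) = (i == j)%:R.
Proof.
move=> be; have /choice[f Hf] : forall i, exists psi : dual L, forall u, psi u = bcoord e u 0 i.
  by move=> i; apply: dual_fun_linear => a u v; rewrite bcoordD// bcoordZ.
by exists f => i j; rewrite Hf bcoord_basis// eq_sym.
Qed.

Lemma dual_frame_bcoord e f i v : is_basis e -> (forall i j, f i (e j) = (i == j)%:R) ->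
  f i v = bcoord e v 0 i.
Proof.
move=> be fe; rewrite {1}(bcoordE v be) dual_sum (bigD1 i)//= big1 => [|j ji].
  by rewrite dualZ fe eqxx mulr1 addr0.
by rewrite dualZ fe eq_sym (negbTE ji) mulr0.
Qed.

Lemma dual_is_basis e f : is_basis e -> (forall i j, f i (e j) = (i == j)%:R) -> is_basis f.
Proof.
move=> be fe phi.
have sumE (k : 'rV[R]_r) j : (\sum_i k 0 i *: f i) (e j) = k 0 j.
  rewrite sum_dualE (bigD1 j)//= big1 => [|i ij].
    by rewrite addr0 -[LHS]/(k 0 j * f j (e j)) fe eqxx mulr1.
  by rewrite -[LHS]/(k 0 i * f i (e j)) fe (negbTE ij) mulr0.
exists (\row_i phi (e i)); split=> [|k ->]; last by apply/rowP => j; rewrite mxE sumE.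
apply: dual_eq => u; rewrite {1}(bcoordE u be) dual_sum [X in _ = dual_fun _ X](bcoordE u be) dual_sum.
by apply: eq_bigr => j _; rewrite !dualZ sumE mxE.
Qed.

Lemma dual_bcoord e f (phi : dual L) j : is_basis e -> (forall i j, f i (e j) = (i == j)%:R) ->
  bcoord f phi 0 j = phi (e j).
Proof.
move=> be fe; have bf := dual_is_basis be fe.
rewrite [X in _ = dual_fun X _](bcoordE phi bf) sum_dualE (bigD1 j)//= big1 => [|i ij].
  by rewrite addr0 -[RHS]/(bcoord f phi 0 j * f j (e j)) fe eqxx mulr1.
by rewrite -[LHS]/(bcoord f phi 0 i * f i (e j)) fe (negbTE ij) mulr0.
Qed.

Lemma dual_separates e u v : is_basis e -> (forall phi : dual L, phi u = phi v) -> u = v.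
Proof.
move=> be H; have [f fe] := dual_basis_exists be.
rewrite (bcoordE u be) (bcoordE v be); apply: eq_bigr => i _; congr (_ *: _).
by rewrite -!(dual_frame_bcoord _ _ be fe).
Qed.

End DualBasis.

Section Affine.
Context {R : realType} {L : lmodType R} (S : affine_space L).
Implicit Types (a b : S) (u v : L) (phi psi : affine_fun S).

Definition adiff a b : L := sval (cid (ashift_uniq a b)).

Lemma adiffE a b : b = a +> adiff a b.
Proof. by have [] := svalP (cid (ashift_uniq a b)). Qed.

Lemma ashift_inj a u v : a +> u = a +> v -> u = v.
Proof.
by move=> E; have [w [_ uw]] := ashift_uniq a (a +> u); rewrite -(uw u)// -(uw v).
Qed.

Lemma adiff_shift a v : adiff a (a +> v) = v.
Proof. by apply: (@ashift_inj a); rewrite -adiffE. Qed.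

Lemma linear_part_at a phi v : linear_part phi v = phi (a +> v) - phi a.
Proof. by rewrite linear_partE addrC addKr. Qed.

Lemma linear_partP (a : R) phi psi v :
  linear_part (a *: phi + psi) v = a * linear_part phi v + linear_part psi v.
Proof.
have [pt] := ainhab S; rewrite !(linear_part_at pt).
rewrite -[X in X - _ = _]/(a * phi (pt +> v) + psi (pt +> v)) -[X in _ - X = _]/(a * phi pt + psi pt).
by rewrite mulrBr opprD addrACA.
Qed.

Lemma linear_partD phi psi : linear_part (phi + psi) = linear_part phi + linear_part psi.
Proof.
apply: dual_eq => v; have := linear_partP 1 phi psi v; rewrite scale1r mul1r => ->.
by [].
Qed.

Lemma linear_partZ (a : R) phi : linear_part (a *: phi) = a *: linear_part phi.
Proof.
apply: dual_eq => v; have := linear_partP a phi 0 v; rewrite addr0 => ->.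
have -> : linear_part (0 : affine_fun S) v = 0.
  by have := linear_partP (-1) 0 0 v; rewrite scaler0 addr0 mulN1r addNr.
by rewrite addr0.
Qed.

Lemma linear_part_one : linear_part (affine_one S) = 0.
Proof.
by apply: dual_eq => v; have [pt] := ainhab S; rewrite (linear_part_at pt) subrr.
Qed.

Lemma affine_eq phi psi : (forall a, phi a = psi a) -> phi = psi.
Proof. by move=> E; apply: val_inj; apply/funext. Qed.

Lemma affine_eq_at o phi psi : phi o = psi o -> linear_part phi = linear_part psi -> phi = psi.
Proof. by move=> Eo El; apply: affine_eq => a; rewrite (adiffE o a) !linear_partE Eo El. Qed.

Lemma affine_fun_exists o (l : dual L) (c : R) : exists phi : affine_fun S,
  phi o = c /\ linear_part phi = l.
Proof.
pose f a : R^o := c + l (adiff o a).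
have P : f \in @affine_form R L S.
  apply/asboolP; exists l => a v; rewrite /f {1}(adiffE o a) -ashiftD adiff_shift.
  by rewrite dualD addrA.
have oo : adiff o o = 0 by rewrite -[X in adiff _ X](ashift0 o) adiff_shift.
exists (AffineFun P); split; first by rewrite /= /f oo dual0 addr0.
by apply: dual_eq => v; rewrite (linear_part_at o) /= /f adiff_shift oo dual0 addr0 addrC addKr.
Qed.

Lemma affine_sumE (I : finType) (F : I -> affine_fun S) a : (\sum_i F i) a = \sum_i F i a.
Proof. by elim/big_rec2 : _ => // i x y _ <-. Qed.

Lemma linear_part_sum (I : finType) (F : I -> affine_fun S) :
  linear_part (\sum_i F i) = \sum_i linear_part (F i).
Proof.
elim/big_rec2 : _ => [|i x y _ <-]; last exact: linear_partD.
by have := linear_partZ 0 0; rewrite !scale0r.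
Qed.

(** An affine function is a constant plus a combination of functions [g i] that vanish at [pt] and
    whose linear parts form the dual basis. As [xi] kills constants, it is determined by the numbers
    xi (g i), which are the coordinates of the vector. *)
Lemma bidual_vector_affine r (e : 'I_r -> L) (xi : dual (affine_fun S)) : is_basis e ->
  xi (affine_one S) = 0 -> exists v, xi = incl_vector S v.
Proof.
move=> be xi1; have [pt] := ainhab S.
have [f fe] := dual_basis_exists be; have bf := dual_is_basis be fe.
have /choice[g Hg] : forall i, exists phi : affine_fun S, phi pt = 0 /\ linear_part phi = f i.
  by move=> i; exact: affine_fun_exists.
exists (\sum_i xi (g i) *: e i); apply: dual_eq => phi.
have -> : phi = \sum_i bcoord f (linear_part phi) 0 i *: g i + phi pt *: affine_one S.
  apply: (@affine_eq_at pt).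
    rewrite -[RHS]/((\sum_i bcoord f (linear_part phi) 0 i *: g i) pt + phi pt * 1) affine_sumE mulr1.
    rewrite big1 ?add0r// => i _.
    by rewrite -[LHS]/(bcoord f (linear_part phi) 0 i * g i pt) (Hg i).1 mulr0.
  rewrite linear_partD linear_partZ linear_part_one scaler0 addr0 linear_part_sum.
  rewrite {1}(bcoordE (linear_part phi) bf); apply: eq_bigr => i _.
  by rewrite linear_partZ (Hg i).2.
rewrite dualD dualZ xi1 mulr0 addr0 dual_sum.
rewrite -[RHS]/(linear_part (\sum_i bcoord f (linear_part phi) 0 i *: g i + phi pt *: affine_one S)
   (\sum_i xi (g i) *: e i)).
rewrite linear_partD linear_partZ linear_part_one scaler0 addr0 linear_part_sum dual_sum.
apply: eq_bigr => i _; rewrite dualZ dualZ sum_dualE (bigD1 i)//= big1 => [|j ji].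
  rewrite linear_partZ (Hg i).2 addr0 mulrC; congr (_ * _).
  by rewrite -[RHS]/(bcoord f (linear_part phi) 0 i * f i (e i)) fe eqxx mulr1.
by rewrite linear_partZ (Hg j).2 -[LHS]/(bcoord f (linear_part phi) 0 j * f j (e i)) fe (negbTE ji) mulr0.
Qed.

(** Subtracting the image of a point leaves an element that kills constants, that is, a vector. *)
Lemma bidual_point_affine r (e : 'I_r -> L) (xi : dual (affine_fun S)) : is_basis e ->
  xi (affine_one S) = 1 -> exists a, xi = incl_point a.
Proof.
move=> be xi1; have [pt] := ainhab S.
have [|v Hv] := @bidual_vector_affine r e (xi - incl_point pt) be.
  by rewrite -[LHS]/(xi (affine_one S) - 1) xi1 subrr.
exists (pt +> v); apply: dual_eq => phi.
have : (xi - incl_point pt) phi = incl_vector S v phi by rewrite Hv.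
rewrite -[LHS]/(xi phi - phi pt) -[RHS]/(linear_part phi v) => /eqP.
by rewrite subr_eq addrC -linear_partE => /eqP.
Qed.

Lemma incl_vector_inj r (e : 'I_r -> L) : is_basis e -> injective (incl_vector S).
Proof.
move=> be u v E; apply: (dual_separates be) => l; have [pt] := ainhab S.
have [phi [_ <-]] := affine_fun_exists pt l 0.
by rewrite -[LHS]/(incl_vector S u phi) E.
Qed.

Lemma incl_point_inj r (e : 'I_r -> L) : is_basis e -> injective (@incl_point R L S).
Proof.
move=> be a b E; rewrite (adiffE a b) -[LHS](ashift0 a); congr (_ +> _).
apply: (dual_separates be) => l.
have [phi [_ <-]] := affine_fun_exists a l 0.
have : incl_point a phi = incl_point b phi by rewrite E.
rewrite -[LHS]/(phi a) -[RHS]/(phi b) [X in _ = affine_funval _ X](adiffE a b) linear_partE.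
by move=> /eqP; rewrite -subr_eq0 opprD addrA subrr sub0r oppr_eq0 dual0 => /eqP.
Qed.

Lemma incl_vectorP (a : R) u v :
  incl_vector S (a *: u + v) = a *: incl_vector S u + incl_vector S v.
Proof. by apply: dual_eq => phi; rewrite -[LHS]/(linear_part phi (a *: u + v)) dual_linear. Qed.

Lemma incl_vector_sum (I : finType) (a : I -> R) (u : I -> L) :
  incl_vector S (\sum_i a i *: u i) = \sum_i a i *: incl_vector S (u i).
Proof.
elim/big_rec2 : _ => [|i x y _ <-]; last by rewrite incl_vectorP.
by have := incl_vectorP (-1) 0 0; rewrite scaler0 addr0 scaleN1r addNr.
Qed.

End Affine.

Section SmoothMatrix.
Context {R : realType} {n : nat} {N : charted R n}.
Hypothesis hN : smooth_atlas N.

Lemma smooth_at_det m (K : N -> 'M[R]_m) p : (forall i j, smooth_at (fun q => K q i j) p) ->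
  smooth_at (fun q => \det (K q)) p.
Proof.
move=> sK; apply: (smooth_at_sum hN) => s; apply: (smooth_at_mul hN).
  exact: smooth_at_cst.
by apply: (smooth_at_prod hN) => i.
Qed.

(** The cofactor formula writes each entry as a polynomial in the entries of [K] divided by the
    determinant. *)
Lemma smooth_at_invmx m (K : N -> 'M[R]_m) p i j U : open U -> U p ->
  (forall q, U q -> K q \in unitmx) ->
  (forall i j, smooth_at (fun q => K q i j) p) -> smooth_at (fun q => invmx (K q) i j) p.
Proof.
move=> oU Up uK sK.
apply: (@smooth_at_eq _ _ _ hN (fun q => (\det (K q))^-1 * ((-1) ^+ (j + i) *
   \det (row' j (col' i (K q))))) _ _ U) => // [q Uq|].
  by rewrite /invmx (uK q Uq) !mxE.
apply: (smooth_at_mul hN).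
  apply: (smooth_at_inv hN); first exact: smooth_at_det.
  by have := uK p Up; rewrite unitmxE unitfE.
apply: (smooth_at_mul hN); first exact: smooth_at_cst.
apply: smooth_at_det => a b; rewrite (_ : (fun q => _) = (fun q => K q (lift j a) (lift i b)))//.
by apply/funext => q; rewrite !mxE.
Qed.

End SmoothMatrix.

(** * Smooth sections and local frames of a vector bundle *)

Section Frames.
Context {R : realType} {n r : nat} {M : charted R n} {E : vbundle M r}.
Hypotheses (hM : smooth_atlas M) (hE : vector_bundle E).
Implicit Types (U W : set M) (e : 'I_r -> sec E) (s t : sec E).

Definition sec_coord e s (i : 'I_r) (p : M) : R := bcoord (fun j => e j p) (s p) 0 i.

Lemma vframe_local F : @vframes R n M r E F -> local_frame F.1 F.2.
Proof. exact: hE.2. Qed.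

(** Smoothness of sections is defined through the given frames [vframes]. Coordinates in another
    frame are obtained with the inverse of the matrix [Km] that expresses this frame in a given
    one. *)
Lemma smooth_at_coord U e U' s p i : local_frame U e -> open U' -> smooth_sec_on U' s ->
  U p -> U' p -> smooth_at (sec_coord e s i) p.
Proof.
move=> fe oU' ss Up U'p; have [oU be se] := fe.
have [F vF Fp] := hE.1 p; have [oF bF _] := vframe_local vF.
have [a sa aE] := ss F vF.
have /choice[K HK] : forall i, exists k : 'I_r -> M -> R, (forall j, smooth_on (U `&` F.1) (k j)) /\
    forall x, U x -> F.1 x -> e i x = \sum_(j < r) k j x *: F.2 j x.
  by move=> i'; have [k] := se i' F vF; exists k.
pose Km q : 'M[R]_r := \matrix_(i, j) K i j q.
pose W := U `&` F.1 `&` (U' `&` F.1).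
have oW : open W by apply: openI; exact: openI.
have Wp : W p by [].
have oUF : open (U `&` F.1) by exact: openI.
have oU'F : open (U' `&` F.1) by exact: openI.
have eK q (k : 'rV[R]_r) : W q -> \sum_i k 0 i *: e i q = \sum_j (k *m Km q) 0 j *: F.2 j q.
  move=> [[Uq Fq] _]; under eq_bigr => i' _ do rewrite ((HK i').2 q Uq Fq) scaler_sumr.
  rewrite exchange_big/=; apply: eq_bigr => j _; rewrite mxE scaler_suml.
  by apply: eq_bigr => i' _; rewrite mxE scalerA.
have uK q : W q -> Km q \in unitmx.
  move=> Wq; have [[Uq Fq] _] := Wq; rewrite -row_free_unit; apply: inj_row_free => v vK.
  apply: (basis_inj (be q Uq)); rewrite eK// vK; apply: etrans; last first.
    by symmetry; rewrite big1// => i' _; rewrite mxE scale0r.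
  by rewrite big1// => i' _; rewrite mxE scale0r.
have sa' j : smooth_at (a j) p by exact: ((smooth_on_at hM (a j) oU'F).1 (sa j) p (conj U'p Fp)).
have sK i' j : smooth_at (K i' j) p.
  exact: ((smooth_on_at hM (K i' j) oUF).1 ((HK i').1 j) p (conj Up Fp)).
apply: (@smooth_at_eq _ _ _ hM (fun q => \sum_j a j q * invmx (Km q) j i) _ _ W) => // [q Wq|].
  have [[Uq Fq] [U'q _]] := Wq.
  rewrite /sec_coord (@bcoord_uniq _ _ _ _ _ ((\row_j a j q) *m invmx (Km q))); last first.
  - rewrite aE// eK// mulmxKV ?uK//.
    by apply: eq_bigr => j _; rewrite mxE.
  - exact: be.
  by rewrite mxE; apply: eq_bigr => j _; rewrite mxE.
apply: (smooth_at_sum hM) => j; apply: (smooth_at_mul hM) => //.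
apply: (smooth_at_invmx hM j i oW) => // i' j'.
by rewrite (_ : (fun q => _) = K i' j')//; apply/funext => q; rewrite mxE.
Qed.

(** Every local frame around [p] is allowed; [sec_smooth_atI] shows that one is enough. *)
Variant sec_smooth_at s p : Prop := SecSmoothAt of forall U e, local_frame U e -> U p ->
  forall i, smooth_at (sec_coord e s i) p.

Lemma sec_smooth_coord s p U e i : sec_smooth_at s p -> local_frame U e -> U p ->
  smooth_at (sec_coord e s i) p.
Proof. by case=> H fe Up; exact: (H U e). Qed.

Lemma sec_smooth_atP s p U e W : local_frame U e -> U p -> open W -> W p ->
  (forall q, W q -> forall i, smooth_at (sec_coord e s i) q) -> sec_smooth_at s p.
Proof.
move=> fe Up oW Wp sc; split=> U' e' fe' U'p i.
have [oU be se] := fe; have [oU' be' se'] := fe'.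
apply: (@smooth_at_eq _ _ _ hM (fun q => \sum_j sec_coord e s j q * sec_coord e' (e j) i q)
    _ _ (U `&` U')) => //.
- exact: openI.
- move=> q [Uq U'q]; rewrite [RHS]/sec_coord (bcoordE (s q) (be q Uq)).
  rewrite (@bcoord_uniq _ _ _ _ _ (\row_i \sum_j sec_coord e s j q * sec_coord e' (e j) i q)) ?mxE//.
    exact: be'.
  under eq_bigr => j _ do rewrite (bcoordE (e j q) (be' q U'q)) scaler_sumr.
  rewrite exchange_big/=; apply: eq_bigr => k _; rewrite mxE scaler_suml.
  by apply: eq_bigr => j _; rewrite scalerA.
- apply: (smooth_at_sum hM) => j; apply: (smooth_at_mul hM); first exact: sc.
  exact: (smooth_at_coord i fe' oU (se j)).
Qed.

Lemma smooth_sec_on_at U s : open U -> smooth_sec_on U s <-> (forall p, U p -> sec_smooth_at s p).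
Proof.
move=> oU; split=> [ss p Up|ss F vF].
  by split=> U' e' fe' U'p i; exact: (smooth_at_coord i fe' oU ss).
have [oF bF _] := vframe_local vF.
exists (fun i => sec_coord F.2 s i) => [i|q Uq Fq].
  apply/(smooth_on_at hM); first exact: openI.
  move=> p [Up Fp]; exact: (sec_smooth_coord i (ss p Up) (vframe_local vF)).
by rewrite {1}(bcoordE (s q) (bF q Fq)).
Qed.

Lemma smooth_secP s : smooth_sec s <-> forall p, sec_smooth_at s p.
Proof.
split=> [/(smooth_sec_on_at s openT) ss p|ss]; first exact: ss.
by apply/(smooth_sec_on_at s openT) => p _; exact: ss.
Qed.

Lemma local_frame_smooth U e i p : local_frame U e -> U p -> sec_smooth_at (e i) p.
Proof. by move=> fe Up; have [oU _ se] := fe; have /(smooth_sec_on_at _ oU) := se i; exact. Qed.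

Lemma frame_at p : exists U e, local_frame U e /\ U p.
Proof. by have [F vF Fp] := hE.1 p; exists F.1, F.2; split=> //; exact: vframe_local. Qed.

Lemma sec_smooth_atI s p : (exists U e, [/\ local_frame U e, U p &
  forall i, smooth_at (sec_coord e s i) p]) -> sec_smooth_at s p.
Proof.
move=> [U [e [fe Up sc]]].
have /choice[W HW] : forall i, exists W, [/\ open W, W p & forall q, W q -> smooth_at (sec_coord e s i) q].
  by move=> i; exact: smooth_at_open (sc i).
apply: (@sec_smooth_atP _ _ U e [set q | forall i, W i q]) => //.
- by apply: open_forall_ord => i; have [] := HW i.
- by move=> i; have [] := HW i.
- by move=> q Wq i; have [_ _] := HW i; apply.
Qed.

Lemma sec_smooth_add s t p : sec_smooth_at s p -> sec_smooth_at t p ->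
  sec_smooth_at (fun q => s q + t q) p.
Proof.
move=> ss st; have [U [e [fe Up]]] := frame_at p; have [oU be _] := fe.
apply: sec_smooth_atI; exists U, e; split=> // i.
apply: (@smooth_at_eq _ _ _ hM (fun q => sec_coord e s i q + sec_coord e t i q) _ _ U) => // [q Uq|].
  by rewrite [RHS]/sec_coord bcoordD//; exact: be.
by apply: (smooth_at_add hM); exact: (@sec_smooth_coord _ _ U).
Qed.

Lemma sec_smooth_scale (f : M -> R) s p : smooth_at f p -> sec_smooth_at s p ->
  sec_smooth_at (fun q => f q *: s q) p.
Proof.
move=> sf ss; have [U [e [fe Up]]] := frame_at p; have [oU be _] := fe.
apply: sec_smooth_atI; exists U, e; split=> // i.
apply: (@smooth_at_eq _ _ _ hM (fun q => f q * sec_coord e s i q) _ _ U) => // [q Uq|].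
  by rewrite [RHS]/sec_coord bcoordZ//; exact: be.
by apply: (smooth_at_mul hM) => //; exact: (@sec_smooth_coord _ _ U).
Qed.

Lemma sec_smooth_eq s t p W : open W -> W p -> (forall q, W q -> s q = t q) ->
  sec_smooth_at s p -> sec_smooth_at t p.
Proof.
move=> oW Wp st ss; split=> U e fe Up i.
apply: (@smooth_at_eq _ _ _ hM (sec_coord e s i) _ _ W) => // [q Wq|].
  by rewrite /sec_coord st.
exact: (sec_smooth_coord i ss fe).
Qed.

Lemma sec_smooth0 p : sec_smooth_at (fun=> 0) p.
Proof.
split=> U e fe Up i; have [oU be _] := fe.
apply: (@smooth_at_eq _ _ _ hM (fun=> 0) _ _ U) => // [q Uq|]; last exact: smooth_at_cst.
rewrite /sec_coord (@bcoord_uniq _ _ _ _ _ 0) ?mxE//; first exact: be.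
by rewrite big1// => j _; rewrite mxE scale0r.
Qed.

End Frames.

Section SectionExtension.
Context {R : realType} {n r : nat} {M : charted R n} {E : vbundle M r}.
Hypotheses (hM : smooth_manifold M) (hE : vector_bundle E).
Let hA := manifold_atlas hM.

Lemma sec_cutoff p (U : set M) chi (s : sec E) : open U -> bump_in p U chi ->
  (forall q, U q -> sec_smooth_at s q) -> smooth_sec (fun q => chi q *: s q).
Proof.
move=> oU [/(smooth_funP hA) schi _ [W [oW chi0 nUW]]] ss; apply/(smooth_secP hA hE) => q.
have [Uq|/nUW Wq] := pselect (U q).
  by apply: (sec_smooth_scale hA hE) => //; exact: ss.
apply: (sec_smooth_eq hA oW Wq (s := fun=> 0)) => [z Wz|].
  by rewrite chi0// scale0r.
exact: sec_smooth0.
Qed.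

Lemma sec_extend p (U : set M) (s : sec E) : open U -> U p ->
  (forall q, U q -> sec_smooth_at s q) ->
  exists s', smooth_sec s' /\ exists W, [/\ open W, W p & forall q, W q -> s' q = s q].
Proof.
move=> oU Up ss; have [chi bchi] := manifold_bump hM oU Up.
exists (fun q => chi q *: s q); split; first exact: (sec_cutoff oU bchi).
have [_ [W [oW Wp W1]] _] := bchi; exists W; split=> // q Wq.
by rewrite W1 ?scale1r.
Qed.

End SectionExtension.

Section SecondCountable.
Context {R : realType}.

Lemma rV_countable_basis m : exists2 B : set (set 'rV[R]_m), countable B &
  (forall O, B O -> open O) /\
  forall x A, open A -> A x -> exists O, [/\ B O, O x & O `<=` A].
Proof.
pose f (qk : 'rV[rat]_m * nat) : set 'rV[R]_m :=
  ball (map_mx ratr qk.1 : 'rV[R]_m) (qk.2.+1%:R^-1 : R).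
exists (f @` setT).
  by apply: (sub_countable (card_image_le f setT)); exact: countableP.
split=> [_ [qk _ <-]|x A oA Ax]; first exact: (@ball_open R 'rV[R]_m).
have /nbhs_ballP[e/= e0 Be] : nbhs x A by exact: open_nbhs_nbhs.
have [k kP] : exists k : nat, (k.+1%:R^-1 : R) < e / 2.
  have e20 : 0 < e / 2 by rewrite divr_gt0.
  exists (Num.truncn (e / 2)^-1).
  by rewrite invf_plt ?posrE// truncnS_gt.
have k0 : 0 < (k.+1%:R^-1 : R) by rewrite invr_gt0.
have /choice[q Hq] : forall i, exists q : rat, `|ratr q - x 0 i| < (k.+1%:R^-1 : R).
  move=> i; have xk : x 0 i < x 0 i + k.+1%:R^-1 by rewrite ltrDl.
  have [q] := rat_in_itvoo xk; rewrite in_itv/= => /andP[xq qx]; exists q.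
  by rewrite gtr0_norm ?subr_gt0// ltrBlDl.
exists (f (\row_i q i, k)); split; first by exists (\row_i q i, k).
  by split=> // a i; rewrite ord1 !mxE /ball/=; exact: Hq.
move=> y [_ By]; apply: Be; split=> // a i; rewrite ord1.
have := By 0 i; rewrite !mxE /ball/= => By0.
rewrite (le_lt_trans (ler_distD (ratr (q i)) _ _))// (splitr e) ltrD//.
  by rewrite distrC (lt_trans (Hq i)).
by rewrite (lt_trans By0).
Qed.

End SecondCountable.

(** * The manifold structure of the total space of a vector bundle *)

Section TotalSpace.
Context {R : realType} {n r : nat} {M : charted R n} {E : vbundle M r}.
Implicit Types (d : chart R n M) (U W : set M) (e : 'I_r -> sec E).

Definition tchart d U e : chart R (n + r) (total_space E) :=
  {| chart_dom := [set z : total_space E | chart_dom d (projT1 z) /\ U (projT1 z)] ;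
     chart_map := fun z : total_space E =>
       row_mx (d (projT1 z)) (bcoord (fun i => e i (projT1 z)) (projT2 z)) |}.

Lemma tchart_inj d U e (z z' : total_space E) : maximal_atlas d -> local_frame U e ->
  chart_dom (tchart d U e) z -> chart_dom (tchart d U e) z' ->
  tchart d U e z = tchart d U e z' -> z = z'.
Proof.
case: z z' => [p w] [p' w'] md [_ be _] [/= dp Up] [/= dp' Up'] /eq_row_mx[/(chart_inj md dp dp')].
move=> E1; subst p'; move=> E2; congr (existT _ _ _).
by rewrite (bcoordE w (be _ Up)) E2 -bcoordE//; exact: be.
Qed.

(** The charts of [total_space] are specified on their domains only. This lemma allows them to be
    replaced by the explicit charts [tchart]. *)
Lemma smooth_transition_eq m (T : Type) (c1 c1' c2 c2' : chart R m T) :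
  chart_dom c1 = chart_dom c1' -> chart_dom c2 = chart_dom c2' ->
  (forall p, chart_dom c1 p -> c1 p = c1' p) -> (forall p, chart_dom c2 p -> c2 p = c2' p) ->
  smooth_transition c1 c2 -> smooth_transition c1' c2'.
Proof.
move=> D1 D2 E1 E2 [io s12].
have I12 : c1' @` (chart_dom c2' `&` chart_dom c1') = c1 @` (chart_dom c2 `&` chart_dom c1).
  rewrite -D1 -D2; apply/seteqP; split=> y [p [d2 d1] <-]; exists p => //; rewrite ?E1//.
split=> [|j]; first by rewrite I12.
have [g sg gE] := s12 j; exists g; first by rewrite I12.
by move=> p; rewrite -D1 -D2 => d2 d1; rewrite -E2// -E1// gE.
Qed.

Hypotheses (hA : smooth_atlas M) (hE : vector_bundle E).

(** The image of the overlap is the whole cylinder over the overlap [W] of the base. On it the fibre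
    coordinates change linearly, with coefficients that are smooth functions of the base point. *)
Lemma tchart_transition d U e d' U' e' : maximal_atlas d -> local_frame U e ->
  maximal_atlas d' -> local_frame U' e' ->
  smooth_transition (tchart d U e) (tchart d' U' e').
Proof.
move=> md fe md' fe'; have [oU be se] := fe; have [oU' be' se'] := fe'.
pose W := chart_dom d `&` U `&` (chart_dom d' `&` U').
have oW : open W by apply: openI; apply: openI => //; exact: chart_dom_open.
have Wd : W `<=` chart_dom d by move=> p [[]].
pose Y := (fun y : 'rV[R]_(n + r) => lsubmx y) @^-1` (d @` W).
have IY : tchart d U e @` (chart_dom (tchart d' U' e') `&` chart_dom (tchart d U e)) = Y.
  apply/seteqP; split=> [y [z [[d'z U'z] [dz Uz]] <-]|y [p [[dp Up] [d'p U'p]] py]].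
    by rewrite /Y/= row_mxKl; exists (projT1 z).
  pose z : total_space E := existT _ p (\sum_i (rsubmx y) 0 i *: e i p).
  exists z => //=; rewrite py (@bcoord_uniq _ _ _ _ _ (rsubmx y)) ?hsubmxK//.
  exact: be.
have oY : open Y.
  have := @open_preimage_within 'rV[R]_(n + r) 'rV[R]_n setT (fun y => lsubmx y) (d @` W) openT.
  rewrite setTI; apply; first exact: chart_imageW_open.
  by move=> y _; apply: differentiable_continuous; exact: differentiable_lsubmx.
have srep f : (forall p, W p -> smooth_at f p) ->
    smooth_in Y (fun y : 'rV[R]_(n + r) => chart_rep d f (lsubmx y)).
  move=> sf; apply: (@smooth_in_comp _ _ _ Y (d @` W) (chart_rep d f) (fun y => lsubmx y)) => //.
  - exact: chart_imageW_open.
  - by move=> vs y [p Wp <-]; exact: (smooth_at_in (sf p Wp) md (Wd _ Wp)).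
  - move=> j; rewrite (_ : (fun y => _) = (fun y : 'rV[R]_(n + r) => y 0 (lshift r j))); last first.
      by apply/funext => y; rewrite mxE.
    exact: smooth_in_coord.
have repE f (z : total_space E) : chart_dom (tchart d U e) z ->
    chart_rep d f (lsubmx (tchart d U e z)) = f (projT1 z).
  by move=> [dz _] /=; rewrite row_mxKl chart_repE.
split=> [|j]; rewrite ?IY//.
have [k ->|k ->] := split_ordP j.
  exists (fun y => chart_rep d (fun q => d' q 0 k) (lsubmx y)).
    rewrite IY; apply: srep => p [_ [d'p _]]; exact: smooth_at_chart.
  by move=> z [d'z U'z] dz; rewrite repE//= row_mxEl.
exists (fun y : 'rV[R]_(n + r) => \sum_i y 0 (rshift n i) *
    chart_rep d (sec_coord e' (e i) k) (lsubmx y) : R^o).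
  rewrite IY; apply/smooth_inP => l; apply: Ck_sum => // i; apply: Ck_mul => //; first exact: Ck_coord.
  have := srep (sec_coord e' (e i) k); move=> /(_ _)/smooth_inP; apply => p [[_ Up] [_ U'p]].
  exact: (smooth_at_coord hA hE k fe' oU (se i)).
move=> z [d'z U'z] dz; have [_ Uz] := dz; rewrite /= row_mxEr.
have bz := be _ Uz; have bz' := be' _ U'z.
rewrite (@bcoord_uniq _ _ _ _ _ (\row_k \sum_i bcoord (fun i => e i (projT1 z)) (projT2 z) 0 i *
   sec_coord e' (e i) k (projT1 z)))//.
  by rewrite mxE; apply: eq_bigr => i _; rewrite row_mxEr (repE _ z dz).
rewrite {1}(bcoordE (projT2 z) bz).
under eq_bigr => i _ do rewrite (bcoordE (e i (projT1 z)) bz') scaler_sumr.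
rewrite exchange_big/=; apply: eq_bigr => i _; rewrite mxE scaler_suml.
by apply: eq_bigr => i' _; rewrite scalerA.
Qed.

Lemma tchart_atlas d F : atlas d -> @vframes R n M r E F ->
  @atlas R _ (total_space E) (tchart d F.1 F.2).
Proof.
move=> ad vF; exists d => //; exists F => //; split=> // z [dz Fz] /=.
rewrite row_mxKl row_mxKr; split=> //; apply: bcoordE.
by have [_ bF _] := vframe_local hE vF; exact: bF.
Qed.

Lemma atlas_tchart c : @atlas R _ (total_space E) c -> exists d F,
  [/\ atlas d, @vframes R n M r E F, chart_dom (tchart d F.1 F.2) = chart_dom c &
   forall z, chart_dom (tchart d F.1 F.2) z -> tchart d F.1 F.2 z = c z].
Proof.
move=> [d ad [F vF [dc Ec]]]; exists d, F; split=> // z dz.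
have [_ bF _] := vframe_local hE vF; have [] := Ec z; first by rewrite dc.
move=> Ed Ez /=; rewrite -[RHS]hsubmxK Ed; congr (row_mx _ _).
by apply: bcoord_uniq => //; apply: bF; have [] := dz.
Qed.

Lemma atlas_transition c c' : @atlas R _ (total_space E) c -> @atlas R _ (total_space E) c' ->
  smooth_transition c c'.
Proof.
move=> /atlas_tchart[d [F [ad vF D1 E1]]] /atlas_tchart[d' [F' [ad' vF' D2 E2]]].
apply: (smooth_transition_eq D1 D2 E1 E2).
by apply: tchart_transition; by [exact: hA.2|exact: vframe_local].
Qed.

Lemma tchart_maximal d U e : maximal_atlas d -> local_frame U e ->
  maximal_atlas (tchart d U e).
Proof.
move=> md fe; split=> [z z'|c' /atlas_tchart[d' [F' [ad' vF' D2 E2]]]]; first exact: tchart_inj.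
have mt := vframe_local hE vF'; have md' := hA.2 _ ad'.
split.
  by apply: (smooth_transition_eq erefl D2 (fun=> fun=> erefl) E2); exact: tchart_transition.
by apply: (smooth_transition_eq D2 erefl E2 (fun=> fun=> erefl)); exact: tchart_transition.
Qed.

Lemma total_atlas : smooth_atlas (total_space E).
Proof.
split=> [z|c ac].
  have [d ad dz] := hA.1 (projT1 z); have [F vF Fz] := hE.1 (projT1 z).
  by exists (tchart d F.1 F.2); first exact: tchart_atlas.
have [d [F [ad vF D1 E1]]] := atlas_tchart ac.
split=> [z z' cz cz' czz'|c' ac']; last by split; exact: atlas_transition.
have fF := vframe_local hE vF.
rewrite -D1 in cz cz'; apply: (tchart_inj (hA.2 _ ad) fF cz cz').
by rewrite !E1.
Qed.

Lemma tchart_at (z : total_space E) U e : local_frame U e -> U (projT1 z) ->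
  exists d, [/\ atlas d, maximal_atlas (tchart d U e) & chart_dom (tchart d U e) z].
Proof.
move=> fe Uz; have [d ad dz] := hA.1 (projT1 z); exists d; split=> //.
by apply: tchart_maximal => //; exact: hA.2.
Qed.

Lemma projection_smooth : @smooth_map R _ _ (total_space E) M (fun z : total_space E => projT1 z).
Proof.
apply: (smooth_map_coord total_atlas hA) => [|z _]; first exact: openT.
have [U [e [fe Uz]]] := frame_at hE (projT1 z).
have [d [ad mt dz]] := tchart_at fe Uz.
exists d, (chart_dom (tchart d U e)); split=> //.
- exact: hA.2.
- exact: (chart_dom_open total_atlas).
- by move=> q [].
- move=> j; rewrite (_ : (fun q => _) = (fun q => tchart d U e q 0 (lshift r j))); last first.
    by apply/funext => q; rewrite /= row_mxEl.
  exact: (smooth_at_chart total_atlas).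
Qed.

Lemma projection_continuous (z : total_space E) :
  {for z, continuous (fun z : total_space E => projT1 z : M)}.
Proof. by have [+ _] := projection_smooth; exact. Qed.

Lemma projection_open W : open W -> open ((fun z : total_space E => projT1 z : M) @^-1` W).
Proof.
move=> oW; rewrite -[X in open X]setTI; apply: open_preimage_within => //; first exact: openT.
by move=> z _; exact: projection_continuous.
Qed.

Lemma smooth_at_basic f (z : total_space E) : smooth_at f (projT1 z) ->
  @smooth_at R _ (total_space E) (fun z => f (projT1 z)) z.
Proof. exact: (smooth_map_at total_atlas hA projection_smooth). Qed.

Lemma smooth_at_fibre_coord U e (z : total_space E) i : local_frame U e -> U (projT1 z) ->
  @smooth_at R _ (total_space E) (fun z => bcoord (fun i => e i (projT1 z)) (projT2 z) 0 i) z.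
Proof.
move=> fe Uz; have [d [ad mt dz]] := tchart_at fe Uz.
rewrite (_ : (fun q => _) = (fun q => tchart d U e q 0 (rshift n i))); last first.
  by apply/funext => q; rewrite /= row_mxEr.
exact: (smooth_at_chart total_atlas).
Qed.

End TotalSpace.

Section TotalManifold.
Context {R : realType} {n r : nat} {M : charted R n} {E : vbundle M r}.
Hypotheses (hM : smooth_manifold M) (hE : vector_bundle E).
Let hA := manifold_atlas hM.
Let hT := total_atlas hA hE.

(** Two points that cannot be separated have the same projection, because the base is Hausdorff.
    They lie then in a common chart, whose target is Hausdorff. *)
Lemma total_hausdorff : hausdorff_space (total_space E).
Proof.
move=> z z' clz.
have pz : projT1 z = projT1 z'.
  have [_ _ hH _] := hM; apply: hH => A B Az Bz.
  have [y [Ay By]] := clz _ _ (projection_continuous hA hE Az) (projection_continuous hA hE Bz).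
  by exists (projT1 y).
have [U [e [fe Uz]]] := frame_at hE (projT1 z).
have [d [ad mt dz]] := tchart_at hA hE fe Uz.
have dz' : chart_dom (tchart d U e) z' by have [? ?] := dz; split; rewrite -pz.
apply: (chart_inj mt) => //; apply: (@norm_hausdorff R 'rV[R]_(n + r)) => A B Az Bz.
have [y [Ay By]] := clz _ _ (chart_continuous hT mt dz Az) (chart_continuous hT mt dz' Bz).
by exists (tchart d U e y).
Qed.

(** One chart [ch b] is chosen for each basic open set b of the base over which some chart is
    defined. The preimages of basic open sets of row vectors under these countably many charts form
    the basis. *)
Lemma total_second_countable : @second_countable (total_space E).
Proof.
have [_ _ _ [B cB [oB bB]]] := hM.
have [B' cB' [oB' bB']] := @rV_countable_basis R (n + r).
pose P (b : set M) (c : chart R (n + r) (total_space E)) :=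
  maximal_atlas c /\ (fun z : total_space E => projT1 z) @^-1` b `<=` chart_dom c.
have /choice[ch Hch] : forall b : set M, exists c, (exists c, P b c) -> P b c.
  move=> b; have [[c Pc]|nP] := pselect (exists c, P b c); first by exists c.
  by exists {| chart_dom := set0 ; chart_map := fun=> 0 |} => /nP.
pose f (bO : set M * set 'rV[R]_(n + r)) : set (total_space E) :=
  [set z | (exists c, P bO.1 c) /\ (chart_dom (ch bO.1) `&` ch bO.1 @^-1` bO.2) z].
exists (f @` (B `*` B')).
  by apply: (sub_countable (card_image_le f _)); exact: countableX.
split=> [_ [[b Q] [/= Bb BQ] <-]|z A Az].
  have [exP|nexP] := pselect (exists c, P b c); last first.
    by rewrite (_ : f (b, Q) = set0); [exact: open0|apply/seteqP; split=> // z [/nexP]].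
  have [mc _] := Hch _ exP; rewrite (_ : f (b, Q) = chart_dom (ch b) `&` ch b @^-1` Q).
    by apply: (chart_open_preimage hT) => //; exact: oB'.
  by apply/seteqP; split=> [z []|z].
have [U [e [fe Uz]]] := frame_at hE (projT1 z).
have [d [ad mt [dz _]]] := tchart_at hA hE fe Uz.
have oU : open U by case: fe.
have nU : nbhs (projT1 z) (U `&` chart_dom d).
  by apply: open_nbhs_nbhs; split=> //; apply: openI => //; exact: (chart_dom_open hA (hA.2 _ ad)).
have [b [Bb bz] bU] := bB _ _ nU.
have exP : exists c, P b c.
  by exists (tchart d U e); split=> // q /bU[].
have [mc bc] := Hch _ exP.
move: Az; rewrite nbhsE => -[A' [oA' A'z] A'A].
have [Q [BQ Qz QA]] := bB' (ch b z) (ch b @` (A' `&` chart_dom (ch b)))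
  (chart_image_open hT mc oA') (imageP (ch b) (conj A'z (bc z bz))).
exists (f (b, Q)).
  split; first by exists (b, Q).
  by split=> //; split=> //; exact: bc.
move=> y [_ [dy /QA [y' [A'y' dy'] yy']]]; apply: A'A.
by rewrite -(chart_inj mc dy' dy yy').
Qed.

Lemma total_manifold : smooth_manifold (total_space E).
Proof.
split; [exact: hT.1|exact: hT.2|exact: total_hausdorff|exact: total_second_countable].
Qed.

End TotalManifold.

(** * The dual bundle and fibrewise linear functions *)

Section DualBundle.
Context {R : realType} {n r : nat} {M : charted R n} {V : vbundle M r}.
Hypotheses (hA : smooth_atlas M) (hV : vector_bundle V).
Implicit Types (U W : set M) (e : 'I_r -> sec V) (f : 'I_r -> sec (dual_bundle V)).

Definition dual_frame U e f : Prop :=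
  forall p, U p -> forall i j, f i p (e j p) = (i == j)%:R.

Lemma dual_frame_exists U e : local_frame U e -> exists f, dual_frame U e f.
Proof.
move=> [_ be _].
have H p : exists f : 'I_r -> dual (V p), U p -> forall i j, f i (e j p) = (i == j)%:R.
  have [Up|nUp] := pselect (U p); last by exists (fun=> 0).
  by have [f Hf] := dual_basis_exists (be p Up); exists f.
by exists (fun i p => sval (cid (H p)) i) => p Up i j; exact: (svalP (cid (H p)) Up).
Qed.

Lemma dual_frame_coord U e f (s : sec V) i p : local_frame U e -> dual_frame U e f -> U p ->
  f i p (s p) = sec_coord e s i p.
Proof. by move=> [_ be _] fe Up; apply: dual_frame_bcoord (be p Up) (fe p Up). Qed.

Lemma dual_frame_local U e f : local_frame U e -> dual_frame U e f -> local_frame U f.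
Proof.
move=> le fe; have [oU be se] := le; split=> // [p Up|i F [G vG [FG FE]]].
  exact: dual_is_basis (be p Up) (fe p Up).
have lG := vframe_local hV vG; have [oG bG sG] := lG.
exists (fun j p => f i p (G.2 j p)) => [j|p Up Fp].
  apply/(smooth_on_at hA); first by rewrite FG; exact: openI.
  rewrite FG => p [Up Gp].
  apply: (@smooth_at_eq _ _ _ hA (sec_coord e (G.2 j) i) _ _ U) => // [q Uq|].
    by rewrite (dual_frame_coord _ _ le fe).
  exact: (smooth_at_coord hA hV i le oG (sG j)).
have Gp : G.1 p by rewrite -FG.
have bF : is_basis (fun i => F.2 i p) := dual_is_basis (bG p Gp) (FE p Fp).
rewrite {1}(bcoordE (f i p) bF); apply: eq_bigr => j _.
by rewrite (dual_bcoord _ _ (bG p Gp) (FE p Fp)).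
Qed.

Lemma dual_vector_bundle : vector_bundle (dual_bundle V).
Proof.
split=> [x|F [G vG [FG FE]]].
  have [G vG Gx] := hV.1 x; have [f fe] := dual_frame_exists (vframe_local hV vG).
  by exists (G.1, f) => //; exists G.
rewrite FG; apply: (dual_frame_local (vframe_local hV vG)) => p Gp i j.
by apply: FE; rewrite FG.
Qed.

Definition linear_fun (Y : sec V) (w : total_space (dual_bundle V)) : R := projT2 w (Y (projT1 w)).

Lemma linear_fun_coord U e f (Y : sec V) (w : total_space (dual_bundle V)) :
  local_frame U e -> dual_frame U e f -> U (projT1 w) ->
  linear_fun Y w = \sum_i bcoord (fun i => f i (projT1 w)) (projT2 w) 0 i *
     sec_coord e Y i (projT1 w).
Proof.
move=> [_ be _] fe Uw; rewrite /linear_fun {1}(bcoordE (Y _) (be _ Uw)) dual_sum.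
apply: eq_bigr => i _.
by rewrite dualZ (dual_bcoord _ _ (be _ Uw) (fe _ Uw)) mulrC.
Qed.

Lemma smooth_at_linear (Y : sec V) (w : total_space (dual_bundle V)) :
  sec_smooth_at Y (projT1 w) -> @smooth_at R _ (total_space (dual_bundle V)) (linear_fun Y) w.
Proof.
move=> sY; have hT := total_atlas hA dual_vector_bundle.
have [U [e [le Uw]]] := frame_at hV (projT1 w); have [f fe] := dual_frame_exists le.
have lf := dual_frame_local le fe; have [oU _ _] := le.
apply: (@smooth_at_eq _ _ _ hT (fun w : total_space (dual_bundle V) =>
   \sum_i bcoord (fun i => f i (projT1 w)) (projT2 w) 0 i * sec_coord e Y i (projT1 w)) _ _
   ((fun w : total_space (dual_bundle V) => projT1 w : M) @^-1` U)) => //.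
- exact: (projection_open hA dual_vector_bundle).
- by move=> q Uq; rewrite (linear_fun_coord _ le fe).
- apply: (smooth_at_sum hT) => i; apply: (smooth_at_mul hT).
    exact: (smooth_at_fibre_coord hA dual_vector_bundle i lf Uw).
  apply: (@smooth_at_basic _ _ _ _ _ hA dual_vector_bundle (sec_coord e Y i)).
  exact: (sec_smooth_coord i sY le).
Qed.

End DualBundle.

(** * Sections of an affine bundle and frames of A^+ *)

Section AffineSections.
Context {R : realType} {n r : nat} {M : charted R n} {V : vbundle M r} {A : abundle V}.
Hypotheses (hA : smooth_atlas M) (hV : vector_bundle V) (hB : affine_bundle A).
Implicit Types (U W : set M) (X : asec A) (Y : sec V).

Definition asec_diff X X' : sec V := fun q => adiff (X q) (X' q).

Lemma adiff_add (L : lmodType R) (S : affine_space L) (a b c : S) :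
  adiff a b + adiff b c = adiff a c.
Proof. by apply: (@ashift_inj _ _ _ a); rewrite ashiftD -!adiffE. Qed.

Lemma adiffxx (L : lmodType R) (S : affine_space L) (a : S) : adiff a a = 0.
Proof. by apply: (addrI (adiff a a)); rewrite adiff_add addr0. Qed.

Lemma adiffN (L : lmodType R) (S : affine_space L) (a b : S) : adiff a b = - adiff b a.
Proof. by apply/eqP; rewrite -subr_eq0 opprK adiff_add adiffxx. Qed.

Variant asec_smooth_at X p : Prop := AsecSmoothAt of forall o, @aorigins R n M r V A o ->
  o.1 p -> sec_smooth_at (asec_diff o.2 X) p.

Lemma smooth_asec_on_at U X : open U -> smooth_asec_on U X <-> (forall p, U p -> asec_smooth_at X p).
Proof.
move=> oU; split=> [sX p Up|sX o ao].
  split=> o ao op; have [oo _] := hB.2 o ao; have [Y sY XE] := sX o ao.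
  have oI : open (U `&` o.1) by exact: openI.
  apply: (sec_smooth_eq hA oI (conj Up op) (s := Y)).
    by move=> q [Uq oq]; rewrite /asec_diff XE// adiff_shift.
  exact: ((smooth_sec_on_at hA hV Y oI).1 sY p (conj Up op)).
have [oo _] := hB.2 o ao; exists (asec_diff o.2 X); last by move=> q _ _; exact: adiffE.
apply/(smooth_sec_on_at hA hV); first exact: openI.
by move=> p [Up op]; have [H] := sX p Up; exact: H.
Qed.

Lemma smooth_asecP X : smooth_asec X <-> forall p, asec_smooth_at X p.
Proof.
split=> [/(smooth_asec_on_at X openT) sX p|sX]; first exact: sX.
by apply/(smooth_asec_on_at X openT) => p _; exact: sX.
Qed.

Lemma sec_smooth_opp Y p : sec_smooth_at Y p -> sec_smooth_at (fun q => - Y q) p.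
Proof.
move=> sY; rewrite (_ : (fun q => _) = (fun q => (-1) *: Y q)); last first.
  by apply/functional_extensionality_dep => q; rewrite scaleN1r.
by apply: (sec_smooth_scale hA hV) => //; exact: smooth_at_cst.
Qed.

Lemma origin_at p : exists o, @aorigins R n M r V A o /\ o.1 p.
Proof. by have [om ao op] := hB.1 p; exists om. Qed.

Lemma asec_diff_smooth X X' p : asec_smooth_at X p -> asec_smooth_at X' p ->
  sec_smooth_at (asec_diff X X') p.
Proof.
move=> [sX] [sX']; have [om [ao op]] := origin_at p.
rewrite (_ : asec_diff X X' = fun q => - asec_diff om.2 X q + asec_diff om.2 X' q); last first.
  by apply/functional_extensionality_dep => q; rewrite /asec_diff -adiffN adiff_add.
by apply: (sec_smooth_add hA hV); [apply: sec_smooth_opp; exact: sX|exact: sX'].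
Qed.

Lemma asec_smooth_shift X Y p : asec_smooth_at X p -> sec_smooth_at Y p ->
  asec_smooth_at (fun q => X q +> Y q) p.
Proof.
move=> [sX] sY; split=> o ao op.
rewrite (_ : asec_diff o.2 _ = fun q => asec_diff o.2 X q + Y q); last first.
  apply/functional_extensionality_dep => q; rewrite /asec_diff -(adiff_add _ (X q)); congr (_ + _).
  by rewrite adiff_shift.
by apply: (sec_smooth_add hA hV) => //; exact: sX.
Qed.

Lemma asec_smooth_eq X X' p W : open W -> W p -> (forall q, W q -> X q = X' q) ->
  asec_smooth_at X p -> asec_smooth_at X' p.
Proof.
move=> oW Wp E [sX]; split=> o ao op; apply: (sec_smooth_eq hA oW Wp (s := asec_diff o.2 X)).
  by move=> q Wq; rewrite /asec_diff E.
exact: sX.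
Qed.

Lemma origin_smooth o p : @aorigins R n M r V A o -> o.1 p -> asec_smooth_at o.2 p.
Proof. by move=> ao op; have [oo /(smooth_asec_on_at o.2 oo) H] := hB.2 o ao; exact: H. Qed.

(** The shape of the frames of [aff_dual], with any section [o] in the place of a given origin. *)
Definition affine_frame U (o : asec A) (e : 'I_r -> sec V) (phi : 'I_r.+1 -> sec (aff_dual A)) :=
  forall p, U p -> phi ord0 p = affine_one (A p) /\ forall i : 'I_r,
    phi (lift ord0 i) p (o p) = 0 /\ forall j : 'I_r, phi (lift ord0 i) p (o p +> e j p) = (i == j)%:R.

Lemma affine_frame_linear U o e phi p i j : affine_frame U o e phi -> U p ->
  linear_part (phi (lift ord0 i) p) (e j p) = (i == j)%:R.
Proof.
by move=> af Up; have [_ /(_ i)[H0 /(_ j) H1]] := af p Up; rewrite (linear_part_at (o p)) H0 subr0.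
Qed.

Lemma affine_frame_exists U o e : local_frame U e -> exists phi, affine_frame U o e phi.
Proof.
move=> le; have [f fe] := dual_frame_exists le.
have H p i : exists phi : affine_fun (A p), phi (o p) = 0 /\ linear_part phi = f i p.
  exact: affine_fun_exists.
exists (fun a p => if unlift ord0 a is Some i then sval (cid (H p i)) else affine_one (A p)).
move=> p Up; rewrite unlift_none; split=> // i; rewrite liftK.
have [H0 H1] := svalP (cid (H p i)); split=> // j.
by rewrite linear_partE H0 add0r H1 fe.
Qed.

Lemma affine_frame_decomp U o e phi p (z : affine_fun (A p)) : local_frame U e ->
  affine_frame U o e phi -> U p ->
  z = z (o p) *: phi ord0 p + \sum_i linear_part z (e i p) *: phi (lift ord0 i) p.
Proof.
move=> [_ be _] af Up; have bp := be _ Up; have [p0 p1] := af p Up.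
apply: (@affine_eq_at _ _ _ (o p)).
  rewrite -[RHS]/((z (o p) *: phi ord0 p) (o p) +
     (\sum_i linear_part z (e i p) *: phi (lift ord0 i) p) (o p)).
  rewrite affine_sumE big1 ?addr0 => [|i _]; first by rewrite p0 -[RHS]/(z (o p) * 1) mulr1.
  by rewrite -[LHS]/(linear_part z (e i p) * phi (lift ord0 i) p (o p)) (p1 i).1 mulr0.
rewrite linear_partD linear_partZ p0 linear_part_one scaler0 add0r linear_part_sum.
apply: dual_eq => v; rewrite (bcoordE v bp) !dual_sum; apply: eq_bigr => j _.
rewrite !dualZ; congr (_ * _); rewrite sum_dualE (bigD1 j)//= big1 => [|i ij].
  by rewrite addr0 linear_partZ -[RHS]/(linear_part z (e j p) * linear_part (phi (lift ord0 j) p) (e j p))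
    (affine_frame_linear _ _ af Up) eqxx mulr1.
by rewrite linear_partZ -[LHS]/(linear_part z (e i p) * linear_part (phi (lift ord0 i) p) (e j p))
    (affine_frame_linear _ _ af Up) (negbTE ij) mulr0.
Qed.

Lemma affine_frame_basis U o e phi p : local_frame U e -> affine_frame U o e phi -> U p ->
  is_basis (fun a => phi a p).
Proof.
move=> le af Up z.
pose k : 'rV[R]_r.+1 := \row_a (if unlift ord0 a is Some i then linear_part z (e i p) else z (o p)).
exists k; split=> [|k' zE].
  rewrite {1}(affine_frame_decomp z le af Up) big_ord_recl !mxE unlift_none; congr (_ + _).
  by apply: eq_bigr => i _; rewrite mxE liftK.
have [p0 p1] := af p Up; apply/rowP => a; rewrite mxE zE.
have [i ->|->] := unliftP ord0 a; rewrite ?liftK ?unlift_none.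
  rewrite linear_part_sum sum_dualE big_ord_recl p0 linear_partZ linear_part_one scaler0 add0r.
  rewrite (bigD1 i)//= big1 => [|j ij].
    by rewrite addr0 linear_partZ -[LHS]/(k' 0 (lift ord0 i) * linear_part (phi (lift ord0 i) p) (e i p))
      (affine_frame_linear _ _ af Up) eqxx mulr1.
  by rewrite linear_partZ -[LHS]/(k' 0 (lift ord0 j) * linear_part (phi (lift ord0 j) p) (e i p))
      (affine_frame_linear _ _ af Up) (negbTE ij) mulr0.
rewrite affine_sumE big_ord_recl big1 ?addr0 => [|j _].
  by rewrite p0 -[LHS]/(k' 0 ord0 * 1) mulr1.
by rewrite -[LHS]/(k' 0 (lift ord0 j) * phi (lift ord0 j) p (o p)) (p1 j).1 mulr0.
Qed.

Lemma affine_frame_coord0 U o e phi p (z : affine_fun (A p)) : local_frame U e ->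
  affine_frame U o e phi -> U p -> bcoord (fun a => phi a p) z 0 ord0 = z (o p).
Proof.
move=> le af Up; have bp := affine_frame_basis le af Up.
pose k : 'rV[R]_r.+1 := \row_a (if unlift ord0 a is Some i then linear_part z (e i p) else z (o p)).
rewrite (@bcoord_uniq _ _ _ _ _ k)// ?mxE ?unlift_none//.
rewrite {1}(affine_frame_decomp z le af Up) big_ord_recl !mxE unlift_none; congr (_ + _).
by apply: eq_bigr => i _; rewrite mxE liftK.
Qed.

Lemma affine_frame_coordS U o e phi p (z : affine_fun (A p)) i : local_frame U e ->
  affine_frame U o e phi -> U p ->
  bcoord (fun a => phi a p) z 0 (lift ord0 i) = linear_part z (e i p).
Proof.
move=> le af Up; have bp := affine_frame_basis le af Up.
pose k : 'rV[R]_r.+1 := \row_a (if unlift ord0 a is Some i then linear_part z (e i p) else z (o p)).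
rewrite (@bcoord_uniq _ _ _ _ _ k)// ?mxE ?liftK//.
rewrite {1}(affine_frame_decomp z le af Up) big_ord_recl !mxE unlift_none; congr (_ + _).
by apply: eq_bigr => i' _; rewrite mxE liftK.
Qed.

(** The coordinates of an affine function in an affine frame are its value at the origin and its
    linear part on the frame of [V]. The transition functions are thus coordinates of the sections
    [G.2 i] and of the difference of the two origins. *)
Lemma affine_frame_local U o e phi : local_frame U e -> affine_frame U o e phi ->
  (forall p, U p -> asec_smooth_at o p) -> local_frame U phi.
Proof.
move=> le af so; have [oU be se] := le; split=> // [p Up|a F [om aom [G vG [FE FP]]]].
  exact: affine_frame_basis le af Up.
have lG := vframe_local hV vG; have [oG bG sG] := lG; have [oom _] := hB.2 om aom.
have lG' : local_frame F.1 G.2.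
  rewrite FE; split; first exact: openI.
  - by move=> x [_ Gx]; exact: bG.
  - move=> i; apply/(smooth_sec_on_at hA hV); first exact: openI.
    by move=> p [_ Gp]; exact: (local_frame_smooth hA hV i lG Gp).
have oF : open F.1 by case: lG'.
have afF : affine_frame F.1 om.2 G.2 F.2 by [].
have oUF : open (U `&` F.1) by exact: openI.
exists (fun b p => bcoord (fun a => F.2 a p) (phi a p) 0 b) => [b|p Up Fp]; last first.
  by apply: bcoordE; exact: affine_frame_basis lG' afF Fp.
apply/(smooth_on_at hA) => // p [Up Fp].
have [io'p iGp] : om.1 p /\ G.1 p by move: Fp; rewrite FE.
have [i ->|->] := unliftP ord0 b.
  apply: (@smooth_at_eq _ _ _ hA (fun q => linear_part (phi a q) (G.2 i q)) _ _ (U `&` F.1)) => //.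
    by move=> q [Uq Fq]; rewrite (affine_frame_coordS _ _ lG' afF Fq).
  have [j ->|->] := unliftP ord0 a.
    apply: (@smooth_at_eq _ _ _ hA (sec_coord e (G.2 i) j) _ _ (U `&` F.1)) => //.
      move=> q [Uq Fq]; rewrite /sec_coord {2}(bcoordE (G.2 i q) (be q Uq)) dual_sum (bigD1 j)//= big1 => [|k kj].
        by rewrite addr0 dualZ (affine_frame_linear _ _ af Uq) eqxx mulr1.
      by rewrite dualZ (affine_frame_linear _ _ af Uq) eq_sym (negbTE kj) mulr0.
    exact: (smooth_at_coord hA hV j le oG (sG i)).
  apply: (@smooth_at_eq _ _ _ hA (fun=> 0) _ _ (U `&` F.1)) => //; last exact: smooth_at_cst.
  by move=> q [Uq Fq]; rewrite (af q Uq).1 linear_part_one.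
apply: (@smooth_at_eq _ _ _ hA (fun q => phi a q (om.2 q)) _ _ (U `&` F.1)) => //.
  by move=> q [Uq Fq]; rewrite (affine_frame_coord0 _ lG' afF Fq).
have [j ->|->] := unliftP ord0 a; last first.
  apply: (@smooth_at_eq _ _ _ hA (fun=> 1) _ _ (U `&` F.1)) => //; last exact: smooth_at_cst.
  by move=> q [Uq Fq]; rewrite (af q Uq).1.
apply: (@smooth_at_eq _ _ _ hA (sec_coord e (asec_diff o om.2) j) _ _ (U `&` F.1)) => //.
  move=> q [Uq Fq]; rewrite (adiffE (o q) (om.2 q)) linear_partE ((af q Uq).2 j).1 add0r.
  rewrite /sec_coord /asec_diff {2}(bcoordE (adiff (o q) (om.2 q)) (be q Uq)) dual_sum (bigD1 j)//= big1 => [|k kj].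
    by rewrite addr0 dualZ (affine_frame_linear _ _ af Uq) eqxx mulr1.
  by rewrite dualZ (affine_frame_linear _ _ af Uq) eq_sym (negbTE kj) mulr0.
have sd : sec_smooth_at (asec_diff o om.2) p.
  by apply: asec_diff_smooth; [exact: so|exact: origin_smooth].
exact: (sec_smooth_coord j sd le Up).
Qed.

Lemma affine_frame_at p : exists U o e phi, [/\ local_frame U e, affine_frame U o e phi,
  U p, forall q, U q -> asec_smooth_at o q & local_frame U phi].
Proof.
have [om [ao op]] := origin_at p; have [oo _] := hB.2 om ao.
have [U [e [le Up]]] := frame_at hV p; have [oU be se] := le.
have le' : local_frame (om.1 `&` U) e.
  split; first exact: openI.
  - by move=> x [_ Ux]; exact: be.
  - move=> i; apply/(smooth_sec_on_at hA hV); first exact: openI.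
    by move=> q [_ Uq]; exact: (local_frame_smooth hA hV i le Uq).
have [phi af] := affine_frame_exists om.2 le'.
exists (om.1 `&` U), om.2, e, phi; split=> //; first by move=> q [oq _]; exact: origin_smooth.
by apply: (affine_frame_local le' af) => q [oq _]; exact: origin_smooth.
Qed.

Lemma aff_dual_vector_bundle : vector_bundle (aff_dual A).
Proof.
split=> [p|F [om ao [G vG [FE FP]]]].
  have [om [ao op]] := origin_at p; have [G vG Gp] := hV.1 p.
  have lG := vframe_local hV vG.
  have [phi af] := affine_frame_exists om.2 lG.
  exists (om.1 `&` G.1, phi); last by [].
  by exists om => //; exists G => //; split=> //= x [_ Gx]; exact: af.
have lG := vframe_local hV vG; have [oG bG sG] := lG; have [oo _] := hB.2 om ao.
have le' : local_frame F.1 G.2.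
  rewrite FE; split; first exact: openI.
  - by move=> x [_ Gx]; exact: bG.
  - move=> i; apply/(smooth_sec_on_at hA hV); first exact: openI.
    by move=> q [_ Gq]; exact: (local_frame_smooth hA hV i lG Gq).
apply: (affine_frame_local (o := om.2) le') => // p; rewrite FE => -[op _].
exact: origin_smooth.
Qed.

End AffineSections.

(** * Existence of a global section of A *)

Section GlobalSection.
Context {R : realType} {n r : nat} {M : charted R n} {V : vbundle M r} {A : abundle V}.
Hypotheses (hM : smooth_manifold M) (hV : vector_bundle V) (hB : affine_bundle A).
Let hA := manifold_atlas hM.

Definition blend_data (c : M -> R) (a : asec A) : Prop :=
  smooth_fun c /\ exists U, [/\ forall p, U p -> asec_smooth_at a p, forall p, c p != 0 -> U p &
    exists W, [/\ open W, forall q, W q -> c q = 0 & forall q, ~ U q -> W q]].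

(** Second countability enters here. Every point has a basic neighbourhood on which some cut-off of
    an origin is constantly 1; one such cut-off is chosen for each basic set, indexed by the
    injection [g] of the basis into [nat]. *)
Lemma countable_blend_cover : exists (c : nat -> M -> R) (a : nat -> asec A),
  (forall k, blend_data (c k) (a k)) /\
  forall p, exists k W, [/\ open W, W p & forall q, W q -> c k q = 1].
Proof.
have [_ _ _ [B cB [oB bB]]] := hM.
have /countable_injP[g ginj] := cB.
have hdef x : exists y : A x, True by have [y] := ainhab (A x); exists y.
pose a0 : asec A := fun x => sval (cid (hdef x)).
pose P (b : set M) (c : M -> R) (a : asec A) := blend_data c a /\ forall q, b q -> c q = 1.
have H k : exists ca : (M -> R) * asec A, blend_data ca.1 ca.2 /\
    forall b, B b -> g b = k -> (exists c a, P b c a) -> forall q, b q -> ca.1 q = 1.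
  have [[b [Bb [gb [c [a [bd ca]]]]]]|nb] :=
      pselect (exists b, B b /\ g b = k /\ exists c a, P b c a).
    exists (c, a); split=> // b' Bb' gb' _ q b'q; apply: ca.
    by rewrite -(ginj b' b (mem_set Bb') (mem_set Bb))// gb.
  (* An index that serves no basic set gets the weight 0. Its section [a0] need not be smooth, as
     the set [U] is then empty. *)
  exists (fun=> 0, a0); split=> [|b Bb gb Pb]; last by case: nb; exists b.
  split=> /=; first exact: smooth_fun_cst.
  exists set0; split=> // [p|]; first by rewrite eqxx.
  by exists setT; split=> //; exact: openT.
have [ca Hca] := choice H.
exists (fun k => (ca k).1), (fun k => (ca k).2); split=> [k|p]; first by have [] := Hca k.
have [om [ao op]] := origin_at hB p; have [oom _] := hB.2 om ao.
have [chi bchi] := manifold_bump hM oom op; have [schi [W [oW Wp W1]] [W' [oW' W'0 nW']]] := bchi.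
have [b [Bb bp] bW] := bB p W (open_nbhs_nbhs (conj oW Wp)).
exists (g b), b; split=> //; first exact: oB.
have [_ Hk] := Hca (g b); apply: (Hk b Bb erefl).
exists chi, om.2; split=> [|q bq]; last by apply: W1; exact: bW.
split=> //; exists om.1; split=> //; last by exists W'.
- by move=> q oq; exact: (origin_smooth hA hV hB ao).
- by move=> q; apply: contra_neqP => /nW'; exact: W'0.
Qed.

(* The local sections a k are blended along a finite but locally varying range
   of indices: once c k = 1, the indices beyond k do not matter. *)
Lemma global_asec_exists : exists X : asec A, smooth_asec X.
Proof.
have [c [a [bd cov]]] := countable_blend_cover.
pose blend k (q : M) (x : A q) : A q := x +> (c k q *: adiff x (a k q)).
(* Higher indices are blended first, so that a stage with c k q = 1 forgets all of them. *)
pose G := fix G k (q : M) (x : A q) : A q := if k is k'.+1 then G k' q (blend k' q x) else x.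
have blend1 k q x : c k q = 1 -> blend k q x = a k q.
  by move=> ck1; rewrite /blend ck1 scale1r -adiffE.
have G_indep m k q x : c k q = 1 -> (k < m)%N -> G m q x = G k q (a k q).
  move=> ck1; elim: m x => // m IH x; rewrite ltnS leq_eqVlt => /orP[/eqP <-|km] /=.
    by rewrite blend1.
  exact: IH.
have Hm q : exists m, exists2 k, (k < m)%N & c k q = 1.
  by have [k [W [_ Wq Wc]]] := cov q; exists k.+1, k; rewrite ?Wc.
pose m q := sval (cid (Hm q)).
pose X : asec A := fun q => G (m q) q (a 0%N q).
exists X; apply/(smooth_asecP hA hV hB) => p.
have [k [W [oW Wp Wc]]] := cov p.
have XE q : W q -> X q = G k q (a k q).
  move=> Wq; rewrite /X /m; case: cid => mq /= [k' k'm ck'].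
  rewrite (G_indep mq k' q)// -(G_indep (maxn k k').+1 k' q (a 0%N q))//.
    by apply: G_indep (Wc _ Wq) _ => //; rewrite ltnS leq_maxl.
  by rewrite ltnS leq_maxr.
have nz q : W q -> c k q != 0 by move=> /Wc ->; exact: oner_neq0.
apply: (asec_smooth_eq hA oW Wp (X := fun q => G k q (a k q))) => [q Wq|].
  by rewrite XE.
have : asec_smooth_at (a k) p.
  by have [_ [U [sU cU _]]] := bd k; apply: sU; apply: cU; exact: nz.
elim: k (a k) {W oW Wp Wc XE nz} => [|k IH] Y sY //=.
apply: IH; rewrite /blend; have [/(smooth_funP hA) sc [U [sU cU [W [oW W0 nUW]]]]] := bd k.
have [Up|/nUW Wp] := pselect (U p).
  apply: (asec_smooth_shift hA hV (Y := fun q => c k q *: asec_diff Y (a k) q) sY).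
  apply: (sec_smooth_scale hA hV) => //.
  by apply: (asec_diff_smooth hA hV hB) => //; exact: sU.
apply: (asec_smooth_eq hA oW Wp (X := Y)) => // q Wq.
by rewrite W0// scale0r ashift0.
Qed.

End GlobalSection.

(** * The AV-bundle A^+ over V^* *)

Section MuBundle.
Context {R : realType} {n r : nat} {M : charted R n} {V : vbundle M r} {A : abundle V}.
Hypotheses (hA : smooth_atlas M) (hV : vector_bundle V) (hB : affine_bundle A).
Let hD := dual_vector_bundle hA hV.
Let hP := aff_dual_vector_bundle hA hV hB.
Let hTD := total_atlas hA hD.
Let hTP := total_atlas hA hP.
Local Notation N := (total_space (dual_bundle V)).
Local Notation Z := (total_space (aff_dual A)).

(** Together with [mu], this evaluation along [X] trivializes A^+ as V^* x R; when [X] is e_0 it is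
    the coordinate y_0. *)
Definition point_fun (X : asec A) (z : Z) : R := projT2 z (X (projT1 z)).

Lemma smooth_at_linear_part (z : Z) U e i : local_frame U e -> U (projT1 z) ->
  @smooth_at R _ Z (fun z => linear_part (projT2 z) (e i (projT1 z))) z.
Proof.
move=> le Uz; have [U' [om [e' [phi [le' af U'z so lphi]]]]] := affine_frame_at hA hV hB (projT1 z).
have [oU be se] := le; have [oU' be' _] := le'.
pose W := (fun z : Z => projT1 z : M) @^-1` (U `&` U').
have oW : open W by apply: (projection_open hA hP); exact: openI.
apply: (@smooth_at_eq _ _ _ hTP (fun z : Z => \sum_j sec_coord e' (e i) j (projT1 z) *
   bcoord (fun a => phi a (projT1 z)) (projT2 z) 0 (lift ord0 j)) _ _ W) => // [q [Uq U'q]|].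
  rewrite [X in _ = dual_fun _ X](bcoordE (e i (projT1 q)) (be' _ U'q)) dual_sum.
  by apply: eq_bigr => j _; rewrite dualZ (affine_frame_coordS _ _ le' af U'q).
apply: (smooth_at_sum hTP) => j; apply: (smooth_at_mul hTP).
  apply: (@smooth_at_basic _ _ _ _ _ hA hP (sec_coord e' (e i) j)).
  exact: (smooth_at_coord hA hV j le' oU (se i)).
exact: (smooth_at_fibre_coord hA hP (lift ord0 j) lphi U'z).
Qed.

Lemma smooth_at_point_fun X (z : Z) : asec_smooth_at X (projT1 z) -> @smooth_at R _ Z (point_fun X) z.
Proof.
move=> sX; have [U [om [e [phi [le af Uz so lphi]]]]] := affine_frame_at hA hV hB (projT1 z).
have [oU be se] := le.
pose W := (fun z : Z => projT1 z : M) @^-1` U.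
have oW : open W by exact: (projection_open hA hP).
apply: (@smooth_at_eq _ _ _ hTP (fun z : Z => bcoord (fun a => phi a (projT1 z)) (projT2 z) 0 ord0 +
   \sum_j sec_coord e (asec_diff om X) j (projT1 z) *
   linear_part (projT2 z) (e j (projT1 z))) _ _ W) => // [q Uq|].
  rewrite /point_fun [X in _ = affine_funval _ X](adiffE (om (projT1 q)) (X (projT1 q))) linear_partE.
  rewrite (affine_frame_coord0 _ le af Uq); congr (_ + _).
  rewrite [X in _ = dual_fun _ X](bcoordE (adiff (om (projT1 q)) (X (projT1 q))) (be _ Uq)) dual_sum.
  by apply: eq_bigr => j _; rewrite dualZ.
apply: (smooth_at_add hTP); first exact: (smooth_at_fibre_coord hA hP ord0 lphi Uz).
apply: (smooth_at_sum hTP) => j; apply: (smooth_at_mul hTP).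
  apply: (@smooth_at_basic _ _ _ _ _ hA hP (sec_coord e (asec_diff om X) j)).
  have sd := asec_diff_smooth hA hV hB (so _ Uz) sX.
  exact: (sec_smooth_coord j sd le Uz).
exact: (smooth_at_linear_part j le Uz).
Qed.

Lemma mu_smooth : smooth_map (@mu R n M r V A).
Proof.
apply: (smooth_map_coord hTP hTD) => [|z _]; first exact: openT.
have [U [e [le Uz]]] := frame_at hV (projT1 z); have [f fe] := dual_frame_exists le.
have lf := dual_frame_local hA hV le fe; have [oU be _] := le.
have [d [ad mt [dz _]]] := tchart_at hA hD (z := mu z) lf Uz.
have md := hA.2 _ ad.
pose W := (fun z : Z => projT1 z : M) @^-1` (U `&` chart_dom d).
have oW : open W.
  by apply: (projection_open hA hP); apply: openI => //; exact: (chart_dom_open hA).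
exists (tchart d U f), W; split=> //; first by move=> q [].
move=> j; have [k ->|k ->] := split_ordP j.
  apply: (@smooth_at_eq _ _ _ hTP (fun z : Z => d (projT1 z) 0 k) _ _ W) => // [q _|].
    by rewrite /= row_mxEl.
  apply: (@smooth_at_basic _ _ _ _ _ hA hP (fun p => d p 0 k)).
  exact: (smooth_at_chart hA).
apply: (@smooth_at_eq _ _ _ hTP (fun z : Z => linear_part (projT2 z) (e k (projT1 z))) _ _ W) => // [q [Uq _]|].
  by rewrite /= row_mxEr (dual_bcoord _ _ (be _ Uq) (fe _ Uq)).
exact: (smooth_at_linear_part k le Uz).
Qed.

Lemma mu_eq (z z' : Z) (X : asec A) : mu z = mu z' -> point_fun X z = point_fun X z' -> z = z'.
Proof.
case: z z' => [p z] [p' z'] E; have pp' : p = p' by have := congr1 (@projT1 _ _) E.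
subst p'; rewrite /point_fun/= => E0; congr existT; apply: (affine_eq_at E0).
(* The second components of equal dependent pairs are equal because equality on [M] is classically
   decidable. *)
by apply: Eqdep_dec.inj_pair2_eq_dec E => x y; exact: pselect.
Qed.

End MuBundle.

(** * Products of manifolds, for the domain V^* x R of the trivialization *)

Section ProductManifold.
Context {R : realType} {n m : nat} {N : charted R n} {N' : charted R m}.
Hypotheses (hN : smooth_atlas N) (hN' : smooth_atlas N').

Lemma submx_open (Y : set 'rV[R]_n) (Y' : set 'rV[R]_m) : open Y -> open Y' ->
  open [set y : 'rV[R]_(n + m) | Y (lsubmx y) /\ Y' (rsubmx y)].
Proof.
move=> oY oY'.
have o1 : open ((fun y : 'rV[R]_(n + m) => lsubmx y : 'rV[R]_n) @^-1` Y).
  have := @open_preimage_within 'rV[R]_(n + m) 'rV[R]_n setT (fun y => lsubmx y) Y openT oY.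
  rewrite setTI; apply.
  by move=> y _; apply: differentiable_continuous; exact: differentiable_lsubmx.
have o2 : open ((fun y : 'rV[R]_(n + m) => rsubmx y : 'rV[R]_m) @^-1` Y').
  have := @open_preimage_within 'rV[R]_(n + m) 'rV[R]_m setT (fun y => rsubmx y) Y' openT oY'.
  rewrite setTI; apply.
  by move=> y _; apply: differentiable_continuous; exact: differentiable_rsubmx.
exact: openI o1 o2.
Qed.

Lemma prod_chart_transition c c' d d' : maximal_atlas c -> maximal_atlas c' ->
  maximal_atlas d -> maximal_atlas d' ->
  @smooth_transition R _ (N * N') (prod_chart c d) (prod_chart c' d').
Proof.
move=> mc mc' md md'.
pose W := chart_dom c' `&` chart_dom c; pose W' := chart_dom d' `&` chart_dom d.
have oW : open W by apply: openI; exact: (chart_dom_open hN).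
have oW' : open W' by apply: openI; exact: (chart_dom_open hN').
have oY := chart_imageW_open hN mc oW (@subIsetr _ _ _).
have oY' := chart_imageW_open hN' md oW' (@subIsetr _ _ _).
have IY : @prod_chart R n m N N' c d @` (chart_dom (prod_chart c' d') `&` chart_dom (prod_chart c d)) =
    [set y | (c @` W) (lsubmx y) /\ (d @` W') (rsubmx y)].
  apply/seteqP; split=> [_ [[p q] [[/= cp dq] [cp' dq']] <-]|y [[p [cp' cp] py] [q [dq' dq] qy]]].
    by rewrite /= row_mxKl row_mxKr; split; [exists p|exists q].
  by exists (p, q) => //=; rewrite py qy hsubmxK.
have oI := submx_open oY oY'.
split=> [|j]; rewrite ?IY//.
have [k ->|k ->] := split_ordP j.
  exists (fun y => chart_rep c (fun q => c' q 0 k) (lsubmx y)).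
    rewrite IY; apply: (@smooth_in_comp _ _ _ _ (c @` W) (chart_rep c (fun q => c' q 0 k)) (fun y => lsubmx y)) => //.
    - by move=> y [].
    - move=> vs y [p [c'p cp] <-].
      exact: (smooth_at_in (smooth_at_chart hN k mc' c'p) mc cp).
    - move=> i; rewrite (_ : (fun y => _) = (fun y : 'rV[R]_(n + m) => y 0 (lshift m i))); last first.
        by apply/funext => y; rewrite mxE.
      exact: smooth_in_coord.
  by move=> [p q] [c'p _] [cp _] /=; rewrite row_mxKl chart_repE// row_mxEl.
exists (fun y => chart_rep d (fun q => d' q 0 k) (rsubmx y)).
  rewrite IY; apply: (@smooth_in_comp _ _ _ _ (d @` W') (chart_rep d (fun q => d' q 0 k)) (fun y => rsubmx y)) => //.
  - by move=> y [].
  - move=> vs y [p [d'p dp] <-].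
    exact: (smooth_at_in (smooth_at_chart hN' k md' d'p) md dp).
  - move=> i; rewrite (_ : (fun y => _) = (fun y : 'rV[R]_(n + m) => y 0 (rshift n i))); last first.
      by apply/funext => y; rewrite mxE.
    exact: smooth_in_coord.
by move=> [p q] [_ d'q] [_ dq] /=; rewrite row_mxKr chart_repE// row_mxEr.
Qed.

Lemma prod_atlas : smooth_atlas (prod_charted N N').
Proof.
split=> [[p q]|c ac].
  have [c ac cp] := hN.1 p; have [d ad dq] := hN'.1 q.
  by exists (prod_chart c d); first by exists c => //; exists d.
have [c1 ac1 [d1 ad1 <-]] := ac; have mc1 := hN.2 _ ac1; have md1 := hN'.2 _ ad1.
split=> [[p q] [p' q'] [cp dq] [cp' dq'] /eq_row_mx[E1 E2]|_ [c2 ac2 [d2 ad2 <-]]].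
  by congr pair; [exact: (chart_inj mc1 cp cp' E1)|exact: (chart_inj md1 dq dq' E2)].
have mc2 := hN.2 _ ac2; have md2 := hN'.2 _ ad2.
by split; exact: prod_chart_transition.
Qed.

Lemma prod_chart_maximal c d : atlas c -> atlas d ->
  @maximal_atlas R _ (prod_charted N N') (prod_chart c d).
Proof. by move=> ac ad; apply: prod_atlas.2; exists c => //; exists d. Qed.

Lemma fst_smooth : @smooth_map R _ _ (prod_charted N N') N (fun z => z.1).
Proof.
apply: (smooth_map_coord prod_atlas hN) => [|[p q] _]; first exact: openT.
have [c ac cp] := hN.1 p; have [d ad dq] := hN'.1 q.
have mcd := prod_chart_maximal ac ad; have mc := hN.2 _ ac.
exists c, (chart_dom (prod_chart c d)); split=> //.
- exact: (chart_dom_open prod_atlas mcd).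
- by move=> z [].
- move=> j; rewrite (_ : (fun z => _) = (fun z => prod_chart c d z 0 (lshift m j))); last first.
    by apply/funext => z; rewrite /= row_mxEl.
  by apply: (smooth_at_chart prod_atlas).
Qed.

Lemma snd_smooth : @smooth_map R _ _ (prod_charted N N') N' (fun z => z.2).
Proof.
apply: (smooth_map_coord prod_atlas hN') => [|[p q] _]; first exact: openT.
have [c ac cp] := hN.1 p; have [d ad dq] := hN'.1 q.
have mcd := prod_chart_maximal ac ad; have md := hN'.2 _ ad.
exists d, (chart_dom (prod_chart c d)); split=> //.
- exact: (chart_dom_open prod_atlas mcd).
- by move=> z [].
- move=> j; rewrite (_ : (fun z => _) = (fun z => prod_chart c d z 0 (rshift n j))); last first.
    by apply/funext => z; rewrite /= row_mxEr.
  by apply: (smooth_at_chart prod_atlas).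
Qed.

End ProductManifold.

Section RealLine.
Context {R : realType}.

Let line_chart : chart R 1 R := {| chart_dom := setT ; chart_map := fun t => const_mx t |}.

Lemma real_line_atlas : smooth_atlas (real_line R).
Proof.
split=> [t|_ ->]; first by exists line_chart.
have tr : @smooth_transition R 1 R line_chart line_chart.
  have IY : line_chart @` (setT `&` setT) = setT.
    apply/seteqP; split=> // y _; exists (y 0 0) => //=.
    by apply/rowP => i; rewrite mxE ord1.
  split=> [|j]; first by rewrite IY; exact: openT.
  exists (fun x => x 0 j : R^o); first exact: smooth_in_coord.
  by move=> t _ _; rewrite /= !mxE.
split=> [s t _ _ /matrixP/(_ 0 0)|_ ->]; first by rewrite !mxE.
by split.
Qed.

Lemma real_line_id (t : R) : @smooth_at R 1 (real_line R) (fun s => s) t.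
Proof.
rewrite (_ : (fun s : real_line R => s : R) = (fun s => line_chart s 0 0)); last first.
  by apply/funext => s; rewrite mxE.
by apply: (smooth_at_chart real_line_atlas) => //; apply: real_line_atlas.2.
Qed.

End RealLine.

(** * The global trivialization of A^+ over V^* given by a section of A *)

Section AVBundleMu.
Context {R : realType} {n r : nat} {M : charted R n} {V : vbundle M r} {A : abundle V}.
Hypotheses (hM : smooth_manifold M) (hV : vector_bundle V) (hB : affine_bundle A).
Let hA := manifold_atlas hM.
Let hD := dual_vector_bundle hA hV.
Let hP := aff_dual_vector_bundle hA hV hB.
Let hTD := total_atlas hA hD.
Let hTP := total_atlas hA hP.
Local Notation N := (total_space (dual_bundle V)).
Local Notation Z := (total_space (aff_dual A)).

(** The inverse of the pair formed by [mu] and [point_fun X]. *)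
Definition mu_lift (X : asec A) (w : N) (t : R) : Z :=
  existT (fun x => aff_dual A x) (projT1 w)
    (sval (cid (affine_fun_exists (X (projT1 w)) (projT2 w) t))).

Lemma mu_lift_mu X w t : mu (mu_lift X w t) = w.
Proof.
by case: w => p w; rewrite /mu_lift /mu/=; case: cid => phi /= [_ ->].
Qed.

Lemma mu_lift_point X w t : point_fun X (mu_lift X w t) = t.
Proof. by rewrite /mu_lift /point_fun/=; case: cid => phi /= []. Qed.

Lemma mu_lift_part X w t : linear_part (projT2 (mu_lift X w t)) = projT2 w.
Proof. by rewrite /mu_lift/=; case: cid => phi /= []. Qed.

Lemma mu_shift_mu (z : Z) t : mu (mu_shift z t) = mu z.
Proof.
case: z => p z; rewrite /mu /mu_shift/=; congr existT.
by rewrite linear_partD linear_partZ linear_part_one scaler0 addr0.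
Qed.

Lemma mu_shift_point X (z : Z) t : point_fun X (mu_shift z t) = point_fun X z + t.
Proof.
by rewrite /point_fun/= -[LHS]/(projT2 z (X (projT1 z)) + t * 1) mulr1.
Qed.

Lemma mu_lift_smooth X : smooth_asec X ->
  @smooth_map_on R _ _ (prod_charted N (real_line R)) Z (setT `*` setT)
    (fun qt => mu_lift X qt.1 qt.2).
Proof.
move=> /(smooth_asecP hA hV hB) sX.
have hN := prod_atlas hTD (@real_line_atlas R).
have s1 := fst_smooth hTD (@real_line_atlas R); have s2 := snd_smooth hTD (@real_line_atlas R).
apply: (smooth_map_coord hN hTP) => [|[w t] _]; first by rewrite setXTT; exact: openT.
have [U [om [e [phi [le af Uz so lphi]]]]] := affine_frame_at hA hV hB (projT1 w).
have [d [ad mt [dz _]]] := tchart_at hA hP (z := mu_lift X w t) lphi Uz.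
have md := hA.2 _ ad; have [oU be _] := le.
pose W0 : set N := (fun w : N => projT1 w : M) @^-1` (U `&` chart_dom d).
have oW0 : open W0.
  by apply: (projection_open hA hD); apply: openI => //; exact: (chart_dom_open hA).
pose W : set (prod_charted N (real_line R)) := (fun z => z.1) @^-1` W0.
have oW : open W.
  rewrite -[W]setTI; apply: (@open_preimage_within _ _ setT (fun z : prod_charted N (real_line R) => z.1 : N)) => //.
    exact: openT.
  by move=> z _; have [+ _] := s1; exact.
have Wwt : W (w, t) by [].
exists (tchart d U phi), W; split=> //; first by move=> q [].
have sfst f : @smooth_at R _ N f w -> @smooth_at R _ (prod_charted N (real_line R)) (fun z => f z.1) (w, t).
  by move=> sf; exact: (@smooth_map_at _ _ _ _ _ hN hTD _ f (w, t) s1 sf).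
move=> j; have [k ->|k ->] := split_ordP j.
  apply: (@smooth_at_eq _ _ _ hN (fun z => d (projT1 z.1) 0 k) _ _ W) => // [q _|].
    by rewrite /= row_mxEl.
  apply: (sfst (fun w : N => d (projT1 w) 0 k)); apply: (@smooth_at_basic _ _ _ _ _ hA hD (fun p => d p 0 k)).
  exact: (smooth_at_chart hA).
have [i ->|->] := unliftP ord0 k.
  apply: (@smooth_at_eq _ _ _ hN (fun z => linear_fun (e i) z.1) _ _ W) => // [q [Uq _]|].
    by rewrite /= row_mxEr (affine_frame_coordS _ _ le af Uq) -/(projT2 (mu_lift X q.1 q.2)) mu_lift_part.
  apply: (sfst (linear_fun (e i))); apply: (smooth_at_linear hA hV); exact: (local_frame_smooth hA hV i le Uz).
apply: (@smooth_at_eq _ _ _ hN (fun z => z.2 + linear_fun (asec_diff X om) z.1) _ _ W) => // [q [Uq _]|].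
  rewrite /= row_mxEr (affine_frame_coord0 _ le af Uq) -/(projT2 (mu_lift X q.1 q.2)).
  rewrite [X in _ = affine_funval _ X](adiffE (X (projT1 q.1)) (om (projT1 q.1))) linear_partE mu_lift_part.
  by congr (_ + _); rewrite -[RHS]/(point_fun X (mu_lift X q.1 q.2)) mu_lift_point.
apply: (smooth_at_add hN).
  exact: (@smooth_map_at _ _ _ _ _ hN (@real_line_atlas R) _ (fun s => s) (w, t) s2 (real_line_id t)).
apply: (sfst (linear_fun (asec_diff X om))); apply: (smooth_at_linear hA hV).
by apply: (asec_diff_smooth hA hV hB) => //; exact: so.
Qed.

Lemma mu_av_bundle : av_bundle (@mu R n M r V A) (@mu_shift R n M r V A).
Proof.
have [X sX] := global_asec_exists hM hV hB.
split.
- split; [exact: total_manifold|exact: total_manifold|exact: mu_smooth|].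
  by move=> w; exists (mu_lift X w 0); exact: mu_lift_mu.
- by move=> z; apply: (mu_eq (X := X)); rewrite ?mu_shift_mu// mu_shift_point addr0.
- move=> z s t; apply: (mu_eq (X := X)); first by rewrite !mu_shift_mu.
  by rewrite !mu_shift_point addrA.
- split=> [z t|z z' zz']; first exact: mu_shift_mu.
  exists (point_fun X z' - point_fun X z); split=> [|t ->].
    by apply: (mu_eq (X := X)); rewrite ?mu_shift_mu// mu_shift_point addrC subrK.
  by rewrite mu_shift_point addrC addKr.
- move=> q; exists setT, (fun qt => mu_lift X qt.1 qt.2), (point_fun X).
  split=> //; first exact: openT.
  split=> //=.
  + exact: mu_lift_smooth.
  + rewrite preimage_setT; apply/(smooth_funP hTP) => z.
    by apply: (smooth_at_point_fun hA hV hB); have /(smooth_asecP hA hV hB) := sX.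
  + by move=> w t _; rewrite mu_lift_mu mu_lift_point.
  + by move=> z _; apply: (mu_eq (X := X)); rewrite ?mu_lift_mu// mu_lift_point.
  + move=> w s t _; apply: (mu_eq (X := X)); first by rewrite mu_shift_mu !mu_lift_mu.
    by rewrite mu_shift_point !mu_lift_point.
Qed.

End AVBundleMu.

(** * The linear Poisson bracket on V^* *)

Section Restriction.
Context {R : realType} {n : nat} {N : charted R n}.
Hypothesis hN : smooth_atlas N.

(** The map may be changed off the smaller domain. Coordinates that were cut off to become global
    functions thus still form a chart near the point. *)
Lemma restrict_maximal (c : chart R n N) (U : set N) (u : N -> 'rV[R]_n) :
  maximal_atlas c -> open U -> U `<=` chart_dom c -> (forall p, U p -> u p = c p) ->
  maximal_atlas {| chart_dom := U ; chart_map := u |}.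
Proof.
move=> mc oU Uc uE; pose c0 : chart R n N := {| chart_dom := U ; chart_map := c |}.
have m0 : maximal_atlas c0.
  split=> [p q Up Uq|c' ac']; first by apply: (chart_inj mc); exact: Uc.
  have mc' := hN.2 _ ac'; have oc' := chart_dom_open hN mc'.
  split; split.
  - rewrite (_ : c0 @` _ = c @` ((chart_dom c' `&` U) `&` chart_dom c)).
      by apply: (chart_image_open hN) => //; exact: openI.
    apply/seteqP; split=> [_ [p [c'p Up] <-]|_ [p [[c'p Up] _] <-]]; last by exists p.
    by exists p => //; split=> //; exact: Uc.
  - move=> j; have [g sg gE] := @smooth_at_maximal _ _ _ (chart_dom c') (fun p => c' p ord0 j) c oc' mc
      (fun p c'p => smooth_at_chart hN j mc' c'p).
    exists g => [|p c'p Up]; last by rewrite gE//; exact: Uc.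
    by apply: smooth_in_sub sg => _ [p [c'p Up] <-]; exists p => //; split=> //; exact: Uc.
  - by apply: (chart_image_open hN).
  - move=> j; have [g sg gE] := @smooth_at_maximal _ _ _ U (fun p => c p ord0 j) c' oU mc'
      (fun p Up => smooth_at_chart hN j mc (Uc p Up)).
    by exists g.
split=> [p q Up Uq /=|c' ac']; first by rewrite !uE//; exact: m0.1.
have [t1 t2] := m0.2 c' ac'; split.
  apply: (@smooth_transition_eq _ _ _ c0 _ c' _) => // p Up; by rewrite /= uE.
by apply: (@smooth_transition_eq _ _ _ c' _ c0 _) => // p Up; rewrite /= uE.
Qed.

End Restriction.

Lemma local_frame_eq (R : realType) (n r : nat) (M : charted R n) (E : vbundle M r)
    (hA : smooth_atlas M) (hE : vector_bundle E) (U W : set M) (e e' : 'I_r -> sec E) :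
  local_frame U e -> open W -> W `<=` U -> (forall p, W p -> forall i, e' i p = e i p) ->
  local_frame W e'.
Proof.
move=> le oW WU ee'; have [oU be _] := le; split=> // [p Wp|i].
  by rewrite (_ : (fun i => e' i p) = fun i => e i p); [exact/be/WU|apply/funext => i; exact: ee'].
apply/(smooth_sec_on_at hA hE) => // p Wp.
apply: (sec_smooth_eq hA oW Wp (s := e i)) => [q Wq|]; first by rewrite ee'.
by apply: (local_frame_smooth hA hE i le); exact: WU.
Qed.

Lemma tangent_sum_comb (R : realType) (n : nat) (N : charted R n) (z : N) (I : finType)
    (a : I -> R) (v : I -> (N -> R) -> R) : (forall i, tangent_vector z (v i)) ->
  tangent_vector z (fun F => \sum_i a i * v i F).
Proof.
move=> tv; split=> [k f g sf sg|f g sf sg].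
  rewrite mulr_sumr -big_split/=; apply: eq_bigr => i _.
  by rewrite (tv i).1// mulrDr mulrCA.
rewrite mulr_suml mulr_sumr -big_split/=; apply: eq_bigr => i _.
by rewrite (tv i).2// mulrDr mulrA (mulrCA (a i)).
Qed.

(** * Tangent vectors to V^* and their values on generators *)

Section Generators.
Context {R : realType} {n r : nat} {M : charted R n} {V : vbundle M r}.
Hypotheses (hM : smooth_manifold M) (hV : vector_bundle V).
Let hA := manifold_atlas hM.
Let hD := dual_vector_bundle hA hV.
Let hN := total_manifold hM hD.
Let hTN := manifold_atlas hN.
Local Notation N := (total_space (dual_bundle V)).

Definition basic_fun (f : M -> R) (w : N) : R := f (projT1 w).

Lemma basic_smooth f : smooth_fun f -> smooth_fun (basic_fun f).
Proof.
move=> /(smooth_funP hA) sf; apply/(smooth_funP hTN) => w.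
exact: (@smooth_at_basic _ _ _ _ _ hA hD f).
Qed.

Lemma linear_smooth Y : smooth_sec Y -> smooth_fun (@linear_fun R n r M V Y).
Proof.
move=> /(smooth_secP hA hV) sY; apply/(smooth_funP hTN) => w.
exact: (smooth_at_linear hA hV).
Qed.

Lemma base_open (W : set M) : open W -> open [set w : N | W (projT1 w)].
Proof. by move=> oW; have := projection_open hA hD oW. Qed.

Definition base_chart (W : set M) (x : 'I_n -> M -> R) : chart R n M :=
  {| chart_dom := W ; chart_map := fun p => \row_i x i p |}.

Definition gen_coord (x : 'I_n -> M -> R) (e : 'I_r -> sec V) (w : N) : 'rV[R]_(n + r) :=
  row_mx (\row_i x i (projT1 w)) (\row_i linear_fun (e i) w).

Definition gen_chart (W : set M) (x : 'I_n -> M -> R) (e : 'I_r -> sec V) : chart R (n + r) N :=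
  {| chart_dom := [set w | W (projT1 w)] ; chart_map := gen_coord x e |}.

(* Coordinates and frames are taken global because tangent vectors act on global
   functions only. *)
Definition generators (W : set M) (x : 'I_n -> M -> R) (e : 'I_r -> sec V) : Prop :=
  [/\ open W, forall i, smooth_fun (x i), forall i, smooth_sec (e i),
      maximal_atlas (base_chart W x) & local_frame W e].

Lemma generators_of_local p d U (e0 : 'I_r -> sec V) : maximal_atlas d -> chart_dom d p ->
  local_frame U e0 -> U p -> exists W x e, [/\ generators W x e, W p, W `<=` chart_dom d `&` U,
    forall q, W q -> \row_i x i q = d q & forall q, W q -> forall i, e i q = e0 i q].
Proof.
move=> md dp le Up; have [oU be _] := le.
have odU : open (chart_dom d `&` U) by apply: openI => //; exact: (chart_dom_open hA).
have [chi bchi] := manifold_bump hM odU (conj dp Up).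
have [_ [W1 [oW1 W1p chi1]] _] := bchi.
pose x i q : R := chi q * d q 0 i; pose e i q := chi q *: e0 i q.
pose W := W1 `&` (chart_dom d `&` U); have oW : open W by exact: openI.
have xE q : W q -> \row_i x i q = d q.
  by move=> [W1q _]; apply/rowP => i; rewrite mxE /x chi1// mul1r.
have eE q : W q -> forall i, e i q = e0 i q by move=> [W1q _] i; rewrite /e chi1// scale1r.
exists W, x, e; split=> //; last by move=> q [].
split=> //.
- move=> i; apply: (smooth_cutoff hM odU bchi) => q [dq _].
  exact: (smooth_at_chart hA).
- move=> i; apply: (sec_cutoff hM hV odU bchi) => q [_ Uq].
  exact: (local_frame_smooth hA hV i le Uq).
- by apply: (restrict_maximal hA md oW) => // q [_ []].
- by apply: (local_frame_eq hA hV le oW) => // q [_ []].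
Qed.

Lemma generators_at p : exists W x e, generators W x e /\ W p.
Proof.
have [d ad dp] := hA.1 p; have [U [e0 [le Up]]] := frame_at hV p.
by have [W [x [e [g Wp _ _ _]]]] := generators_of_local (hA.2 _ ad) dp le Up; exists W, x, e.
Qed.

Lemma gen_chart_maximal W x e : generators W x e -> maximal_atlas (gen_chart W x e).
Proof.
move=> [oW sx se mx le]; have [f fe] := dual_frame_exists le.
have lf := dual_frame_local hA hV le fe; have [_ be _] := le.
apply: (restrict_maximal hTN (tchart_maximal hA hD mx lf)) => //.
- exact: base_open.
- move=> w Ww; rewrite /gen_coord /=; congr row_mx; apply/rowP => i; rewrite mxE.
  by rewrite (dual_bcoord _ _ (be _ Ww) (fe _ Ww)).
Qed.

Lemma gen_coord_smooth W x e j : generators W x e -> smooth_fun (fun w => gen_coord x e w 0 j).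
Proof.
move=> [_ sx se _ _]; have [k ->|k ->] := split_ordP j.
  rewrite (_ : (fun w => _) = basic_fun (x k)); first exact: basic_smooth.
  by apply/funext => w; rewrite /gen_coord row_mxEl mxE.
rewrite (_ : (fun w => _) = linear_fun (e k)); first exact: linear_smooth.
by apply/funext => w; rewrite /gen_coord row_mxEr mxE.
Qed.

Definition partial_gen W x e (F : N -> R) (j : 'I_(n + r)) (w : N) : R :=
  'D_(delta_mx 0 j) (chart_rep (gen_chart W x e) F) (gen_coord x e w).

Section Local.
Variables (W : set M) (x : 'I_n -> M -> R) (e : 'I_r -> sec V).
Hypothesis g : generators W x e.
Let c := gen_chart W x e.
Let mc : maximal_atlas c := gen_chart_maximal g.
Let D : set N := [set w | W (projT1 w)].

Let oD : open D.
Proof. by apply: base_open; case: g. Qed.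

Let oY : open (c @` D).
Proof. by apply: (chart_imageW_open hTN mc). Qed.

Lemma rep_smooth (F : N -> R) : smooth_fun F -> smooth_in (c @` D) (chart_rep c F).
Proof.
move=> /(smooth_funP hTN) sF vs y [w Dw <-].
exact: (smooth_at_in (sF w) mc Dw).
Qed.

Lemma tangent_gen (z : N) v (F : N -> R) : tangent_vector z v -> W (projT1 z) -> smooth_fun F ->
  v F = \sum_i partial_gen W x e F (lshift r i) z * v (basic_fun (x i)) +
        \sum_a partial_gen W x e F (rshift n a) z * v (linear_fun (e a)).
Proof.
move=> tv Wz sF.
rewrite (@tangent_comp _ _ _ hN z v tv _ (gen_coord x e) (c @` D) (chart_rep c F) F D)//.
- rewrite big_split_ord/=; congr (_ + _); apply: eq_bigr => i _; congr (_ * v _).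
    by apply/funext => w; rewrite /gen_coord row_mxEl mxE.
  by apply/funext => w; rewrite /gen_coord row_mxEr mxE.
- by move=> j; exact: (gen_coord_smooth j g).
- by exists z.
- exact: rep_smooth.
- by move=> w Dw; rewrite -[gen_coord x e w]/(c w) chart_repE.
Qed.

Lemma partial_tangent (z : N) j : W (projT1 z) -> tangent_vector z (fun F => partial_gen W x e F j z).
Proof.
move=> Wz; have Yz : (c @` D) (gen_coord x e z) by exists z.
have dr F : smooth_fun F -> derivable (chart_rep c F) (gen_coord x e z) (delta_mx 0 j).
  by move=> sF; apply: diff_derivable; exact: smooth_in_differentiable (rep_smooth sF) Yz.
split=> [k F G sF sG|F G sF sG]; rewrite /partial_gen.
  rewrite (@near_eq_derive _ _ _ _ (fun y => k *: chart_rep c F y + chart_rep c G y)); last first.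
    apply: (open_near_eq oY Yz) => y [w Dw <-]; rewrite !chart_repE//.
  rewrite -[LHS]/('D_(delta_mx 0 j) ((k *: chart_rep c F) + chart_rep c G) _).
  rewrite deriveD; [|by apply: derivableZ; exact: dr|exact: dr].
  by rewrite deriveZ; [|exact: dr].
rewrite (@near_eq_derive _ _ _ _ (fun y => chart_rep c F y * chart_rep c G y)); last first.
  apply: (open_near_eq oY Yz) => y [w Dw <-]; rewrite !chart_repE//.
rewrite -[LHS]/('D_(delta_mx 0 j) (chart_rep c F * chart_rep c G) _) deriveM; [|exact: dr|exact: dr].
rewrite -[gen_coord x e z]/(c z) !chart_repE// addrC /GRing.scale/= mulrC//.
Qed.

Lemma partial_coord (z : N) j k : W (projT1 z) ->
  partial_gen W x e (fun w => gen_coord x e w 0 k) j z = (k == j)%:R.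
Proof.
move=> Wz; have Yz : (c @` D) (gen_coord x e z) by exists z.
rewrite /partial_gen (@near_eq_derive _ _ _ _ (fun y : 'rV[R]_(n + r) => y 0 k : R^o)).
  by rewrite derive_coord mxE.
by apply: (open_near_eq oY Yz) => y [w Dw <-]; rewrite chart_repE.
Qed.

Lemma partial_smooth (F : N -> R) j (z : N) : smooth_fun F -> W (projT1 z) ->
  smooth_at (partial_gen W x e F j) z.
Proof.
move=> sF Wz; apply: (@smooth_at_comp _ _ _ hTN _ (gen_coord x e) (c @` D)
  (fun y => 'D_(delta_mx 0 j) (chart_rep c F) y) z) => //.
- by move=> k; have /(smooth_funP hTN) := gen_coord_smooth k g.
- by exists z.
- by apply: smooth_in_derive; exact: rep_smooth.
Qed.

End Local.

Lemma tangent_eq (z : N) v v' : tangent_vector z v -> tangent_vector z v' ->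
  (forall f, smooth_fun f -> v (basic_fun f) = v' (basic_fun f)) ->
  (forall Y, smooth_sec Y -> v (linear_fun Y) = v' (linear_fun Y)) ->
  forall F, smooth_fun F -> v F = v' F.
Proof.
move=> tv tv' Ef EY F sF; have [W [x [e [g Wz]]]] := generators_at (projT1 z).
have [_ sx se _ _] := g.
rewrite (tangent_gen g tv Wz sF) (tangent_gen g tv' Wz sF).
by congr (_ + _); apply: eq_bigr => i _; rewrite ?Ef ?EY.
Qed.

(** The identities that the values of a tangent vector at [z] satisfy on basic and on fibrewise
    linear functions. By [tangent_exists] they also suffice. *)
Definition gen_compatible (z : N) (rho : (M -> R) -> R) (delta : sec V -> R) : Prop :=
  [/\ tangent_vector (projT1 z) rho,
      forall (k : R) Y Y', smooth_sec Y -> smooth_sec Y' ->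
        delta (fun p => k *: Y p + Y' p) = k * delta Y + delta Y'
    & forall f Y, smooth_fun f -> smooth_sec Y ->
        delta (fun p => f p *: Y p) = f (projT1 z) * delta Y + rho f * linear_fun Y z].

(** The argument of [tangent_local], applied to the section Y - Y' multiplied by 1 - chi. *)
Lemma compatible_local z rho delta Y Y' U : gen_compatible z rho delta -> open U ->
  U (projT1 z) -> smooth_sec Y -> smooth_sec Y' -> (forall p, U p -> Y p = Y' p) ->
  delta Y = delta Y'.
Proof.
move=> [trho dlin dmul] oU Uz sY sY' YE.
have [chi bchi] := manifold_bump hM oU Uz.
have [schi [W [_ Wp W1]] [W0 [_ chi0 nUW]]] := bchi.
have sB : smooth_sec (fun p => (-1) *: Y' p + Y p).
  apply/(smooth_secP hA hV) => p; have /(smooth_secP hA hV)/(_ p) sYp := sY.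
  have /(smooth_secP hA hV)/(_ p) sY'p := sY'.
  apply: (sec_smooth_add hA hV) => //; apply: (sec_smooth_scale hA hV) => //.
  exact: (smooth_at_cst hA).
have s1 : smooth_fun (fun q => 1 - chi q).
  by apply: (smooth_fun_sub hM) => //; exact: smooth_fun_cst.
apply/eqP; rewrite -subr_eq0 addrC -mulN1r -dlin//; apply/eqP.
have := dmul _ _ s1 sB.
rewrite W1// subrr mul0r add0r /linear_fun (YE _ Uz) scaleN1r addNr dual0 mulr0 => <-.
congr delta; apply/functional_extensionality_dep => q.
have [Uq|/nUW Wq] := pselect (U q); first by rewrite YE// scaleN1r addNr scaler0.
by rewrite chi0// subr0 scale1r.
Qed.

Lemma compatible_sum z rho delta (I : finType) (f : I -> M -> R) (Y : I -> sec V) :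
  gen_compatible z rho delta -> (forall i, smooth_fun (f i)) -> (forall i, smooth_sec (Y i)) ->
  smooth_sec (fun p => \sum_i f i p *: Y i p) /\
  delta (fun p => \sum_i f i p *: Y i p) =
    \sum_i (f i (projT1 z) * delta (Y i) + rho (f i) * linear_fun (Y i) z).
Proof.
move=> [trho dlin dmul] sf sY.
have sfY i : smooth_sec (fun p => f i p *: Y i p).
  apply/(smooth_secP hA hV) => p; apply: (sec_smooth_scale hA hV).
    by have /(smooth_funP hA) := sf i.
  by have /(smooth_secP hA hV) := sY i.
have s0 : smooth_sec (fun p : M => 0 : V p).
  by apply/(smooth_secP hA hV) => p; exact: (sec_smooth0 hA).
have d0 : delta (fun p => 0) = 0.
  have := dlin (-1) _ _ s0 s0; rewrite (_ : (fun p => -1 *: 0 + 0) = fun p : M => 0 : V p).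
    by rewrite mulN1r addNr.
  by apply/functional_extensionality_dep => p; rewrite scaler0 addr0.
elim: (index_enum I) => [|i s [sS IH]].
  rewrite big_nil (_ : (fun p => _) = fun p : M => 0 : V p)//.
  by apply/functional_extensionality_dep => p; rewrite big_nil.
rewrite big_cons -IH.
rewrite (_ : (fun p => _) = fun p => 1 *: (f i p *: Y i p) + \sum_(i <- s) f i p *: Y i p); last first.
  by apply/functional_extensionality_dep => p; rewrite big_cons scale1r.
split; last by rewrite dlin// dmul// mul1r.
apply/(smooth_secP hA hV) => p; apply: (sec_smooth_add hA hV).
  apply: (sec_smooth_scale hA hV); first exact: (smooth_at_cst hA).
  by have /(smooth_secP hA hV) := sfY i.
by have /(smooth_secP hA hV) := sS.
Qed.

(** The values on the coordinates [x i] and on the frame [e k] dictate the coefficients of [v] on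
    the partial derivatives. Expanding f in the coordinates and Y in the frame, compatibility gives
    the values on all other generators. *)
Lemma tangent_exists z rho delta : gen_compatible z rho delta -> exists v,
  [/\ tangent_vector z v, forall f, smooth_fun f -> v (basic_fun f) = rho f &
      forall Y, smooth_sec Y -> v (linear_fun Y) = delta Y].
Proof.
move=> gc; have [trho dlin dmul] := gc.
have [W [x [e [g Wz]]]] := generators_at (projT1 z); have [oW sx se mx le] := g.
pose a (j : 'I_(n + r)) : R := row_mx (\row_i rho (x i)) (\row_k delta (e k)) 0 j.
pose v (F : N -> R) : R := \sum_j a j * partial_gen W x e F j z.
have tv : tangent_vector z v.
  by apply: tangent_sum_comb => j; exact: (partial_tangent g).
have vcoord k : v (fun w => gen_coord x e w 0 k) = a k.
  rewrite /v (bigD1 k)//= (partial_coord g)// eqxx mulr1 big1 ?addr0// => j jk.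
  by rewrite (partial_coord g)// eq_sym (negbTE jk) mulr0.
have vx i : v (basic_fun (x i)) = rho (x i).
  rewrite (_ : basic_fun (x i) = fun w => gen_coord x e w 0 (lshift r i)); last first.
    by apply/funext => w; rewrite /gen_coord row_mxEl mxE.
  by rewrite vcoord /a row_mxEl mxE.
have ve i : v (linear_fun (e i)) = delta (e i).
  rewrite (_ : linear_fun (e i) = fun w => gen_coord x e w 0 (rshift n i)); last first.
    by apply/funext => w; rewrite /gen_coord row_mxEr mxE.
  by rewrite vcoord /a row_mxEr mxE.
have oX : open (base_chart W x @` W) by apply: (chart_imageW_open hA mx).
have vb f : smooth_fun f -> v (basic_fun f) = rho f.
  move=> sf; pose G := chart_rep (base_chart W x) f.
  have sG : smooth_in (base_chart W x @` W) G.
    move=> vs y [p Wp <-]; have /(smooth_funP hA)/(_ p) sfp := sf.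
    exact: (smooth_at_in sfp mx Wp).
  have Xp : (base_chart W x @` W) (\row_i x i (projT1 z)) by exists (projT1 z).
  rewrite (@tangent_comp _ _ _ hM (projT1 z) rho trho _ (fun p => \row_i x i p) _ G f W _ oX)//; first last.
  - by move=> q Wq; rewrite -[\row_i _]/(base_chart W x q) /G chart_repE.
  - by move=> j; rewrite (_ : (fun q => _) = x j)//; apply/funext => q; rewrite mxE.
  rewrite (@tangent_comp _ _ _ hN z v tv _ (fun w : N => \row_i x i (projT1 w)) _ G (basic_fun f)
      [set w | W (projT1 w)] _ oX)//; first last.
  - by move=> w Ww; rewrite -[\row_i _]/(base_chart W x (projT1 w)) /G chart_repE.
  - exact: basic_smooth.
  - exact: base_open.
  - move=> j; rewrite (_ : (fun q => _) = basic_fun (x j)); first exact: basic_smooth.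
    by apply/funext => q; rewrite mxE.
  apply: eq_bigr => j _; congr (_ * _).
  rewrite (_ : (fun w => _) = basic_fun (x j)); last by apply/funext => q; rewrite mxE.
  by rewrite vx; congr rho; apply/funext => q; rewrite mxE.
exists v; split=> // Y sY.
have [chi bchi] := manifold_bump hM oW Wz; have [schi [W1 [oW1 W1z chi1]] _] := bchi.
pose f i q : R := chi q * sec_coord e Y i q.
have sf i : smooth_fun (f i).
  apply: (smooth_cutoff hM oW bchi) => q Wq; have /(smooth_secP hA hV)/(_ q) sYq := sY.
  exact: (sec_smooth_coord i sYq le Wq).
have [sY' dY'] := compatible_sum gc sf se.
have oI : open (W1 `&` W) by exact: openI.
have YE q : (W1 `&` W) q -> Y q = \sum_i f i q *: e i q.
  move=> [W1q Wq]; have [_ be _] := le; rewrite {1}(bcoordE (Y q) (be q Wq)).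
  by apply: eq_bigr => i _; rewrite /f chi1// mul1r.
rewrite (compatible_local gc oI (conj W1z Wz) sY sY' YE) dY'.
rewrite (@tangent_local _ _ _ hN z v tv _ (linear_fun (fun p => \sum_i f i p *: e i p))
   [set w | (W1 `&` W) (projT1 w)])//; first last.
- by move=> w Ww; rewrite /linear_fun YE.
- exact: linear_smooth.
- exact: linear_smooth.
- exact: base_open.
rewrite (_ : linear_fun _ = fun w => \sum_i basic_fun (f i) w * linear_fun (e i) w); last first.
  by apply/funext => w; rewrite /linear_fun dual_sum; apply: eq_bigr => i _; rewrite dualZ.
have sbl i : smooth_fun (fun w => basic_fun (f i) w * linear_fun (e i) w).
  by apply: (smooth_fun_mul hN); [exact: basic_smooth|exact: linear_smooth].
rewrite (tangent_sum hN tv sbl); apply: eq_bigr => i _.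
rewrite (tangentM tv); [|exact: basic_smooth|exact: linear_smooth].
by rewrite vb// ve addrC.
Qed.

(** This allows a vector field to be defined by an arbitrary choice at each point: in a chart, its
    components are its values on generators. *)
Lemma tangent_family_smooth (v : N -> (N -> R) -> R) F : (forall z, tangent_vector z (v z)) ->
  (forall f, smooth_fun f -> smooth_fun (fun z => v z (basic_fun f))) ->
  (forall Y, smooth_sec Y -> smooth_fun (fun z => v z (linear_fun Y))) ->
  smooth_fun F -> smooth_fun (fun z => v z F).
Proof.
move=> tv sb sl sF; apply/(smooth_funP hTN) => z.
have [W [x [e [g Wz]]]] := generators_at (projT1 z); have [oW sx se mx le] := g.
apply: (@smooth_at_eq _ _ _ hTN (fun z => \sum_i partial_gen W x e F (lshift r i) z * v z (basic_fun (x i)) +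
        \sum_a partial_gen W x e F (rshift n a) z * v z (linear_fun (e a))) _ _ [set w | W (projT1 w)]) => //.
- exact: base_open.
- by move=> q Wq; rewrite (tangent_gen g (tv q) Wq sF).
apply: (smooth_at_add hTN); apply: (smooth_at_sum hTN) => i; apply: (smooth_at_mul hTN).
- exact: (partial_smooth g).
- by have /(smooth_funP hTN) := sb _ (sx i).
- exact: (partial_smooth g).
- by have /(smooth_funP hTN) := sl _ (se i).
Qed.

End Generators.

Lemma smooth_sec_scale (R : realType) (n r : nat) (M : charted R n) (E : vbundle M r)
    (hA : smooth_atlas M) (hE : vector_bundle E) (f : M -> R) (s : sec E) :
  smooth_fun f -> smooth_sec s -> smooth_sec (fun p => f p *: s p).
Proof.
move=> /(smooth_funP hA) sf /(smooth_secP hA hE) ss; apply/(smooth_secP hA hE) => p.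
exact: (sec_smooth_scale hA hE).
Qed.

Lemma smooth_sec_comb (R : realType) (n r : nat) (M : charted R n) (E : vbundle M r)
    (hA : smooth_atlas M) (hE : vector_bundle E) (k : R) (s t : sec E) :
  smooth_sec s -> smooth_sec t -> smooth_sec (fun p => k *: s p + t p).
Proof.
move=> /(smooth_secP hA hE) ss /(smooth_secP hA hE) st; apply/(smooth_secP hA hE) => p.
apply: (sec_smooth_add hA hE) => //; apply: (sec_smooth_scale hA hE) => //.
exact: (smooth_at_cst hA).
Qed.

(** * Biderivations, Poisson brackets and the fields that preserve them *)

Section Biderivation.
Context {R : realType} {n : nat} {N : charted R n}.
Hypothesis hN : smooth_manifold N.
Implicit Types (X : (N -> R) -> (N -> R)) (P : (N -> R) -> (N -> R) -> (N -> R)).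

Lemma fieldD X f g : vector_field X -> smooth_fun f -> smooth_fun g ->
  X (fun p => f p + g p) = fun z => X f z + X g z.
Proof. by move=> [_ tX] sf sg; apply/funext => z; rewrite (tangentD (tX z)). Qed.

Lemma fieldB X f g : vector_field X -> smooth_fun f -> smooth_fun g ->
  X (fun p => f p - g p) = fun z => X f z - X g z.
Proof. by move=> [_ tX] sf sg; apply/funext => z; rewrite (tangentB hN (tX z)). Qed.

Lemma field_comb X (k : R) f g : vector_field X -> smooth_fun f -> smooth_fun g ->
  X (fun p => k * f p + g p) = fun z => k * X f z + X g z.
Proof. by move=> [_ tX] sf sg; apply/funext => z; rewrite (tX z).1. Qed.

Lemma fieldM X f g : vector_field X -> smooth_fun f -> smooth_fun g ->
  X (fun p => f p * g p) = fun z => X f z * g z + f z * X g z.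
Proof. by move=> [_ tX] sf sg; apply/funext => z; rewrite (tangentM (tX z)). Qed.

Lemma field_cst X (a : R) : vector_field X -> X (fun=> a) = fun=> 0.
Proof. by move=> [_ tX]; apply/funext => z; rewrite (tangent_cst hN (tX z)). Qed.

Lemma tangent_opp z (v : (N -> R) -> R) : tangent_vector z v -> tangent_vector z (fun F => - v F).
Proof.
move=> tv; split=> [k f g sf sg|f g sf sg]; first by rewrite tv.1// opprD mulrN.
by rewrite tv.2// opprD mulNr mulrN.
Qed.

Lemma tangent_add z (v w : (N -> R) -> R) : tangent_vector z v -> tangent_vector z w ->
  tangent_vector z (fun F => v F + w F).
Proof.
move=> tv tw; split=> [k f g sf sg|f g sf sg]; rewrite ?(tv.1, tw.1)// ?(tv.2, tw.2)//; ring.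
Qed.

Lemma tangent_scale z (k : R) (v : (N -> R) -> R) : tangent_vector z v ->
  tangent_vector z (fun F => k * v F).
Proof. by move=> tv; split=> [l f g sf sg|f g sf sg]; rewrite ?tv.1 ?tv.2//; ring. Qed.

Lemma tangent0 z : tangent_vector z (fun _ : N -> R => 0).
Proof. by split=> *; rewrite ?mulr0 ?mul0r addr0. Qed.

Definition biderivation P := forall F, smooth_fun F -> vector_field (P F) /\ vector_field (P^~ F).

Definition preserves P X := forall F G, smooth_fun F -> smooth_fun G -> forall z,
  X (P F G) z = P (X F) G z + P F (X G) z.

(** Applied to a product, each composite of [X] with the bracket produces cross terms in which both
    factors are differentiated; they cancel, and a first-order operator remains. *)
Lemma defect_tangent P X F z : biderivation P -> vector_field X -> smooth_fun F ->
  tangent_vector z (fun G => X (P F G) z - P (X F) G z - P F (X G) z).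
Proof.
move=> bP vX sF; have [vF _] := bP _ sF; have sXF := vX.1 _ sF; have [vXF _] := bP _ sXF.
have sX G := vX.1 G; have sPF G := vF.1 G.
split=> [k f g sf sg|f g sf sg].
  rewrite !(field_comb k vF) ?(field_comb k vXF) ?(field_comb k vX)//; try by [exact: sX|exact: sPF].
  rewrite (field_comb k vF)//; [ring|exact: sX|exact: sX].
rewrite (fieldM vF)// (fieldM vXF)// (fieldM vX)//.
rewrite !(fieldD vX) ?(fieldD vF) ?(fieldM vX) ?(fieldM vF)//; try (apply: (smooth_fun_mul hN)) => //;
  try by [exact: sX|exact: sPF].
ring.
Qed.

Lemma defect_tangentl P X G z : biderivation P -> vector_field X -> smooth_fun G ->
  tangent_vector z (fun F => X (P F G) z - P (X F) G z - P F (X G) z).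
Proof.
move=> bP vX sG; pose Q F G := P G F.
have bQ : biderivation Q by move=> F sF; have [] := bP _ sF.
rewrite (_ : (fun F => _) = fun F => X (Q G F) z - Q (X G) F z - Q G (X F) z).
  exact: defect_tangent.
by apply/funext => F; rewrite addrAC.
Qed.

Definition poisson P :=
  [/\ forall F, smooth_fun F -> vector_field (P F),
      forall F G, smooth_fun F -> smooth_fun G -> forall z, P F G z = - P G F z
    & forall F G H, smooth_fun F -> smooth_fun G -> smooth_fun H -> forall z,
        P F (P G H) z + P G (P H F) z + P H (P F G) z = 0].

(* The defect of X = P F at (G, H) is the Jacobiator of (F, G, H), which is
   cyclically invariant. *)
Lemma preserves_jacobi P F G H z : (forall F, smooth_fun F -> vector_field (P F)) ->
  (forall F G, smooth_fun F -> smooth_fun G -> forall z, P F G z = - P G F z) ->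
  smooth_fun F -> smooth_fun G -> smooth_fun H ->
  P F (P G H) z - P (P F G) H z - P G (P F H) z =
  P F (P G H) z + P G (P H F) z + P H (P F G) z.
Proof.
move=> vP aP sF sG sH; rewrite (aP (P F G))//; last exact: (vP _ sF).1.
rewrite (_ : P F H = fun z => - P H F z); last by apply/funext => y; rewrite aP.
rewrite (tangentN hN ((vP _ sG).2 z)); last exact: (vP _ sH).1.
ring.
Qed.

End Biderivation.

(** * The linear Poisson bracket of a Lie algebroid *)

Section LieAlgebroid.
Context {R : realType} {n r : nat} {M : charted R n} {V : vbundle M r}.
Hypotheses (hM : smooth_manifold M) (hV : vector_bundle V).
Let hA := manifold_atlas hM.
Let hD := dual_vector_bundle hA hV.
Let hN := total_manifold hM hD.
Local Notation N := (total_space (dual_bundle V)).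

Definition lie_algebroid (br : sec V -> sec V -> sec V) (a : forall p, V p -> (M -> R) -> R) :=
  [/\ lie_bracket br, forall p (v : V p), tangent_vector p (a p v),
      forall p (k : R) (u v : V p) f, smooth_fun f -> a p (k *: u + v) f = k * a p u f + a p v f,
      forall Y f, smooth_sec Y -> smooth_fun f -> smooth_fun (fun p => a p (Y p) f)
    & forall Y Z f, smooth_sec Y -> smooth_sec Z -> smooth_fun f -> forall p,
        br Y (fun q => f q *: Z q) p = f p *: br Y Z p + a p (Y p) f *: Z p].

(** A derivation of the vector bundle [V] with symbol [rho]. Both D_X and [Y, .] are of this kind,
    and [covariant_lift] turns them into vector fields on V^*. *)
Definition covariant_operator (rho : (M -> R) -> M -> R) (D : sec V -> sec V) :=
  [/\ vector_field rho, forall Y, smooth_sec Y -> smooth_sec (D Y),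
      forall (k : R) Y Z, smooth_sec Y -> smooth_sec Z -> forall p,
        D (fun q => k *: Y q + Z q) p = k *: D Y p + D Z p
    & forall f Y, smooth_fun f -> smooth_sec Y -> forall p,
        D (fun q => f q *: Y q) p = f p *: D Y p + rho f p *: Y p].

Lemma covariant_compatible rho D z : covariant_operator rho D ->
  gen_compatible z (fun f => rho f (projT1 z)) (fun Y => linear_fun (D Y) z).
Proof.
move=> [vr sD lD mD]; split; first exact: vr.2.
  by move=> k Y Z sY sZ; rewrite /linear_fun lD// dualD dualZ.
by move=> f Y sf sY; rewrite /linear_fun mD// dualD !dualZ.
Qed.

Lemma covariant_lift rho D : covariant_operator rho D -> exists X : (N -> R) -> (N -> R),
  [/\ vector_field X, forall f, smooth_fun f -> X (basic_fun f) = basic_fun (rho f)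
    & forall Y, smooth_sec Y -> X (linear_fun Y) = linear_fun (D Y)].
Proof.
move=> cD; have [vr sD _ _] := cD.
have /choice[v vP] z := tangent_exists hM hV (covariant_compatible z cD).
exists (fun F z => v z F).
have Eb f : smooth_fun f -> (fun z => v z (basic_fun f)) = basic_fun (rho f).
  by move=> sf; apply/funext => z; have [_ -> //] := vP z.
have El Y : smooth_sec Y -> (fun z => v z (linear_fun Y)) = linear_fun (D Y).
  by move=> sY; apply/funext => z; have [_ _ ->] := vP z.
split=> //; split=> [F sF|z]; last by have [] := vP z.
apply: (tangent_family_smooth hM hV) => //.
- by move=> z; have [] := vP z.
- by move=> f sf; rewrite Eb//; apply: (basic_smooth hM hV); exact: vr.1.
- by move=> Y sY; rewrite El//; apply: (linear_smooth hM hV); exact: sD.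
Qed.

Variables (br : sec V -> sec V -> sec V) (a : forall p, V p -> (M -> R) -> R).
Hypothesis hbr : lie_algebroid br a.

Definition anchor_field (Y : sec V) : (M -> R) -> (M -> R) := fun f p => a (Y p) f.

Lemma anchor0 p f : smooth_fun f -> a (0 : V p) f = 0.
Proof.
have [_ _ la _ _] := hbr => sf.
by have := la p (-1) 0 0 f sf; rewrite scaler0 addr0 mulN1r addNr.
Qed.

Lemma anchorZ p (k : R) (v : V p) f : smooth_fun f -> a (k *: v) f = k * a v f.
Proof. by have [_ _ la _ _] := hbr => sf; rewrite -[k *: v]addr0 la// anchor0// addr0. Qed.

Lemma anchor_field_vector Y : smooth_sec Y -> vector_field (anchor_field Y).
Proof.
have [_ ta _ sa _] := hbr => sY; split=> [f sf|p]; first exact: sa.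
exact: ta.
Qed.

Lemma bracketZl f Y Z p : smooth_fun f -> smooth_sec Y -> smooth_sec Z ->
  br (fun q => f q *: Y q) Z p = f p *: br Y Z p - a (Z p) f *: Y p.
Proof.
have [[_ _ aB _] _ _ _ mB] := hbr => sf sY sZ.
rewrite aB//; last exact: (smooth_sec_scale hA hV).
by rewrite mB// (aB Z Y)// scalerN opprD opprK.
Qed.

Lemma bracket_covariant Y : smooth_sec Y -> covariant_operator (anchor_field Y) (br Y).
Proof.
have [[sB lB aB _] ta la sa mB] := hbr => sY; split.
- exact: anchor_field_vector.
- by move=> Z sZ; exact: sB.
- move=> k Z W sZ sW p; have sZW := smooth_sec_comb hA hV k sZ sW.
  by rewrite aB// lB// opprD -scalerN -!aB.
- by move=> f Z sf sZ p; rewrite mB.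
Qed.

Definition algebroid_derivation rho D := covariant_operator rho D /\
  forall Y Z, smooth_sec Y -> smooth_sec Z -> forall p,
    D (br Y Z) p = br (D Y) Z p + br Y (D Z) p.

Lemma bracket_derivation Y : smooth_sec Y -> algebroid_derivation (anchor_field Y) (br Y).
Proof.
have [[sB lB aB jB] ta la sa mB] := hbr => sY; split; first exact: bracket_covariant.
move=> Z W sZ sW p.
have sZW := sB _ _ sZ sW; have sYZ := sB _ _ sY sZ; have sYW := sB _ _ sY sW.
have := jB _ _ _ sY sZ sW p; rewrite (aB W (br Y Z))//.
rewrite (_ : br W Y = fun q => (-1) *: br Y W q + (0 : V q)); last first.
  by apply/functional_extensionality_dep => q; rewrite aB// scaleN1r addr0.
have s0 : smooth_sec (fun q : M => 0 : V q).
  by apply/(smooth_secP hA hV) => q; exact: (sec_smooth0 hA).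
have [_ _ lZ _] := bracket_covariant sZ.
have b0 : br Z (fun q : M => 0 : V q) p = 0.
  have := lZ (-1) _ _ s0 s0 p.
  rewrite (_ : (fun q => _) = fun q : M => 0 : V q); first by rewrite scaleN1r addNr.
  by apply/functional_extensionality_dep => q; rewrite scaler0 addr0.
rewrite lZ// b0 addr0 scaleN1r => /eqP; rewrite -addrA -opprD subr_eq0 => /eqP ->.
by rewrite addrC.
Qed.

(* Comparing the two sides of D[Y, fZ] = [DY, fZ] + [Y, D(fZ)]. *)
Lemma derivation_anchor rho D Y f p : algebroid_derivation rho D -> smooth_sec Y -> smooth_fun f ->
  rho (anchor_field Y f) p = a (D Y p) f + a (Y p) (rho f).
Proof.
have [[sB lB aB jB] ta la sa mB] := hbr => -[[vr sD lD mD] dD] sY sf.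
have a0 := anchor0.
have [U [e [le Up]]] := frame_at hV p; have [oU be _] := le.
(* In rank 0 there is no nonzero section whose coefficients could be compared, but both sides are
   then 0. *)
case: (pickP (fun i : 'I_r => true)) => [i _|r0]; last first.
  have V0 q (v : V q) : v = 0.
    have [U' [e' [[_ be' _] Uq]]] := frame_at hV q.
    by rewrite (bcoordE v (be' _ Uq)) big1// => i; have := r0 i.
  rewrite (V0 _ (D Y p)) (V0 _ (Y p)) !a0//; last exact: vr.1.
  rewrite (_ : anchor_field Y f = fun=> 0) ?(field_cst hM _ vr) ?addr0//.
  by apply/funext => q; rewrite /anchor_field (V0 _ (Y q)) a0.
(* [Z] extends a frame section globally, and the dual covector [phi i] reads off the coefficient of
   Z p. *)
have [Z [sZ [W [oW Wp ZE]]]] := sec_extend hM hV oU Up (fun q Uq => local_frame_smooth hA hV i le Uq).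
have [phi phiE] := dual_basis_exists (be _ Up).
have phiZ : phi i (Z p) = 1 by rewrite ZE// phiE eqxx.
have sfZ := smooth_sec_scale hA hV sf sZ.
have := dD _ _ sY sfZ p.
rewrite (_ : br Y (fun q => f q *: Z q) = fun q => 1 *: (f q *: br Y Z q) + a (Y q) f *: Z q); last first.
  by apply/functional_extensionality_dep => q; rewrite mB// scale1r.
rewrite (_ : D (fun q => f q *: Z q) = fun q => 1 *: (f q *: D Z q) + rho f q *: Z q); last first.
  by apply/functional_extensionality_dep => q; rewrite mD// scale1r.
have srf := vr.1 _ sf; have saf := sa _ _ sY sf; have sDZ := sD _ sZ; have sYZ := sB _ _ sY sZ.
have [_ _ lY _] := bracket_covariant sY.
have s1 := smooth_sec_scale hA hV sf sYZ; have s2 := smooth_sec_scale hA hV saf sZ.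
have s3 := smooth_sec_scale hA hV sf sDZ; have s4 := smooth_sec_scale hA hV srf sZ.
rewrite lD// lY// !scale1r !mD// !mB//; last exact: sD.
rewrite dD// => /(congr1 (phi i)); rewrite !(dualD, dualZ) phiZ /anchor_field.
set u1 := phi i _; set u2 := phi i _; set u3 := phi i _; set u4 := phi i _ => E.
by lra.
Qed.

Lemma biderivation_eq (b b' : (N -> R) -> (N -> R) -> R) (z : N) :
  (forall F, smooth_fun F -> tangent_vector z (b F) /\ tangent_vector z (b^~ F)) ->
  (forall F, smooth_fun F -> tangent_vector z (b' F) /\ tangent_vector z (b'^~ F)) ->
  (forall f g, smooth_fun f -> smooth_fun g ->
     b (basic_fun f) (basic_fun g) = b' (basic_fun f) (basic_fun g)) ->
  (forall f Y, smooth_fun f -> smooth_sec Y ->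
     b (basic_fun f) (linear_fun Y) = b' (basic_fun f) (linear_fun Y)) ->
  (forall f Y, smooth_fun f -> smooth_sec Y ->
     b (linear_fun Y) (basic_fun f) = b' (linear_fun Y) (basic_fun f)) ->
  (forall Y Z, smooth_sec Y -> smooth_sec Z ->
     b (linear_fun Y) (linear_fun Z) = b' (linear_fun Y) (linear_fun Z)) ->
  forall F G, smooth_fun F -> smooth_fun G -> b F G = b' F G.
Proof.
move=> tb tb' E1 E2 E3 E4 F G sF sG.
have tF H sH := (tb H sH).1; have tF' H sH := (tb' H sH).1.
have tG H sH := (tb H sH).2; have tG' H sH := (tb' H sH).2.
apply: (tangent_eq hM hV (tF _ sF) (tF' _ sF)) => // [f sf|Y sY].
  have sb := basic_smooth hM hV sf.
  apply: (tangent_eq hM hV (tG _ sb) (tG' _ sb)) => // [g sg|Z sZ]; [exact: E1|exact: E3].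
have sl := linear_smooth hM hV sY.
apply: (tangent_eq hM hV (tG _ sl) (tG' _ sl)) => // [g sg|Z sZ]; [exact: E2|exact: E4].
Qed.

Definition linear_bracket (P : (N -> R) -> (N -> R) -> (N -> R)) :=
  [/\ forall f g, smooth_fun f -> smooth_fun g -> P (basic_fun f) (basic_fun g) = fun=> 0,
      forall f Y, smooth_fun f -> smooth_sec Y ->
        P (basic_fun f) (linear_fun Y) = basic_fun (fun p => - anchor_field Y f p),
      forall f Y, smooth_fun f -> smooth_sec Y ->
        P (linear_fun Y) (basic_fun f) = basic_fun (anchor_field Y f)
    & forall Y Z, smooth_sec Y -> smooth_sec Z ->
        P (linear_fun Y) (linear_fun Z) = linear_fun (br Y Z)].

(* In the proof, v (f, z) is {., f o pi} at z and T Y is {l_Y, .}; by antisymmetry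
   they prescribe {F, .} on the generators. *)
Lemma linear_bracket_exists : exists2 P : (N -> R) -> (N -> R) -> (N -> R),
  biderivation P & linear_bracket P.
Proof.
have [[sB lB aB jB] ta la sa mB] := hbr.
have /choice[v vP] (fz : (M -> R) * N) : exists v : (N -> R) -> R, smooth_fun fz.1 ->
    [/\ tangent_vector fz.2 v, forall g, smooth_fun g -> v (basic_fun g) = 0 &
        forall Y, smooth_sec Y -> v (linear_fun Y) = basic_fun (anchor_field Y fz.1) fz.2].
  case: fz => f z /=; have [sf|nf] := pselect (smooth_fun f); last by exists (fun=> 0).
  have [|v [tv v0 v1]] := @tangent_exists _ _ _ _ _ hM hV z (fun=> 0)
      (fun Y => basic_fun (anchor_field Y f) z); last by exists v.
  split; first exact: tangent0.
    by move=> k Y Y' sY sY'; rewrite /basic_fun /anchor_field la.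
  move=> g Y sg sY; rewrite /basic_fun /anchor_field mul0r addr0.
  by rewrite anchorZ.
have /choice[T TP] (Y : sec V) : exists X : (N -> R) -> (N -> R), smooth_sec Y ->
    [/\ vector_field X, forall f, smooth_fun f -> X (basic_fun f) = basic_fun (anchor_field Y f)
    & forall Z, smooth_sec Z -> X (linear_fun Z) = linear_fun (br Y Z)].
  have [sY|nY] := pselect (smooth_sec Y); last by exists (fun _ _ => 0).
  by have [X ?] := covariant_lift (bracket_covariant sY); exists X.
have sv f F : smooth_fun f -> smooth_fun F -> smooth_fun (fun z => v (f, z) F).
  move=> sf sF; apply: (@tangent_family_smooth _ _ _ _ _ hM hV (fun z => v (f, z))) => //.
  - by move=> z; have [] := vP (f, z) sf.
  - move=> g sg; rewrite (_ : (fun z => _) = fun=> 0); first exact: (smooth_fun_cst hN).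
    by apply/funext => z; have [_ -> //] := vP (f, z) sf.
  - move=> Y sY; rewrite (_ : (fun z => _) = basic_fun (anchor_field Y f)).
      by apply: (basic_smooth hM hV); exact: sa.
    by apply/funext => z; have [_ _ ->] := vP (f, z) sf.
(* The values prescribed for {F, f o pi} and {F, l_Y} are themselves tangent vectors applied to [F].
   Their compatibility is an identity between tangent vectors, checked on generators. *)
have compat F z : smooth_fun F -> gen_compatible z (fun f => v (f, z) F) (fun Y => - T Y F z).
  move=> sF; split.
  - split=> [k f g sf sg|f g sf sg].
      have skfg : smooth_fun (fun p => k * f p + g p).
        apply: (smooth_fun_add hM) => //; apply: (smooth_fun_mul hM) => //.
        exact: (smooth_fun_cst hM).
      have [t1 b1 l1] := vP (_, z) skfg; have [t2 b2 l2] := vP (_, z) sf.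
      have [t3 b3 l3] := vP (_, z) sg.
      apply: (tangent_eq hM hV t1 (tangent_add (tangent_scale k t2) t3)) => //.
        by move=> h sh; rewrite b1// b2// b3// mulr0 addr0.
      move=> Y sY; rewrite l1// l2// l3// /basic_fun /anchor_field.
      by rewrite (ta _ _).1.
    have sfg := smooth_fun_mul hM sf sg.
    have [t1 b1 l1] := vP (_, z) sfg; have [t2 b2 l2] := vP (_, z) sf.
    have [t3 b3 l3] := vP (_, z) sg.
    rewrite mulrC.
    apply: (tangent_eq hM hV t1 (tangent_add (tangent_scale _ t2) (tangent_scale _ t3))) => //.
      by move=> h sh; rewrite b1// b2// b3// !mulr0 addr0.
    move=> Y sY; rewrite l1// l2// l3// /basic_fun /anchor_field.
    by rewrite (ta _ _).2//= mulrC.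
  - move=> k Y Y' sY sY'; have sYY := smooth_sec_comb hA hV k sY sY'.
    have [t1 b1 l1] := TP _ sYY; have [t2 b2 l2] := TP _ sY; have [t3 b3 l3] := TP _ sY'.
    suff -> : T (fun p => k *: Y p + Y' p) F z = k * T Y F z + T Y' F z by ring.
    apply: (tangent_eq hM hV (t1.2 z) (tangent_add (tangent_scale k (t2.2 z)) (t3.2 z))) => //.
      by move=> g sg; rewrite b1// b2// b3// /basic_fun /anchor_field la.
    by move=> Z sZ; rewrite l1// l2// l3// /linear_fun lB// dualD dualZ.
  - move=> f Y sf sY; have sfY := smooth_sec_scale hA hV sf sY.
    have [t1 b1 l1] := TP _ sfY; have [t2 b2 l2] := TP _ sY; have [t3 b3 l3] := vP (f, z) sf.
    suff -> : T (fun p => f p *: Y p) F z =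
      f (projT1 z) * T Y F z + (- linear_fun Y z) * v (f, z) F by ring.
    apply: (tangent_eq hM hV (t1.2 z) (tangent_add (tangent_scale _ (t2.2 z)) (tangent_scale _ t3))) => //.
      by move=> g sg; rewrite b1// b2// b3// mulr0 addr0 /basic_fun /anchor_field anchorZ.
    move=> Z sZ; rewrite l1// l2// l3// /linear_fun bracketZl// dualD dualN !dualZ.
    by rewrite mulNr mulrC (mulrC (a _ _)) mulrC.
have /choice[w wP] (Fz : (N -> R) * N) : exists u : (N -> R) -> R, smooth_fun Fz.1 ->
    [/\ tangent_vector Fz.2 u, forall g, smooth_fun g -> u (basic_fun g) = v (g, Fz.2) Fz.1 &
        forall Y, smooth_sec Y -> u (linear_fun Y) = - T Y Fz.1 Fz.2].
  case: Fz => F z /=; have [sF|nF] := pselect (smooth_fun F); last by exists (fun=> 0).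
  by have [u ?] := tangent_exists hM hV (compat F z sF); exists u.
(* By construction [w] is a derivation in the second argument. That it is one in the first argument
   is again checked on generators of the second. *)
have wl z (k : R) F G : smooth_fun F -> smooth_fun G -> forall H, smooth_fun H ->
    w (fun q => k * F q + G q, z) H = k * w (F, z) H + w (G, z) H.
  move=> sF sG; have sFG : smooth_fun (fun q => k * F q + G q).
    apply: (smooth_fun_add hN) => //; apply: (smooth_fun_mul hN) => //.
    exact: (smooth_fun_cst hN).
  have [t1 b1 l1] := wP (_, z) sFG; have [t2 b2 l2] := wP (_, z) sF.
  have [t3 b3 l3] := wP (_, z) sG.
  apply: (tangent_eq hM hV t1 (tangent_add (tangent_scale k t2) t3)) => [f sf|Y sY].
    by have [tv _ _] := vP (f, z) sf; rewrite b1// b2// b3// tv.1.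
  have [tT _ _] := TP _ sY; rewrite l1// l2// l3//= (tT.2 z).1//; ring.
have wm z F G : smooth_fun F -> smooth_fun G -> forall H, smooth_fun H ->
    w (fun q => F q * G q, z) H = G z * w (F, z) H + F z * w (G, z) H.
  move=> sF sG; have sFG : smooth_fun (fun q => F q * G q) by apply: (smooth_fun_mul hN).
  have [t1 b1 l1] := wP (_, z) sFG; have [t2 b2 l2] := wP (_, z) sF.
  have [t3 b3 l3] := wP (_, z) sG.
  apply: (tangent_eq hM hV t1 (tangent_add (tangent_scale _ t2) (tangent_scale _ t3))) => [f sf|Y sY].
    by have [tv _ _] := vP (f, z) sf; rewrite b1// b2// b3//= tv.2// mulrC.
  have [tT _ _] := TP _ sY; rewrite l1// l2// l3//= (tT.2 z).2//; ring.
have ws F G : smooth_fun F -> smooth_fun G -> smooth_fun (fun z => w (F, z) G).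
  move=> sF sG.
  apply: (@tangent_family_smooth _ _ _ _ _ hM hV (fun z => w (F, z))) => //.
  - by move=> z; have [] := wP (F, z) sF.
  - move=> g sg; rewrite (_ : (fun z => _) = fun z => v (g, z) F); first exact: sv.
    by apply/funext => z; have [_ -> //] := wP (F, z) sF.
  - move=> Y sY; rewrite (_ : (fun z => _) = fun z => - T Y F z).
      by apply: (smooth_fun_opp hN); have [vT _ _] := TP _ sY; exact: vT.1.
    by apply/funext => z; have [_ _ ->] := wP (F, z) sF.
exists (fun F G z => w (F, z) G).
  move=> F sF; split; split=> [G sG|z]; [exact: ws| |exact: ws|].
    by have [] := wP (F, z) sF.
  split=> [k G H sG sH|G H sG sH]; first by rewrite wl.
  by rewrite wm// mulrC.
split.
- move=> f g sf sg; apply/funext => z; have sb := basic_smooth hM hV sf.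
  have [_ -> // _] := wP (_, z) sb; by have [_ ->] := vP (g, z) sg.
- move=> f Y sf sY; apply/funext => z; have sb := basic_smooth hM hV sf.
  have [_ _ ->//] := wP (_, z) sb; by have [_ -> //] := TP _ sY.
- move=> f Y sf sY; apply/funext => z; have sb := linear_smooth hM hV sY.
  have [_ ->// _] := wP (_, z) sb; by have [_ _ ->] := vP (f, z) sf.
move=> Y Z sY sZ; apply/funext => z; have sl := linear_smooth hM hV sY.
have [_ _ ->//] := wP (_, z) sl; have [_ _ ->//] := TP _ sZ.
by rewrite /linear_fun aB// dualN opprK.
Qed.

(** The defect is a derivation in each argument, so generators suffice. Mixed pairs reduce to
    [derivation_anchor], and pairs of linear functions to the rule for D [Y, Z]. *)
Lemma covariant_preserves P X rho D : biderivation P -> linear_bracket P ->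
  algebroid_derivation rho D -> vector_field X ->
  (forall f, smooth_fun f -> X (basic_fun f) = basic_fun (rho f)) ->
  (forall Y, smooth_sec Y -> X (linear_fun Y) = linear_fun (D Y)) -> preserves P X.
Proof.
move=> bP [P1 P2 P3 P4] dD vX Xb Xl; have [[vr sD lD mD] der] := dD.
have [[sB _ _ _] _ _ sa _] := hbr.
have sb f : smooth_fun f -> smooth_fun (@basic_fun R n r M V f) by exact: (basic_smooth hM hV).
have sl Y : smooth_sec Y -> smooth_fun (@linear_fun R n r M V Y) by exact: (linear_smooth hM hV).
move=> F G sF sG z; apply/eqP; rewrite -subr_eq0 opprD addrA; apply/eqP.
apply: (@biderivation_eq (fun F G => X (P F G) z - P (X F) G z - P F (X G) z) (fun _ _ => 0) z) => //.
- move=> H sH; split; [exact: (defect_tangent hN)|exact: (defect_tangentl hN)].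
- by move=> H sH; split; exact: tangent0.
- move=> f g sf sg; rewrite P1// !Xb// !P1//; [|exact: vr.1|exact: vr.1].
  by rewrite (field_cst hN)// !subr0.
- move=> f Y sf sY; have sr := vr.1 _ sf; have sDY := sD _ sY; have sY' := sa _ _ sY sf.
  rewrite P2// (Xb _ sf) (Xl _ sY) !P2// Xb; last exact: (smooth_fun_opp hM).
  have sY'' : smooth_fun (anchor_field Y f) by [].
  rewrite /basic_fun (tangentN hM (vr.2 _) sY'').
  rewrite (derivation_anchor _ dD)//; rewrite /anchor_field; ring.
- move=> f Y sf sY; have sr := vr.1 _ sf; have sDY := sD _ sY; have sY' := sa _ _ sY sf.
  rewrite P3// (Xb _ sf) (Xl _ sY) !P3// (Xb _ sY').
  by rewrite /basic_fun (derivation_anchor _ dD)// /anchor_field; ring.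
- move=> Y Z sY sZ; have sDY := sD _ sY; have sDZ := sD _ sZ.
  rewrite P4// !Xl// ?P4//; last exact: sB.
  by rewrite /linear_fun der// dualD; ring.
Qed.

Lemma linear_bracket_antisymmetric P F G z : biderivation P -> linear_bracket P ->
  smooth_fun F -> smooth_fun G -> P F G z = - P G F z.
Proof.
move=> bP [P1 P2 P3 P4]; have [[_ _ aB _] _ _ _ _] := hbr; move: F G.
apply: (@biderivation_eq (fun F G => P F G z) (fun F G => - P G F z) z).
- by move=> F sF; have [[_ t1] [_ t2]] := bP _ sF; split; [exact: t1|exact: t2].
- by move=> F sF; have [[_ t1] [_ t2]] := bP _ sF; split; apply: tangent_opp; [exact: t2|exact: t1].
- by move=> f g sf sg; rewrite !P1// oppr0.
- by move=> f Y sf sY; rewrite P2// P3.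
- by move=> f Y sf sY; rewrite P2// P3// /basic_fun opprK.
- by move=> Y Z sY sZ; rewrite !P4// /linear_fun aB// dualN.
Qed.

(** When one argument is l_Y, the Jacobi identity says that the field of l_Y, which lifts the
    derivation [Y, .], preserves the bracket; cyclic invariance puts l_Y first. Among three basic
    functions all brackets vanish. *)
Lemma linear_poisson_exists : exists P : (N -> R) -> (N -> R) -> (N -> R),
  [/\ biderivation P, poisson P & linear_bracket P].
Proof.
have [P bP lP] := linear_bracket_exists; exists P; split=> //.
have aP F G : smooth_fun F -> smooth_fun G -> forall z, P F G z = - P G F z.
  by move=> sF sG z; exact: linear_bracket_antisymmetric.
have vP F : smooth_fun F -> vector_field (P F) by move=> /bP[].
have [P1 P2 P3 P4] := lP.
have sb f : smooth_fun f -> smooth_fun (@basic_fun R n r M V f) by exact: (basic_smooth hM hV).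
have sl Y : smooth_sec Y -> smooth_fun (@linear_fun R n r M V Y) by exact: (linear_smooth hM hV).
pose J F G H z := P F (P G H) z + P G (P H F) z + P H (P F G) z.
have JC F G H z : J F G H z = J G H F z by rewrite /J; ring.
have Jpres F : smooth_fun F -> preserves P (P F) -> forall G H, smooth_fun G -> smooth_fun H ->
    forall z, J F G H z = 0.
  move=> sF pF G H sG sH z; rewrite /J -(preserves_jacobi hN z vP aP sF sG sH) pF//.
  by ring.
have Jl Y : smooth_sec Y -> forall G H, smooth_fun G -> smooth_fun H ->
    forall z, J (linear_fun Y) G H z = 0.
  move=> sY; apply: Jpres; first exact: sl.
  apply: (covariant_preserves bP lP (bracket_derivation sY)); first exact: (vP _ (sl _ sY)).
    by move=> f sf; rewrite P3.
  by move=> Z sZ; rewrite P4.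
have Jeq F : smooth_fun F -> (forall f g, smooth_fun f -> smooth_fun g -> forall z,
    J F (basic_fun f) (basic_fun g) z = 0) -> forall G H, smooth_fun G -> smooth_fun H ->
    forall z, J F G H z = 0.
  move=> sF Jb G H sG sH z.
  rewrite /J -(preserves_jacobi hN z vP aP sF sG sH).
  apply: (@biderivation_eq (fun G H => P F (P G H) z - P (P F G) H z - P G (P F H) z) (fun _ _ => 0) z) => //.
  - move=> K sK; split; [exact: (defect_tangent hN z bP (vP _ sF) sK)|exact: (defect_tangentl hN z bP (vP _ sF) sK)].
  - by move=> K sK; split; exact: tangent0.
  - move=> f g sf sg; rewrite (preserves_jacobi hN z vP aP sF (sb _ sf) (sb _ sg)).
    exact: Jb.
  - move=> f Y sf sY; rewrite (preserves_jacobi hN z vP aP sF (sb _ sf) (sl _ sY)).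
    rewrite -/(J _ _ _ _) -JC; apply: Jl => //; exact: sb.
  - move=> f Y sf sY; rewrite (preserves_jacobi hN z vP aP sF (sl _ sY) (sb _ sf)).
    rewrite -/(J _ _ _ _) JC; apply: Jl => //; exact: sb.
  - move=> Y Z sY sZ; rewrite (preserves_jacobi hN z vP aP sF (sl _ sY) (sl _ sZ)).
    rewrite -/(J _ _ _ _) JC; apply: Jl => //; exact: sl.
(* [Jeq] is used twice: it makes the last two arguments basic and then, after a rotation that moves
   [F] to the end, it replaces [F] by a basic function too. *)
split=> // F G H sF sG sH; apply: (Jeq) => // f g sf sg z.
rewrite JC.
apply: Jeq => //; [exact: sb| |exact: sb].
move=> h k sh sk y; rewrite /J !P1// !(field_cst hN) ?addr0//; apply: vP; exact: sb.
Qed.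

End LieAlgebroid.

(** * The aff-Poisson structure *)

Section AffinePoisson.
Context {R : realType} {m n : nat} {Z : charted R m} {N : charted R n}.
Variables (tau : Z -> N) (shift : Z -> R -> Z) (H : (N -> Z) -> (N -> R)).
Variables (P : (N -> R) -> (N -> R) -> (N -> R)) (X : (N -> R) -> (N -> R)).
Hypotheses (hN : smooth_manifold N) (hP : poisson P) (vX : vector_field X).
Hypothesis pX : preserves P X.
Hypothesis sH : forall h, av_section tau h -> smooth_fun (H h).
Hypothesis H_shift : forall h f, av_section tau h -> smooth_fun f ->
  H (sec_shift shift h f) = fun q => H h q - f q.

(* Minus the linear Poisson bracket on A^+ of y_0 + H h and y_0 + H h', with
   {y_0, .} = X. *)
Definition hamiltonian_bracket (h h' : N -> Z) : N -> R :=
  fun q => X (fun p => H h p - H h' p) q - P (H h) (H h') q.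

Let vP F : smooth_fun F -> vector_field (P F).
Proof. by have [+ _ _] := hP; exact. Qed.

Let aP F G : smooth_fun F -> smooth_fun G -> forall z, P F G z = - P G F z.
Proof. by have [_ + _] := hP; exact. Qed.

Lemma hamiltonian_bracket_smooth h h' : av_section tau h -> av_section tau h' ->
  smooth_fun (hamiltonian_bracket h h').
Proof.
move=> /sH ah /sH ah'; apply: (smooth_fun_sub hN).
  by apply: vX.1; exact: (smooth_fun_sub hN).
exact: (vP ah).1.
Qed.

Lemma hamiltonian_bracket_linear_part h f q : av_section tau h -> smooth_fun f ->
  affine_linear_part shift hamiltonian_bracket h f q = X f q + P (H h) f q.
Proof.
move=> ah sf; have s := sH ah; have ss := smooth_fun_sub hN s sf.
rewrite /affine_linear_part /hamiltonian_bracket H_shift//.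
rewrite !(fieldB hN vX)// (fieldB hN (vP s))//; ring.
Qed.

Lemma hamiltonian_bracket_poisson : aff_poisson tau shift hamiltonian_bracket.
Proof.
have B2 h f q := @hamiltonian_bracket_linear_part h f q.
have scomb (k : R) f g : smooth_fun f -> smooth_fun g ->
    smooth_fun (fun p => k * f p + g p) (N := N).
  move=> sf sg; apply: (smooth_fun_add hN) => //; apply: (smooth_fun_mul hN) => //.
  exact: (smooth_fun_cst hN).
have [_ _ jP] := hP.
split.
- exact: hamiltonian_bracket_smooth.
- move=> h ah; have s := sH ah; split.
    exists (fun f q => X f q + P (H h) f q) => [k f g sf sg q|h' f ah' sf q].
      by rewrite (field_comb k vX)// (field_comb k (vP s))//; ring.
    have s' := sH ah'; have ss := smooth_fun_sub hN s' sf.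
    rewrite /hamiltonian_bracket H_shift// !(fieldB hN vX)// (fieldB hN (vP s))//; ring.
  exists (fun f q => - X f q - P (H h) f q) => [k f g sf sg q|h' f ah' sf q].
    by rewrite (field_comb k vX)// (field_comb k (vP s))//; ring.
  have s' := sH ah'; have ss := smooth_fun_sub hN s' sf.
  rewrite /hamiltonian_bracket H_shift// !(fieldB hN vX)// !(aP _ s)// (fieldB hN (vP s))//; ring.
- move=> h1 h2 /sH s1 /sH s2 q.
  by rewrite /hamiltonian_bracket !(fieldB hN vX)// (aP s2)//; ring.
- move=> h1 h2 h3 a1 a2 a3 q; rewrite !B2//; try exact: hamiltonian_bracket_smooth.
  rewrite /hamiltonian_bracket; move: (sH a1) (sH a2) (sH a3).
  move: (H h1) (H h2) (H h3) => F G K sF sG sK.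
  have sX F' : smooth_fun F' -> smooth_fun (X F') by exact: vX.1.
  have sP F' G' : smooth_fun F' -> smooth_fun G' -> smooth_fun (P F' G').
    by move=> sF'; exact: (vP sF').1.
  (* One cyclic term, expanded with [pX]. In the cyclic sum the mixed terms cancel in pairs once
     antisymmetry has moved every X F' to the second slot. *)
  have E F' G' K' : smooth_fun F' -> smooth_fun G' -> smooth_fun K' ->
      X (fun q => X (fun p => G' p - K' p) q - P G' K' q) q +
      P F' (fun q => X (fun p => G' p - K' p) q - P G' K' q) q =
      X (X G') q - X (X K') q - P (X G') K' q - P G' (X K') q +
      P F' (X G') q - P F' (X K') q - P F' (P G' K') q.
    move=> sF' sG' sK'; have sB := smooth_fun_sub hN sG' sK'.
    have sXB := sX _ sB; have sPG := sP _ _ sG' sK'; have [sXG sXK] := (sX _ sG', sX _ sK').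
    rewrite (fieldB hN vX sXB sPG) (fieldB hN (vP sF') sXB sPG) (fieldB hN vX sG' sK').
    by rewrite (fieldB hN vX sXG sXK) (fieldB hN (vP sF') sXG sXK) pX//; ring.
  rewrite !E//; have J := jP _ _ _ sF sG sK q.
  rewrite (aP (sX _ sG) sK) (aP (sX _ sK) sF) (aP (sX _ sF) sG).
  by rewrite -[RHS]oppr0 -[in RHS]J; ring.
- move=> h ah; have s := sH ah; split=> [f sf|z].
    rewrite (_ : affine_linear_part _ _ _ _ = fun q => X f q + P (H h) f q).
      by apply: (smooth_fun_add hN); [exact: vX.1|exact: (vP s).1].
    by apply/funext => q; rewrite B2.
  have [_ t1] := vX; have [_ t2] := vP s.
  have [t3 t4] := tangent_add (t1 z) (t2 z).
  split=> [k f g sf sg|f g sf sg].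
    by rewrite !B2//; [exact: t3|exact: scomb].
  by rewrite !B2//; [exact: t4|exact: (smooth_fun_mul hN)].
Qed.

End AffinePoisson.

(** * Frames of the bidual adapted to 1_A *)

Section BidualFrames.
Context {R : realType} {n r : nat} {M : charted R n} {V : vbundle M r} {A : abundle V}.
Hypotheses (hA : smooth_atlas M) (hV : vector_bundle V) (hB : affine_bundle A).
Let hP := aff_dual_vector_bundle hA hV hB.
Let hQ := dual_vector_bundle hA hP.

Definition bidual_frame (X : asec A) (e : 'I_r -> sec V) (a : 'I_r.+1) : sec (bidual A) :=
  fun p => if unlift ord0 a is Some i then incl_vector (A p) (e i p) else incl_point (X p).

Lemma bidual_frame0 X e p : bidual_frame X e ord0 p = incl_point (X p).
Proof. by rewrite /bidual_frame unlift_none. Qed.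

Lemma bidual_frameS X e i p : bidual_frame X e (lift ord0 i) p = incl_vector (A p) (e i p).
Proof. by rewrite /bidual_frame liftK. Qed.

Lemma bidual_frame_dual U X e phi : affine_frame U X e phi -> dual_frame U phi (bidual_frame X e).
Proof.
move=> aphi p Up a b; have [phi0 phiS] := aphi p Up.
case: (unliftP ord0 a) => [i|] ->; case: (unliftP ord0 b) => [j|] ->.
- rewrite bidual_frameS /= (affine_frame_linear _ _ aphi Up).
  by rewrite (inj_eq (@lift_inj _ ord0)) eq_sym.
- by rewrite bidual_frameS phi0 /= linear_part_one.
- by rewrite bidual_frame0 /=; have [-> _] := phiS j.
- by rewrite bidual_frame0 phi0 eqxx.
Qed.

Lemma bidual_frame_local U X e : local_frame U e -> (forall p, U p -> asec_smooth_at X p) ->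
  local_frame U (bidual_frame X e).
Proof.
move=> le sX; have [phi aphi] := affine_frame_exists X le.
apply: (dual_frame_local hA hP (affine_frame_local hA hV hB le aphi sX)).
exact: bidual_frame_dual.
Qed.

Lemma bidual_affine_one (xi : 'I_r.+1 -> sec (bidual A)) p (k : 'rV[R]_r.+1) :
  xi ord0 p (affine_one (A p)) = 1 -> (forall i, xi (lift ord0 i) p (affine_one (A p)) = 0) ->
  (\sum_a k 0 a *: xi a p) (affine_one (A p)) = k 0 ord0.
Proof.
move=> x0 xS; rewrite sum_dualE big_ord_recl big1 => [|i _].
  by rewrite addr0 [LHS](_ : _ = k 0 ord0 * xi ord0 p (affine_one (A p)))// x0 mulr1.
by rewrite [LHS](_ : _ = k 0 (lift ord0 i) * xi (lift ord0 i) p (affine_one (A p)))// xS mulr0.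
Qed.

Lemma smooth_at_pairing (k : nat) (E : vbundle M k) (hE : vector_bundle E) (s : sec (dual_bundle E))
    U e i p : local_frame U e -> U p -> sec_smooth_at s p -> smooth_at (fun q => s q (e i q)) p.
Proof.
move=> le Up ss; have [f fe] := dual_frame_exists le; have [oU be _] := le.
apply: (smooth_at_eq hA oU Up (f := sec_coord f s i)).
  by move=> q Uq; rewrite /sec_coord (dual_bcoord _ _ (be q Uq) (fe q Uq)).
exact: (sec_smooth_coord i ss (dual_frame_local hA hE le fe) Up).
Qed.

(** An element of the bidual with value 1 or 0 on 1_A is a point of [A] or a vector of [V]. The
    smoothness of the resulting [X] and [e] is read off from their pairings with an affine frame of
    A^+. *)
Lemma bidual_frame_split U (xi : 'I_r.+1 -> sec (bidual A)) : local_frame U xi ->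
  (forall p, U p -> xi ord0 p (affine_one (A p)) = 1) ->
  (forall p, U p -> forall i, xi (lift ord0 i) p (affine_one (A p)) = 0) ->
  exists X e, [/\ local_frame U e, forall p, U p -> asec_smooth_at X p
    & forall p, U p -> forall a, xi a p = bidual_frame X e a p].
Proof.
move=> lxi x0 xS; have [oU bxi _] := lxi.
have bV p : exists b : 'I_r -> V p, is_basis b.
  by have [U' [b [[_ + _] U'p]]] := frame_at hV p => /(_ _ U'p); exists (fun i => b i p).
have [X XE] : exists X : asec A, forall p, U p -> xi ord0 p = incl_point (X p).
  have X p : {a : A p | U p -> xi ord0 p = incl_point a}.
    apply: cid; have [Up|nUp] := pselect (U p); last by have [a] := ainhab (A p); exists a.
    by have [b bb] := bV p; have [a ->] := bidual_point_affine bb (x0 p Up); exists a.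
  by exists (fun p => sval (X p)) => p; exact: (svalP (X p)).
have [e eE] : exists e : 'I_r -> sec V, forall i p, U p -> xi (lift ord0 i) p = incl_vector (A p) (e i p).
  have e (i : 'I_r) p : {v : V p | U p -> xi (lift ord0 i) p = incl_vector (A p) v}.
    apply: cid; have [Up|nUp] := pselect (U p); last by exists 0.
    by have [b bb] := bV p; have [v ->] := bidual_vector_affine bb (xS p Up i); exists v.
  by exists (fun i p => sval (e i p)) => i p; exact: (svalP (e i p)).
have sxi a p (Up : U p) := local_frame_smooth hA hQ a lxi Up.
exists X, e.
split.
- split=> // [p Up v|i].
    have [k [kE ku]] := bxi p Up (incl_vector (A p) v); have [b bb] := bV p.
    (* Pairing with 1_A shows that a vector has no component along e_0. *)
    have k0 : k 0 ord0 = 0.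
      by rewrite -(bidual_affine_one k (x0 p Up) (xS p Up)) -kE /= linear_part_one.
    exists (\row_i k 0 (lift ord0 i)); split.
      apply: (incl_vector_inj bb (S := A p)); rewrite kE big_ord_recl k0 scale0r add0r.
      by rewrite incl_vector_sum; apply: eq_bigr => i _; rewrite mxE eE.
    move=> l lE; have /ku -> : incl_vector (A p) v =
        \sum_a (\row_a (if unlift ord0 a is Some i then l 0 i else 0)) 0 a *: xi a p.
      rewrite big_ord_recl mxE unlift_none scale0r add0r lE incl_vector_sum.
      by apply: eq_bigr => i _; rewrite mxE liftK eE.
    by apply/rowP => i; rewrite !mxE liftK.
  apply/(smooth_sec_on_at hA hV) => // p Up.
  have [U' [om [b [phi [lb aphi U'p so lphi]]]]] := affine_frame_at hA hV hB p.
  have oUU : open (U `&` U') by apply: openI => //; case: lb.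
  apply: (sec_smooth_atP hA hV lb U'p oUU (conj Up U'p)) => q [Uq U'q] j.
  have := smooth_at_pairing hP (lift ord0 j) lphi U'q (sxi (lift ord0 i) q Uq).
  apply: (smooth_at_eq hA oUU (conj Uq U'q)) => y [Uy U'y]; rewrite eE//=.
  have [_ bb _] := lb; apply: (@dual_frame_bcoord _ _ _ (fun i => b i y) (fun j => linear_part (phi (lift ord0 j) y)) j _ (bb _ U'y)) => l l'.
  exact: (affine_frame_linear _ _ aphi).
- move=> p Up.
  have [U' [om [b [phi [lb aphi U'p so lphi]]]]] := affine_frame_at hA hV hB p.
  have oUU : open (U `&` U') by apply: openI => //; case: lb.
  have sd : sec_smooth_at (asec_diff om X) p.
    apply: (sec_smooth_atP hA hV lb U'p oUU (conj Up U'p)) => q [Uq U'q] j.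
    have := smooth_at_pairing hP (lift ord0 j) lphi U'q (sxi ord0 q Uq).
    apply: (smooth_at_eq hA oUU (conj Uq U'q)) => y [Uy U'y]; rewrite XE//=.
    rewrite {1}(adiffE (om y) (X y)) linear_partE; have [_ /(_ j)[-> _]] := aphi y U'y.
    rewrite add0r; have [_ bb _] := lb; apply: (@dual_frame_bcoord _ _ _ (fun i => b i y) (fun j => linear_part (phi (lift ord0 j) y)) j _ (bb _ U'y)) => l l'.
    exact: (affine_frame_linear _ _ aphi).
  apply: (asec_smooth_eq hA oUU (conj Up U'p) (X := fun q => om q +> asec_diff om X q)).
    by move=> q _; rewrite -adiffE.
  by apply: (asec_smooth_shift hA hV) => //; exact: so.
- move=> p Up a; case: (unliftP ord0 a) => [i|] ->; first by rewrite bidual_frameS eE.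
  by rewrite bidual_frame0 XE.
Qed.
End BidualFrames.

(** * The Lie algebroid V, the derivation D_X and the Hamiltonian vector fields *)

Section Affgebroid.
Context {R : realType} {n r : nat} {M : charted R n} {V : vbundle M r} {A : abundle V}.
Variable L : affgebroid A.
Hypotheses (hM : smooth_manifold M) (hV : vector_bundle V) (hB : affine_bundle A).
Hypothesis hL : lie_affgebroid L.
Let hA := manifold_atlas hM.
Let hD := dual_vector_bundle hA hV.
Let hP := aff_dual_vector_bundle hA hV hB.
Let hN := total_manifold hM hD.
Let hZ := total_manifold hM hP.
Local Notation N := (total_space (dual_bundle V)).
Local Notation Z := (total_space (aff_dual A)).

(** The anchor of [V], that is, the linear part of the affine anchor. By [anchor_shift] the base
    point X p has no influence on smooth functions. *)
Definition vector_anchor (X : asec A) (p : M) (v : V p) (f : M -> R) : R :=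
  la_anchor L (X p +> v) f - la_anchor L (X p) f.

Lemma anchor_shift X p (a : A p) v f : smooth_fun f ->
  la_anchor L (a +> v) f = la_anchor L a f + @vector_anchor X p v f.
Proof.
have [[_ [_ aff _]] _ _ _ _] := hL => sf; have /asboolP[l lE] := aff p f sf.
by rewrite /vector_anchor !lE; ring.
Qed.

(** The Leibniz rule of the bracket of [V] is not among the axioms. It results from expanding D_(X +
    Y) (f W) in two ways. *)
Lemma affgebroid_algebroid X : smooth_asec X -> lie_algebroid (la_br L) (vector_anchor X).
Proof.
have [[lbr [ta aff sa]] _ _ der mD] := hL => sX.
have ashift_smooth Y : smooth_sec Y -> smooth_asec (fun p => X p +> Y p).
  move=> /(smooth_secP hA hV) sY; apply/(smooth_asecP hA hV hB) => p.
  by apply: (asec_smooth_shift hA hV) => //; move: p; apply/(smooth_asecP hA hV hB).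
split=> //.
- move=> p v; rewrite /vector_anchor.
  have := tangent_add (ta _ (X p +> v)) (tangent_opp (ta _ (X p))); exact.
- move=> p k u v f sf; have /asboolP[l lE] := aff p f sf.
  by rewrite /vector_anchor !lE dualD dualZ; ring.
- move=> Y f sY sf; apply: (smooth_fun_sub hM); last exact: sa.
  apply: (sa (fun p => X p +> Y p)) => //; exact: ashift_smooth.
- move=> Y W f sY sW sf p; have sfW := smooth_sec_scale hA hV sf sW.
  have [_ DE] := der X Y W sX sY sW; have [_ DfE] := der X Y _ sX sY sfW.
  have := mD _ _ _ (ashift_smooth _ sY) sf sW p.
  rewrite DfE DE mD// scalerDr (anchor_shift X)// scalerDl -!addrA => /addrI E.
  apply: (@addrI _ (la_anchor L (X p) f *: W p)); rewrite E.
  by rewrite addrCA.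
Qed.

Lemma affgebroid_derivation X : smooth_asec X ->
  algebroid_derivation (la_br L) (fun f p => la_anchor L (X p) f) (la_D L X).
Proof.
have [[lbr [ta aff sa]] sD lD der mD] := hL => sX; split.
  split; [|by move=> Y sY; exact: sD|by move=> k Y W sY sW p; exact: lD|by move=> f Y sf sY p; exact: mD].
  by split=> [f sf|p]; [exact: sa|exact: ta].
by move=> Y W sY sW; have [] := der X Y W sX sY sW.
Qed.

(** The sign is that of h(x, y) = (x, -H, y): when [X] is e_0, [point_fun X] is the coordinate
    y_0. *)
Definition hamiltonian (X : asec A) (h : N -> Z) : N -> R := fun w => - point_fun X (h w).

Lemma hamiltonian_smooth X h : smooth_asec X -> av_section (@mu R n M r V A) h ->
  smooth_fun (hamiltonian X h).
Proof.
move=> /(smooth_asecP hA hV hB) sX [sh _]; apply: (smooth_fun_opp hN).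
apply: (smooth_map_fun (manifold_atlas hN) (manifold_atlas hZ) sh (g := point_fun X)).
apply/(smooth_funP (manifold_atlas hZ)) => z; exact: (smooth_at_point_fun hA hV hB).
Qed.

Lemma hamiltonian_shift X h f :
  hamiltonian X (sec_shift (@mu_shift R n M r V A) h f) = fun q => hamiltonian X h q - f q.
Proof. by apply/funext => q; rewrite /hamiltonian /sec_shift mu_shift_point opprD. Qed.

(** Replacing [X] by X + Y adds [Y, .] to D_X, and the term - l_Y found here contributes the
    opposite field. The Hamiltonian vector field is therefore independent of [X]. *)
Lemma hamiltonian_asec_shift X Y h w : av_section (@mu R n M r V A) h ->
  hamiltonian (fun p => X p +> Y p) h w = hamiltonian X h w - linear_fun Y w.
Proof.
move=> [_ hw]; rewrite /hamiltonian /point_fun linear_partE opprD; congr (_ - _).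
by rewrite -[in RHS](hw w).
Qed.

(* The Hamiltonian vector field does not depend on X0, so that X can be adapted
   to the local section e_0 in the Hamilton equations. *)
Lemma hamiltonian_field_exists :
  exists B, aff_poisson (@mu R n M r V A) (@mu_shift R n M r V A) B /\
  exists X0 P, [/\ smooth_asec X0, poisson P, linear_bracket (la_br L) (vector_anchor X0) P &
   forall h X, av_section (@mu R n M r V A) h -> smooth_asec X ->
    (forall f w, smooth_fun f -> affine_linear_part (@mu_shift R n M r V A) B h (basic_fun f) w =
       la_anchor L (X (projT1 w)) f + P (hamiltonian X h) (basic_fun f) w) /\
    (forall Y w, smooth_sec Y -> affine_linear_part (@mu_shift R n M r V A) B h (linear_fun Y) w =
       linear_fun (la_D L X Y) w + P (hamiltonian X h) (linear_fun Y) w)].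
Proof.
have [X0 sX0] := global_asec_exists hM hV hB.
have ha := affgebroid_algebroid sX0; have hd := affgebroid_derivation sX0.
have [P [bP hP' lP]] := linear_poisson_exists hM hV ha.
have [Xh [vX Xb Xl]] := covariant_lift hM hV hd.1.
have pX := covariant_preserves hM hV ha bP lP hd vX Xb Xl.
have sH h := @hamiltonian_smooth X0 h sX0.
have HS h f (_ : av_section (@mu R n M r V A) h) (_ : smooth_fun f) := hamiltonian_shift X0 h f.
exists (hamiltonian_bracket (hamiltonian X0) P Xh); split.
  exact: (hamiltonian_bracket_poisson hN hP' vX pX sH HS).
exists X0, P; split=> // h X ah sX; have [vP _ _] := hP'.
have sb f : smooth_fun f -> smooth_fun (@basic_fun R n r M V f) by exact: (basic_smooth hM hV).
have sl Y : smooth_sec Y -> smooth_fun (@linear_fun R n r M V Y) by exact: (linear_smooth hM hV).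
pose Y0 := asec_diff X0 X; have sY0 : smooth_sec Y0.
  apply/(smooth_secP hA hV) => p; apply: (asec_diff_smooth hA hV hB).
    by move: p; apply/(smooth_asecP hA hV hB).
  by move: p; apply/(smooth_asecP hA hV hB).
have XE : X = fun p => X0 p +> Y0 p.
  by apply/functional_extensionality_dep => p; rewrite -adiffE.
have HX : hamiltonian X h = fun w => hamiltonian X0 h w - linear_fun Y0 w.
  by apply/funext => w; rewrite XE hamiltonian_asec_shift.
have [P1 P2 P3 P4] := lP; have [[lbr [ta aff sa]] sD lD der mD] := hL.
have PX F w : smooth_fun F -> P (hamiltonian X h) F w =
    P (hamiltonian X0 h) F w - P (linear_fun Y0) F w.
  move=> sF; have [_ tP] := (bP _ sF).2; rewrite HX.
  by rewrite (tangentB hN (tP w))//; [exact: sH|exact: sl].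
split=> [f w sf|Y w sY].
  rewrite (hamiltonian_bracket_linear_part hN hP' vX sH HS)// ?PX ?Xb ?P3//; try by [exact: sb].
  rewrite [in RHS]XE (anchor_shift X0)// /basic_fun /anchor_field; ring.
rewrite (hamiltonian_bracket_linear_part hN hP' vX sH HS)// ?PX ?Xl ?P4//; try by [exact: sl].
rewrite [in RHS]XE /linear_fun (der _ _ _ sX0 sY0 sY).2 dualD; ring.
Qed.

End Affgebroid.

(** * Hamilton equations *)

Section BlockDerivatives.
Context {R : realType} {n r : nat}.
Variable H : 'rV[R]_n -> 'rV[R]_r -> R^o.
Let H2 (u : 'rV[R]_(n + r)) : R^o := H (lsubmx u) (rsubmx u).

Lemma delta_row_mxl i : delta_mx 0 (lshift r i) = row_mx (delta_mx 0 i) 0 :> 'rV[R]_(n + r).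
Proof.
apply/rowP => j; rewrite mxE; case: (split_ordP j) => k ->.
  by rewrite row_mxEl mxE (inj_eq (@lshift_inj _ _)).
by rewrite row_mxEr mxE eqxx/= eq_rlshift.
Qed.

Lemma delta_row_mxr i : delta_mx 0 (rshift n i) = row_mx 0 (delta_mx 0 i) :> 'rV[R]_(n + r).
Proof.
apply/rowP => j; rewrite mxE; case: (split_ordP j) => k ->.
  by rewrite row_mxEl mxE eqxx/= eq_lrshift.
by rewrite row_mxEr mxE (inj_eq (@rshift_inj _ _)).
Qed.

Lemma derive_blockl i x y : 'D_(delta_mx 0 (lshift r i)) H2 (row_mx x y) = 'D_(delta_mx 0 i) (H^~ y) x.
Proof.
have E : (fun t : R => t^-1 *: ((H2 \o shift (row_mx x y)) (t *: delta_mx 0 (lshift r i)) - H2 (row_mx x y))) =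
    fun t : R => t^-1 *: (((H^~ y) \o shift x) (t *: delta_mx 0 i) - (H^~ y) x).
  apply/funext => t /=.
  by rewrite /H2 delta_row_mxl scale_row_mx scaler0 add_row_mx add0r !row_mxKl !row_mxKr.
by rewrite /derive E.
Qed.

Lemma derive_blockr i x y : 'D_(delta_mx 0 (rshift n i)) H2 (row_mx x y) = 'D_(delta_mx 0 i) (H x) y.
Proof.
have E : (fun t : R => t^-1 *: ((H2 \o shift (row_mx x y)) (t *: delta_mx 0 (rshift n i)) - H2 (row_mx x y))) =
    fun t : R => t^-1 *: (((H x) \o shift y) (t *: delta_mx 0 i) - (H x) y).
  apply/funext => t /=.
  by rewrite /H2 delta_row_mxr scale_row_mx scaler0 add_row_mx add0r !row_mxKl !row_mxKr.
by rewrite /derive E.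
Qed.

End BlockDerivatives.

(** * Derivatives along curves *)

Section Curves.
Context {R : realType} {n : nat} {N : charted R n}.

(** Smooth curves are continuous for the atlas topology of [real_line R], while derivatives refer to
    the norm topology of [R^o]. The chart [const_mx] links the two. *)
Lemma curve_near (J : set R) (c : R -> N) (t : R) (W : set N) : smooth_curve J c -> J t ->
  open W -> W (c t) -> \forall s \near (t : R^o), W (c s).
Proof.
move=> [cc _] Jt oW Wt.
have : nbhs (t : real_line R) (c @^-1` W) := cc t Jt W (open_nbhs_nbhs (conj oW Wt)).
rewrite nbhsE => -[U [oU Ut] UW].
have [Q oQ] := (openP U).1 oU _ (erefl : atlas (c := real_line R) _).
rewrite setIT setTI => UE.
have cm : {for t : R^o, continuous (fun s : R^o => const_mx s : 'rV[R]_1)}.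
  apply: row_continuous => j.
  rewrite (_ : (fun s : R^o => _) = id); last by apply/funext => s; rewrite mxE.
  exact: cvg_id.
have Qt : Q (const_mx t) by have : U t by []; rewrite UE.
have nQ : nbhs (t : R^o) (fun s : R^o => Q (const_mx s)) := cm Q (open_nbhs_nbhs (conj oQ Qt)).
by apply: filterS nQ => s Qs; apply: UW; rewrite UE.
Qed.

End Curves.

Section GeneratorCurves.
Context {R : realType} {n r : nat} {M : charted R n} {V : vbundle M r}.
Hypotheses (hM : smooth_manifold M) (hV : vector_bundle V).
Let hA := manifold_atlas hM.
Let hD := dual_vector_bundle hA hV.
Let hN := total_manifold hM hD.
Let hTN := manifold_atlas hN.
Local Notation N := (total_space (dual_bundle V)).

(** Near c t, [F] is a function of the coordinates given by the generators. The chain rule along the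
    curve and the expansion [tangent_gen] of v F have the same coefficients. *)
Lemma curve_chain_rule (J : set R) (c : R -> N) (t : R) v W x e (F : N -> R) :
  smooth_curve J c -> J t -> tangent_vector (c t) v -> generators W x e -> W (projT1 (c t)) ->
  (forall i, is_derive (t : R^o) 1 (basic_fun (x i) \o c : R^o -> R^o) (v (basic_fun (x i)))) ->
  (forall a, is_derive (t : R^o) 1 (linear_fun (e a) \o c : R^o -> R^o) (v (linear_fun (e a)))) ->
  smooth_fun F -> is_derive (t : R^o) 1 (F \o c : R^o -> R^o) (v F).
Proof.
move=> sc Jt tv g Wt dx de sF; have [oW sx se mx le] := g.
have mc := gen_chart_maximal hM hV g; have oD := base_open hM hV oW.
pose u (s : R^o) : 'rV[R]_(n + r) := gen_coord x e (c s).
pose k : 'rV[R]_(n + r) := row_mx (\row_i v (basic_fun (x i))) (\row_a v (linear_fun (e a))).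
have du j : is_derive (t : R^o) 1 (fun s : R^o => u s 0 j : R^o) (k 0 j).
  case: (split_ordP j) => i ->; rewrite /k ?row_mxEl ?row_mxEr mxE.
    rewrite (_ : (fun s => _) = (basic_fun (x i) \o c)) //.
    by apply/funext => s; rewrite /u /gen_coord row_mxEl mxE.
  rewrite (_ : (fun s => _) = (linear_fun (e i) \o c)) //.
  by apply/funext => s; rewrite /u /gen_coord row_mxEr mxE.
have dvu : derivable u (t : R^o) 1.
  by apply/derivable_mxP => i j; rewrite (ord1 i); have [] := du j.
have Du : 'D_1 u (t : R^o) = k.
  by rewrite derive_mx//; apply/rowP => j; rewrite mxE; have [_ ->] := du j.
pose G := chart_rep (gen_chart W x e) F.
have oY := chart_imageW_open hTN mc oD (fun w Ww => Ww).
have dG : differentiable G (u t).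
  by apply: (smooth_in_differentiable oY (rep_smooth hM hV g sF)); exists (c t).
have := derive_comp dvu dG; rewrite Du derive_rV// => dGu.
apply: (@near_eq_is_derive _ R^o R^o (G \o u)).
  have := curve_near sc Jt oD Wt; apply: filterS => s Ws.
  exact: (chart_repE F mc Ws).
apply: (is_derive_eq dGu); rewrite (tangent_gen hM hV g tv Wt sF) big_split_ord /=.
by congr (_ + _); apply: eq_bigr => i _; rewrite /k ?row_mxEl ?row_mxEr mxE mulrC.
Qed.

End GeneratorCurves.

(** * The Hamiltonian vector field in local data *)

Section Hamilton.
Context {R : realType} {n r : nat} {M : charted R n} {V : vbundle M r} {A : abundle V}.
Variable L : affgebroid A.
Hypotheses (hM : smooth_manifold M) (hV : vector_bundle V) (hB : affine_bundle A).
Hypothesis hL : lie_affgebroid L.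
Let hA := manifold_atlas hM.
Let hD := dual_vector_bundle hA hV.
Let hP := aff_dual_vector_bundle hA hV hB.
Let hN := total_manifold hM hD.
Local Notation N := (total_space (dual_bundle V)).
Local Notation Z := (total_space (aff_dual A)).

(** Local data determine [v] only on global smooth functions that factor through the chart on its
    whole domain. The cut-off coordinate [x i] factors through its own [chart_rep], which is the
    i-th coordinate near d p. *)
Lemma chart_derivation_coord (d : chart R n M) W x p (v : (M -> R) -> R) (k : 'I_n -> R) i :
  maximal_atlas d -> open W -> W p -> W `<=` chart_dom d -> (forall i, smooth_fun (x i)) ->
  (forall q, W q -> \row_i x i q = d q) ->
  (forall (f : M -> R) (g : 'rV[R]_n -> R^o), smooth_fun f ->
    (forall q, chart_dom d q -> f q = g (d q)) ->
    v f = \sum_(j < n) k j * 'D_(delta_mx 0 j) g (d p)) ->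
  v (x i) = k i.
Proof.
move=> md oW Wp Wd sx xE vE; have oY := chart_imageW_open hA md oW Wd.
rewrite (vE (x i) (chart_rep d (x i)))//; last by move=> q dq; rewrite chart_repE.
have Dg j : 'D_(delta_mx 0 j) (chart_rep d (x i)) (d p) = (i == j)%:R.
  rewrite (@near_eq_derive _ _ _ _ (fun y : 'rV[R]_n => y 0 i : R^o)) ?derive_coord ?mxE ?eqxx//.
  apply: (open_near_eq oY (ex_intro2 _ _ p Wp erefl)) => y [q Wq <-].
  by rewrite chart_repE; [rewrite -xE// mxE|exact: md|exact: Wd].
rewrite (bigD1 i)//= Dg eqxx mulr1 big1 ?addr0// => j ji.
by rewrite Dg eq_sym (negbTE ji) mulr0.
Qed.

Definition position_rate (d : local_data A) (H : 'rV[R]_n -> 'rV[R]_r -> R^o) (w : N) (i : 'I_n) : R :=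
  let p := projT1 w in
  ld_rho d ord0 i p + \sum_(b < r) 'D_(delta_mx 0 b) (H (ld_x d p)) (ld_y d w) * ld_rho d (lift ord0 b) i p.

Definition momentum_rate (d : local_data A) (H : 'rV[R]_n -> 'rV[R]_r -> R^o) (w : N) (a : 'I_r) : R :=
  let p := projT1 w in
  - (\sum_(i < n) ld_rho d (lift ord0 a) i p * 'D_(delta_mx 0 i) (H^~ (ld_y d w)) (ld_x d p)) +
  \sum_(g < r) ld_y d w ord0 g * (ld_C d ord0 a g p +
    \sum_(b < r) ld_C d (lift ord0 b) a g p * 'D_(delta_mx 0 b) (H (ld_x d p)) (ld_y d w)).

Variables (X0 : asec A) (P : (N -> R) -> (N -> R) -> (N -> R)).
Hypotheses (sX0 : smooth_asec X0) (hP' : poisson P)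
  (lP : linear_bracket (la_br L) (vector_anchor L X0) P).
Variables (h : N -> Z) (XH : (N -> R) -> N -> R).
Hypothesis ah : av_section (@mu R n M r V A) h.
Hypothesis XHb : forall X f w, smooth_asec X -> smooth_fun f ->
  XH (basic_fun f) w = la_anchor L (X (projT1 w)) f + P (hamiltonian X h) (basic_fun f) w.
Hypothesis XHl : forall X Y w, smooth_asec X -> smooth_sec Y ->
  XH (linear_fun Y) w = linear_fun (la_D L X Y) w + P (hamiltonian X h) (linear_fun Y) w.

(** The chart and the frame of [d] are only local. They are replaced near [z] by global functions
    [x], sections [e] of [V] and a section [X] of [A], to which the formulas [XHb] and [XHl]
    apply. *)
Lemma hamilton_rates d H (z : N) : is_local_data L d -> local_hamiltonian d h H ->
  chart_dom (ld_x d) (projT1 z) -> exists W x e, [/\ generators W x e, W (projT1 z),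
    forall w : N, W (projT1 w) -> forall i, basic_fun (x i) w = ld_x d (projT1 w) 0 i,
    forall w : N, W (projT1 w) -> forall a, linear_fun (e a) w = ld_y d w 0 a &
    (forall i, XH (basic_fun (x i)) z = position_rate d H z i) /\
    (forall a, XH (linear_fun (e a)) z = momentum_rate d H z a)].
Proof.
move=> [[md lxi x0 xS] yE rhoE CE] HE; set p := projT1 z => Up.
pose U := chart_dom (ld_x d).
have [Xl [e0 [le0 sXl xiE]]] := bidual_frame_split hA hV hB lxi x0 xS.
have [W [x [e [g Wp WU xE eE]]]] := generators_of_local hM hV md Up le0 Up.
have [oW sx se mx le] := g.
have WU' q : W q -> U q by move=> /WU[].
(* A section of an affine bundle cannot be multiplied by a bump function, so its difference to the
   global section [X0] is extended instead. *)
have [X [sX [W2 [oW2 W2p XE]]]] : exists X, smooth_asec X /\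
    exists W2 : set M, [/\ open W2, W2 p & forall q, W2 q -> X q = Xl q].
  have oU : open U by case: lxi.
  have sY q : U q -> sec_smooth_at (asec_diff X0 Xl) q.
    move=> Uq; apply: (asec_diff_smooth hA hV hB); last exact: sXl.
    by move: q {Uq}; apply/(smooth_asecP hA hV hB).
  have [Y [sY' [W2 [oW2 W2p YE]]]] := sec_extend hM hV oU Up sY.
  exists (fun q => X0 q +> Y q); split.
    apply/(smooth_asecP hA hV hB) => q; apply: (asec_smooth_shift hA hV).
      by move: q; apply/(smooth_asecP hA hV hB).
    by move: q; apply/(smooth_secP hA hV).
  by exists W2; split=> // q W2q; rewrite YE// -adiffE.
have oW3 : open (W `&` W2) by exact: openI.
have xi0 q : (W `&` W2) q -> ld_e d ord0 q = incl_point (X q).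
  by move=> [Wq W2q]; rewrite (xiE q (WU' _ Wq)) bidual_frame0 XE.
have xil b q : W q -> ld_e d (lift ord0 b) q = incl_vector (A q) (e b q).
  by move=> Wq; rewrite (xiE q (WU' _ Wq)) bidual_frameS eE.
have rho0 i : la_anchor L (X p) (x i) = ld_rho d ord0 i p.
  apply: (@chart_derivation_coord (ld_x d) W x p (la_anchor L (X p)) (fun i => ld_rho d ord0 i p) i md oW Wp WU' sx xE).
  by apply: (rhoE p Up ord0); rewrite xi0//; exact: bidual_anchor_point.
have rhol b i : vector_anchor L X0 (e b p) (x i) = ld_rho d (lift ord0 b) i p.
  apply: (@chart_derivation_coord (ld_x d) W x p (vector_anchor L X0 (e b p)) (fun i => ld_rho d (lift ord0 b) i p) i md oW Wp WU' sx xE).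
  by apply: (rhoE p Up (lift ord0 b)); rewrite xil//; exact: bidual_anchor_vector.
have bp : is_basis (fun i => e i p) by case: le => _ /(_ _ Wp).
have nearE (W' : set M) (Q : M -> Prop) : open W' -> W' p -> (forall q, W' q -> Q q) -> \forall q \near p, Q q.
  by move=> oW' W'p WQ; apply: filterS WQ _; exact: open_nbhs_nbhs.
have C0 b : la_D L X (e b) p = \sum_c ld_C d ord0 b c p *: e c p.
  apply: (incl_vector_inj bp (S := A p)); rewrite incl_vector_sum.
  rewrite (CE p Up ord0 b _ _ _ (bidual_bracket_point L sX (se b))).
  - by apply: eq_bigr => c _; rewrite xil.
  - by apply: (nearE _ _ oW3) => // q Wq; rewrite xi0.
  - by apply: (nearE _ _ oW) => // q Wq; rewrite xil.
have Cl a b : la_br L (e a) (e b) p = \sum_c ld_C d (lift ord0 a) b c p *: e c p.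
  apply: (incl_vector_inj bp (S := A p)); rewrite incl_vector_sum.
  rewrite (CE p Up (lift ord0 a) b _ _ _ (bidual_bracket_vector L (se a) (se b))).
  - by apply: eq_bigr => c _; rewrite xil.
  - by apply: (nearE _ _ oW) => // q Wq; rewrite xil.
  - by apply: (nearE _ _ oW) => // q Wq; rewrite xil.
have xW (w : N) : W (projT1 w) -> forall i, basic_fun (x i) w = ld_x d (projT1 w) 0 i.
  by move=> Ww i; rewrite -xE// mxE.
have yW (w : N) : W (projT1 w) -> forall a, linear_fun (e a) w = ld_y d w 0 a.
  move=> Ww a; have := yE (mu_lift X0 w 0) (WU' _ Ww) a; rewrite mu_lift_mu => ->.
  by rewrite /fibre_coord xil//= mu_lift_part.
exists W, x, e; split=> //.
pose HX := hamiltonian X h; have sHX : smooth_fun HX by exact: (hamiltonian_smooth hM hV hB).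
have gE (w : N) : W (projT1 w) -> gen_coord x e w = row_mx (ld_x d (projT1 w)) (ld_y d w).
  by move=> Ww; rewrite /gen_coord xE//; congr row_mx; apply/rowP => a; rewrite mxE yW.
have mc := gen_chart_maximal hM hV g.
have oD : open [set w : N | (W `&` W2) (projT1 w)] by exact: base_open.
have HXE (w : N) : (W `&` W2) (projT1 w) -> HX w = H (ld_x d (projT1 w)) (ld_y d w).
  move=> Ww; have hw : projT1 (h w) = projT1 w by rewrite -[in RHS](ah.2 w).
  apply: oppr_inj; rewrite -HE; last exact: WU' Ww.1.
  by rewrite /HX /hamiltonian opprK /fibre_coord xi0// hw.
have DH j : partial_gen W x e HX j z =
    'D_(delta_mx 0 j) (fun u : 'rV[R]_(n + r) => H (lsubmx u) (rsubmx u) : R^o)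
      (row_mx (ld_x d p) (ld_y d z)).
  rewrite /partial_gen gE//; apply: near_eq_derive.
  have oY := chart_imageW_open (manifold_atlas hN) mc oD (fun w Ww => Ww.1).
  apply: (open_near_eq oY); first by exists z => //; rewrite /= gE.
  move=> y [w [Ww W2w] <-]; rewrite chart_repE// HXE//.
  by rewrite -[gen_chart W x e w]/(gen_coord x e w) gE// row_mxKl row_mxKr.
have [vP aP _] := hP'; have [P1 P2 P3 P4] := lP.
have sb i := basic_smooth hM hV (sx i); have sl a := linear_smooth hM hV (se a).
(* Antisymmetry moves [HX] to the slot where [P F] acts as a tangent vector, which is then expanded
   on the generators. *)
have PH F : smooth_fun F -> P HX F z = - (
    \sum_j 'D_(delta_mx 0 j) (H^~ (ld_y d z)) (ld_x d p) * P F (basic_fun (x j)) z +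
    \sum_b 'D_(delta_mx 0 b) (H (ld_x d p)) (ld_y d z) * P F (linear_fun (e b)) z).
  move=> sF; rewrite aP//; congr (- _).
  rewrite (tangent_gen hM hV g ((vP _ sF).2 z) Wp sHX).
  by congr (_ + _); apply: eq_bigr => j _; rewrite DH ?derive_blockl ?derive_blockr.
split=> [i|a].
  rewrite (XHb z sX)// PH// rho0 /position_rate; congr (_ + _).
  rewrite opprD big1 ?oppr0 ?add0r => [|j _]; last by rewrite P1// mulr0.
  rewrite -sumrN; apply: eq_bigr => b _.
  by rewrite P2// /basic_fun /anchor_field rhol mulrN opprK.
rewrite (XHl z sX)// PH// /momentum_rate opprD addrCA; congr (_ + _).
  by congr (- _); apply: eq_bigr => j _; rewrite P3// /basic_fun /anchor_field rhol mulrC.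
have lE (k : 'I_r -> R) Y : Y p = \sum_c k c *: e c p ->
    linear_fun Y z = \sum_c k c * ld_y d z 0 c.
  move=> YE; rewrite /linear_fun YE dual_sum; apply: eq_bigr => c _.
  by rewrite dualZ -yW.
rewrite (lE _ _ (C0 a)) -sumrN.
transitivity (\sum_c ld_C d ord0 a c p * ld_y d z 0 c +
  \sum_c \sum_b ld_y d z 0 c * (ld_C d (lift ord0 b) a c p * 'D_(delta_mx 0 b) (H (ld_x d p)) (ld_y d z))).
  congr (_ + _); rewrite exchange_big /=; apply: eq_bigr => b _.
  (* [e_a, e_b] is turned into - [e_b, e_a] to match the index order of C_(beta alpha) in the
     equations. *)
  have [[[_ _ aB _] _] _ _ _ _] := hL.
  rewrite P4// /linear_fun aB// dualN mulrN opprK -/(linear_fun _ z) (lE _ _ (Cl b a)) mulr_sumr.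
  by apply: eq_bigr => c _; ring.
by rewrite -big_split /=; apply: eq_bigr => c _; rewrite mulrDr mulr_sumr mulrC.
Qed.

End Hamilton.

(** * Locality of the operators and existence of local data *)

Section Locality.
Context {R : realType} {n r : nat} {M : charted R n} {V : vbundle M r}.
Hypotheses (hM : smooth_manifold M) (hV : vector_bundle V).
Let hA := manifold_atlas hM.

(** Pairing [D] with a covector gives compatible data at that covector, which are local. Covectors
    separate the vectors of a fibre. *)
Lemma covariant_near rho D (Y Y' : sec V) (p : M) : covariant_operator rho D -> smooth_sec Y ->
  smooth_sec Y' -> (\forall q \near p, Y q = Y' q) -> D Y p = D Y' p.
Proof.
move=> cD sY sY' nE; have : nbhs p (fun q => Y q = Y' q) := nE; rewrite nbhsE => -[U [oU Up] UE].
have [U' [e [[_ + _] U'p]]] := frame_at hV p => /(_ _ U'p) be.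
apply: (dual_separates be) => phi.
pose z : total_space (dual_bundle V) := existT (fun x => dual_bundle V x) p phi.
exact: (compatible_local hM hV (covariant_compatible z cD) oU (Up : U (projT1 z)) sY sY' UE).
Qed.

Lemma tangent_chart_coord W (x : 'I_n -> M -> R) p (v : (M -> R) -> R) f (g : 'rV[R]_n -> R^o) :
  tangent_vector p v -> open W -> W p -> (forall i, smooth_fun (x i)) ->
  maximal_atlas (base_chart W x) -> smooth_fun f ->
  (forall q, W q -> f q = g (base_chart W x q)) ->
  v f = \sum_i v (x i) * 'D_(delta_mx 0 i) g (base_chart W x p).
Proof.
move=> tv oW Wp sx mx sf fE.
have oY := chart_imageW_open hA mx oW (fun q Wq => Wq).
have sg : smooth_in (base_chart W x @` W) g.
  apply: (smooth_in_eq oY (f := chart_rep (base_chart W x) f)).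
    by move=> _ [q Wq <-]; rewrite chart_repE// fE.
  move=> vs y [q Wq <-]; have /(smooth_funP hA)/(_ q) sfq := sf.
  exact: (smooth_at_in sfq mx Wq).
have xE j : (fun q => (base_chart W x q) 0 j) = x j by apply/funext => q; rewrite mxE.
rewrite (@tangent_comp _ _ _ hM p v tv _ (base_chart W x) _ g f W _ oY)//.
- by apply: eq_bigr => i _; rewrite mulrC xE.
- by move=> j; rewrite xE.
Qed.

End Locality.

Section LocalData.
Context {R : realType} {n r : nat} {M : charted R n} {V : vbundle M r} {A : abundle V}.
Variable L : affgebroid A.
Hypotheses (hM : smooth_manifold M) (hV : vector_bundle V) (hB : affine_bundle A).
Hypothesis hL : lie_affgebroid L.
Let hA := manifold_atlas hM.
Local Notation N := (total_space (dual_bundle V)).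
Local Notation Z := (total_space (aff_dual A)).

(** An inversion with an explicit equation on the index, so that [xi] may be a compound term such as
    a value of a frame. *)
Lemma bidual_anchorP x (xi : bidual A x) v : bidual_anchor L xi v ->
  (exists2 a, xi = incl_point a & v = la_anchor L a) \/
  (exists a u, xi = incl_vector (A x) u /\ v = fun f => la_anchor L (a +> u) f - la_anchor L a f).
Proof. by case=> [a|a u]; [left; exists a|right; exists a, u]. Qed.

Lemma incl_point_vector x (a : A x) (u : V x) : incl_point a <> incl_vector (A x) u.
Proof.
move=> /(congr1 (fun xi : dual _ => xi (affine_one (A x)))) /=.
by rewrite linear_part_one => /eqP; rewrite oner_eq0.
Qed.

(** Locality in [Y] is that of a covariant operator. For [X], the difference of the two operators is
    the bracket with X - X', a section that vanishes near [p]. *)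
Lemma affgebroid_near (X X' : asec A) (Y Y' : sec V) p : smooth_asec X -> smooth_asec X' ->
  smooth_sec Y -> smooth_sec Y' -> (\forall q \near p, X q = X' q) ->
  (\forall q \near p, Y q = Y' q) -> la_D L X Y p = la_D L X' Y' p.
Proof.
move=> sX sX' sY sY' nX nY; have [[lbr _] sD lD der mD] := hL.
have ha := affgebroid_algebroid hM hV hB hL sX'.
rewrite (covariant_near hM hV (affgebroid_derivation hL sX).1 sY sY' nY).
pose Y0 := asec_diff X' X; have sY0 : smooth_sec Y0.
  apply/(smooth_secP hA hV) => q; apply: (asec_diff_smooth hA hV hB).
    by move: q; apply/(smooth_asecP hA hV hB).
  by move: q; apply/(smooth_asecP hA hV hB).
rewrite (_ : X = fun q => X' q +> Y0 q); last first.
  by apply/functional_extensionality_dep => q; rewrite -adiffE.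
rewrite (der _ _ _ sX' sY0 sY').2; have [_ _ aB _] := lbr.
have s0 : smooth_sec (fun q : M => 0 : V q).
  by apply/(smooth_secP hA hV) => q; exact: (sec_smooth0 hA).
have cY := bracket_covariant hM hV ha sY'.
rewrite aB// (covariant_near hM hV cY sY0 s0); last first.
  by apply: filterS nX => q XE; rewrite /Y0 /asec_diff XE adiffxx.
have [_ _ lY _] := cY; have := lY (-1) _ _ s0 s0 p.
rewrite (_ : (fun q => _) = fun q : M => 0 : V q); last first.
  by apply/functional_extensionality_dep => q; rewrite scaler0 addr0.
by rewrite scaleN1r addNr => ->; rewrite oppr0 addr0.
Qed.

(** Solutions are defined by quantifying over all local data, so the implication from solutions to
    integral curves needs some data around each point. They are built from global sections, to which
    the bracket and D_X can be applied directly. *)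
Lemma local_data_exists (X : asec A) (h : N -> Z) p : smooth_asec X -> exists (d : local_data A) H,
  [/\ is_local_data L d, local_hamiltonian d h H & chart_dom (ld_x d) p].
Proof.
move=> sX; have [W [x [e [g Wp]]]] := generators_at hM hV p.
have [oW sx se mx le] := g; have [_ be _] := le.
have ha := affgebroid_algebroid hM hV hB hL sX.
have sX' q : asec_smooth_at X q by move: q; apply/(smooth_asecP hA hV hB).
have mc := gen_chart_maximal hM hV g.
have [[_ [ta aff _]] _ _ _ _] := hL.
pose rho (a : 'I_r.+1) i q := if unlift ord0 a is Some b then vector_anchor L X (e b q) (x i)
  else la_anchor L (X q) (x i).
pose K (a : 'I_r.+1) b c q := bcoord (fun i => e i q)
  (if unlift ord0 a is Some a' then la_br L (e a') (e b) q else la_D L X (e b) q) 0 c.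
pose d := {| ld_x := base_chart W x ; ld_e := bidual_frame X e ;
  ld_y := fun w : N => \row_a linear_fun (e a) w ; ld_rho := rho ; ld_C := K |}.
exists d, (fun u v => chart_rep (gen_chart W x e) (hamiltonian X h) (row_mx u v)); split=> //; last first.
  move=> w Ww /=; rewrite -[row_mx _ _]/(gen_chart W x e w) (chart_repE _ mc Ww) opprK.
  by rewrite /fibre_coord bidual_frame0.
(* [bidual_anchor] and [bidual_bracket] mention arbitrary points, vectors and sections whose images
   agree with the frame. Injectivity of the inclusions identifies them with [X] and the [e b]. *)
have xiS q (a : 'I_r.+1) (u : V q) : bidual_frame X e a q = incl_vector (A q) u -> W q ->
    exists2 b, a = lift ord0 b & u = e b q.
  case: (unliftP ord0 a) => [b|] ->; last by rewrite bidual_frame0 => /incl_point_vector.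
  by rewrite bidual_frameS => E Wq; exists b => //; rewrite (incl_vector_inj (be _ Wq) E).
have xi0 q (a : 'I_r.+1) (y : A q) : bidual_frame X e a q = incl_point y -> W q ->
    a = ord0 /\ y = X q.
  case: (unliftP ord0 a) => [b|] ->; first by rewrite bidual_frameS => /esym/incl_point_vector.
  by rewrite bidual_frame0 => E Wq; split=> //; rewrite (incl_point_inj (be _ Wq) E).
split=> /=.
- split=> //; first exact: (bidual_frame_local hA hV hB le (fun q _ => sX' q)).
    by move=> q Wq; rewrite bidual_frame0.
  by move=> q Wq i; rewrite bidual_frameS /= linear_part_one.
- by move=> z Wz i; rewrite mxE /fibre_coord bidual_frameS.
- move=> q Wq a v /bidual_anchorP[[y yE ->]|[y [u [uE ->]]]] f G sf fE.
    have [-> ->] := xi0 _ _ _ yE Wq.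
    rewrite (tangent_chart_coord hM (ta _ _) oW Wq sx mx sf fE).
    by apply: eq_bigr => i _; rewrite /rho unlift_none.
  have [b -> ->] := xiS _ _ _ uE Wq.
  rewrite (anchor_shift hL X)// addrC addKr.
  have [_ tV _ _ _] := ha.
  rewrite (tangent_chart_coord hM (tV _ _) oW Wq sx mx sf fE).
  by apply: eq_bigr => i _; rewrite /rho liftK.
have nW q (Q : M -> Prop) : W q -> (\forall q' \near q, Q q') -> \forall q' \near q, Q q' /\ W q'.
  by move=> Wq nQ; apply: filterI nQ _; exact: open_nbhs_nbhs.
move=> q Wq a b s t w sw; case: sw => [Y Z' sY sZ|Y Z' sY sZ] ns nt.
  have [a0 _] := xi0 _ _ _ (esym (nbhs_singleton ns)) Wq; subst a.
  rewrite (@affgebroid_near Y X Z' (e b))//.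
  - rewrite {1}(bcoordE (la_D L X (e b) q) (be _ Wq)) incl_vector_sum.
    by apply: eq_bigr => c _; rewrite bidual_frameS /K unlift_none.
  - by apply: filterS (nW _ _ Wq ns) => q' [E Wq']; have [_ ->] := xi0 _ _ _ (esym E) Wq'.
  - apply: filterS (nW _ _ Wq nt) => q' [E Wq'].
    by have [b' /lift_inj -> ->] := xiS _ _ _ (esym E) Wq'.
have [a' aE _] := xiS _ _ _ (esym (nbhs_singleton ns)) Wq; subst a.
have nY : \forall q' \near q, Y q' = e a' q'.
  apply: filterS (nW _ _ Wq ns) => q' [E Wq'].
  by have [b' /lift_inj -> ->] := xiS _ _ _ (esym E) Wq'.
have nZ : \forall q' \near q, Z' q' = e b q'.
  apply: filterS (nW _ _ Wq nt) => q' [E Wq'].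
  by have [b' /lift_inj -> ->] := xiS _ _ _ (esym E) Wq'.
rewrite (covariant_near hM hV (bracket_covariant hM hV ha sY) sZ (se b) nZ).
have [[[_ _ aB _] _] _ _ _ _] := hL.
rewrite aB// (covariant_near hM hV (bracket_covariant hM hV ha (se b)) sY (se a') nY) -aB//.
rewrite {1}(bcoordE (la_br L (e a') (e b) q) (be _ Wq)) incl_vector_sum.
by apply: eq_bigr => c _; rewrite bidual_frameS /K liftK.
Qed.

End LocalData.

Theorem theorem3p2 (R : realType) (n r : nat) (M : charted R n)
    (V : vbundle M r) (A : abundle V) (L : affgebroid A)
    (hM : smooth_manifold M) (hV : vector_bundle V) (hA : affine_bundle A)
    (hL : lie_affgebroid L) :
  av_bundle (@mu R n M r V A) (@mu_shift R n M r V A) /\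
  exists B : (total_space (dual_bundle V) -> total_space (aff_dual A)) ->
             (total_space (dual_bundle V) -> total_space (aff_dual A)) ->
             (total_space (dual_bundle V) -> R),
    aff_poisson (@mu R n M r V A) (@mu_shift R n M r V A) B /\
    forall h, av_section (@mu R n M r V A) h ->
      vector_field
        (hamiltonian_vector_field (@mu_shift R n M r V A) B h) /\
      forall (J : set R) (c : R -> total_space (dual_bundle V)),
        open J -> is_interval J -> smooth_curve J c ->
        (integral_curve
           (hamiltonian_vector_field (@mu_shift R n M r V A) B h) J c <->
         hamilton_solution L h J c).
Proof.
split; first exact: mu_av_bundle.
have [B [aB [X0 [P [sX0 hP lP fieldE]]]]] := hamiltonian_field_exists hM hV hA hL.
exists B; split=> // h ah; have [_ _ _ _ /(_ h ah) vX] := aB; split=> // J c oJ iJ sc.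
have rates d H z := @hamilton_rates _ _ _ _ _ _ L hM hV hA hL X0 P sX0 hP lP h _ ah
  (fun X f w sX => (fieldE h X ah sX).1 f w) (fun X Y w sX => (fieldE h X ah sX).2 Y w) d H z.
(* The coordinates of [d] agree along the curve, near [t], with global generators, on which the
   integral curve can be tested. *)
split=> [ic t Jt d H ld lh dt|hs t Jt F sF].
  have [W [x [e [g Wt xE eE [Xx Xe]]]]] := rates d H (c t) ld lh dt.
  have [oW sx se _ _] := g; have nW := curve_near sc Jt (base_open hM hV oW) Wt.
  split=> [i|a].
    apply: (@near_eq_is_derive _ R^o R^o (basic_fun (x i) \o c)).
      by apply: filterS nW => s Ws; exact: xE.
    exact: (is_derive_eq (ic t Jt _ (basic_smooth hM hV (sx i))) (Xx i)).
  apply: (@near_eq_is_derive _ R^o R^o (linear_fun (e a) \o c)).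
    by apply: filterS nW => s Ws; exact: eE.
  exact: (is_derive_eq (ic t Jt _ (linear_smooth hM hV (se a))) (Xe a)).
(* Conversely, the equations in one system of local data give the derivatives of the generators
   along the curve, and these determine that of every [F]. *)
have [d [H [ld lh dt]]] := local_data_exists hM hV hA hL h (projT1 (c t)) sX0.
have [Hx Hy] := hs t Jt d H ld lh dt.
have [W [x [e [g Wt xE eE [Xx Xe]]]]] := rates d H (c t) ld lh dt.
have [oW _ _ _ _] := g; have nW := curve_near sc Jt (base_open hM hV oW) Wt.
apply: (curve_chain_rule hM hV sc Jt (vX.2 (c t)) g Wt _ _ sF) => [i|a].
  rewrite Xx; apply: near_eq_is_derive (Hx i).
  by apply: filterS nW => s Ws; rewrite /= xE.
rewrite Xe; apply: near_eq_is_derive (Hy a).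
by apply: filterS nW => s Ws; rewrite /= eE.
Qed.
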